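(* For every $\eta>0$ there exists $c\in\mathbb{N}$ such that the following holds. Let $f:\{0,1\}^m\to\{0,1\}$ and $g:\{0,1\}^n\to\{0,1\}$ be non-constant monotone functions. Suppose that there exist a search problem $S\subseteq\{0,1\}^\ell\times\mathcal{O}$ and a function $\mathrm{gd}:\{0,1\}^t\times\{0,1\}^t\to\{0,1\}$ of input length $t\ge c\cdot\log(m\cdot\ell)$ and discrepancy $\mathrm{disc}(\mathrm{gd})\le 2^{-\eta\cdot t}$, such that the lifted search problem $S\diamond\mathrm{gd}$ reduces to $\mathit{mKW}_g$. Then $$\log \mathsf{L}(\mathit{mKW}_f\diamond \mathit{mKW}_g)\;\ge\;\log\mathsf{L}(\mathit{mKW}_f)+\Omega(\mathsf{Q}(S)\cdot t).$$
   Context: All logarithms are base 2. Asymptotic convention: $A\ge B+\Omega(E)$ means that there are constants $\kappa>0$ and $N_0$ (here depending only on $\eta$) such that $A\ge B+\kappa E$ whenever $E\ge N_0$. A search problem $S\subseteq\mathcal{I}\times\mathcal{O}$ (finite sets) is the task: given $z\in\mathcal{I}$, find $o\in S(z)=\{o:(z,o)\in S\}$; $S(z)$ is assumed non-empty for all $z$. For $\mathcal{I}=\{0,1\}^\ell$, $\mathsf{Q}(S)$ is the minimal depth of a deterministic decision tree (querying individual input bits) that outputs an element of $S(z)$ on every $z$. A communication problem $P\subseteq\mathcal{X}\times\mathcal{Y}\times\mathcal{O}$: Alice gets $x\in\mathcal{X}$, Bob gets $y\in\mathcal{Y}$, and they must output some $o$ with $(x,y,o)\in P$. Protocols are deterministic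 binary protocol trees; $\mathsf{L}(P)$ is the minimal number of leaves of a protocol solving $P$. For a non-constant monotone $h:\{0,1\}^N\to\{0,1\}$, $\mathit{mKW}_h$ is the communication problem in which Alice gets $x\in h^{-1}(1)$, Bob gets $y\in h^{-1}(0)$, and they must find $i\in[N]$ with $x_i>y_i$. The composition $f\diamond g:(\{0,1\}^n)^m\to\{0,1\}$ is $f\diamond g(x_1,\dots,x_m)=f(g(x_1),\dots,g(x_m))$, and $\mathit{mKW}_f\diamond\mathit{mKW}_g$ denotes $\mathit{mKW}_{f\diamond g}$. With $\Lambda=\{0,1\}^t$, the lifted search problem $S\diamond\mathrm{gd}\subseteq\Lambda^\ell\times\Lambda^\ell\times\mathcal{O}$ is the communication problem whose solutions on $(x,y)$ are $S(\mathrm{gd}(x_1,y_1),\dots,\mathrm{gd}(x_\ell,y_\ell))$. Discrepancy: for $\boldsymbol u,\boldsymbol v$ independent uniform over $\Lambda$ and a combinatorial rectangle $R\subseteq\Lambda\times\Lambda$, $\mathrm{disc}(\mathrm{gd},R)=|\Pr[\mathrm{gd}(\boldsymbol u,\boldsymbol v)=0\text{ and }(\boldsymbol u,\boldsymbol v)\in R]-\Pr[\mathrm{gd}(\boldsymbol u,\boldsymbol v)=1\text{ and }(\boldsymbol u,\boldsymbol v)\in R]|$, and $\mathrm{disc}(\mathrm{gd})=\max_R\mathrm{disc}(\mathrm{gd},R)$. A reduction from $P\subseteq\mathcal{X}\times\mathcal{Y}\times\mathcal{O}$ to $P'\subseteq\mathcal{X}'\times\mathcal{Y}'\times\mathcal{O}'$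 consists of functions $R_A:\mathcal{X}\to\mathcal{X}'$, $R_B:\mathcal{Y}\to\mathcal{Y}'$, $R_{\text{out}}:\mathcal{O}'\to\mathcal{O}$ such that for all $x,y,o'$: if $o'$ is a solution of $P'$ on $(R_A(x),R_B(y))$ then $R_{\text{out}}(o')$ is a solution of $P$ on $(x,y)$. *)

(* Defs.v *)
From HB Require Import structures.
From mathcomp Require Import all_boot all_order all_algebra.
From mathcomp Require Import all_classical all_reals all_analysis.

Set Implicit Arguments.
Unset Strict Implicit.
Unset Printing Implicit Defensive.

Import Order.TTheory GRing.Theory Num.Theory.

Local Open Scope ring_scope.

(* {0,1}^I for a finite index set I; {0,1}^n is [cube 'I_n]. *)
Notation cube I := {ffun I -> bool}.

Definition log2 (R : realType) (x : R) : R := ln x / ln 2.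

(* The least element of A, with the junk value 0 when A is empty. The sets it
   is applied to below are nonempty for every search problem with no empty
   S(z), and for mKW_h with h monotone and non-constant. *)
Definition nat_least (A : nat -> Prop) : nat :=
  if pselect (exists k, `[< A k >]) is left exA then ex_minn exA else 0%N.

Definition cube_monotone (I : finType) (h : cube I -> bool) : Prop :=
  forall x y : cube I, (forall i, (x i <= y i)%N) -> (h x <= h y)%N.

Definition cube_nonconstant (I : finType) (h : cube I -> bool) : Prop :=
  exists x y : cube I, h x <> h y.

(* A relation S on I * O is represented by the map z |-> S(z). *)
Definition search_problem (I : Type) (O : finType) := I -> {set O}.

Definition total_search (I : Type) (O : finType) (S : search_problem I O) :
  Prop := forall z, S z != finset.set0.

Inductive dtree (l : nat) (O : Type) : Type :=
| DLeaf of O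
| DQuery of 'I_l & dtree l O & dtree l O.

(* In [DQuery i T0 T1], the subtree Tb is followed when the i-th bit is b. *)
Fixpoint dtree_eval (l : nat) (O : Type) (T : dtree l O) (z : cube 'I_l) : O :=
  match T with
  | DLeaf o => o
  | DQuery i T0 T1 => if z i then dtree_eval T1 z else dtree_eval T0 z
  end.

Fixpoint dtree_depth (l : nat) (O : Type) (T : dtree l O) : nat :=
  match T with
  | DLeaf _ => 0
  | DQuery _ T0 T1 => (maxn (dtree_depth T0) (dtree_depth T1)).+1
  end.

Definition dtree_solves (l : nat) (O : finType) (T : dtree l O)
  (S : search_problem (cube 'I_l) O) : Prop :=
  forall z, dtree_eval T z \in S z.

Definition query_complexity (l : nat) (O : finType)
  (S : search_problem (cube 'I_l) O) : nat :=
  nat_least (fun d => exists T : dtree l O,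
    dtree_solves T S /\ dtree_depth T = d).

(* A relation P on X * Y * O, as the map sending (x, y) to its solutions. *)
Definition comm_problem (X Y : Type) (O : finType) := X -> Y -> {set O}.

Inductive protocol (X Y O : Type) : Type :=
| PLeaf of O
| PAlice of (X -> bool) & protocol X Y O & protocol X Y O
| PBob of (Y -> bool) & protocol X Y O & protocol X Y O.

(* At an internal node the owner sends a bit, and the second subtree is
   followed when that bit is 1. *)
Fixpoint protocol_eval (X Y O : Type) (p : protocol X Y O) (x : X) (y : Y) : O :=
  match p with
  | PLeaf o => o
  | PAlice a p0 p1 => if a x then protocol_eval p1 x y else protocol_eval p0 x y
  | PBob b p0 p1 => if b y then protocol_eval p1 x y else protocol_eval p0 x y
  end.

Fixpoint protocol_leaves (X Y O : Type) (p : protocol X Y O) : nat :=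
  match p with
  | PLeaf _ => 1
  | PAlice _ p0 p1 => protocol_leaves p0 + protocol_leaves p1
  | PBob _ p0 p1 => protocol_leaves p0 + protocol_leaves p1
  end.

Definition protocol_solves (X Y : Type) (O : finType) (p : protocol X Y O)
  (P : comm_problem X Y O) : Prop :=
  forall x y, protocol_eval p x y \in P x y.

Definition leaf_complexity (X Y : Type) (O : finType)
  (P : comm_problem X Y O) : nat :=
  nat_least (fun k => exists p : protocol X Y O,
    protocol_solves p P /\ protocol_leaves p = k).

Definition mKW (I : finType) (h : cube I -> bool) :
  comm_problem {x : cube I | h x} {y : cube I | ~~ h y} I :=
  fun x y => [set i | (val x i > val y i)%N].
Arguments mKW {I} h x y.

(* The coordinates of ({0,1}^n)^m are indexed by pairs (row, position). *)
Definition compose (m n : nat) (f : cube 'I_m -> bool) (g : cube 'I_n -> bool) :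
  cube ('I_m * 'I_n)%type -> bool :=
  fun x => f [ffun i => g [ffun j => x (i, j)]].

Definition lift_search (l t : nat) (O : finType)
  (S : search_problem (cube 'I_l) O) (gd : cube 'I_t -> cube 'I_t -> bool) :
  comm_problem {ffun 'I_l -> cube 'I_t} {ffun 'I_l -> cube 'I_t} O :=
  fun x y => S [ffun i => gd (x i) (y i)].

(* Pr[gd(u, v) = b and (u, v) in A * B] for u, v independent and uniform. *)
Definition prob_rect (R : realType) (t : nat)
  (gd : cube 'I_t -> cube 'I_t -> bool) (b : bool) (A B : {set cube 'I_t}) : R :=
  #|[set w : cube 'I_t * cube 'I_t |
      [&& gd w.1 w.2 == b, w.1 \in A & w.2 \in B]]|%:R
  / #|{: cube 'I_t * cube 'I_t}|%:R.

Definition disc_rect (R : realType) (t : nat)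
  (gd : cube 'I_t -> cube 'I_t -> bool) (A B : {set cube 'I_t}) : R :=
  `|prob_rect R gd false A B - prob_rect R gd true A B|.

(* The rectangles are the products A * B; as [disc_rect] is nonnegative, the
   neutral element 0 does not affect the maximum. *)
Definition disc (R : realType) (t : nat)
  (gd : cube 'I_t -> cube 'I_t -> bool) : R :=
  \big[Num.max/0]_(AB : {set cube 'I_t} * {set cube 'I_t})
    disc_rect R gd AB.1 AB.2.

Definition reduces (X Y X' Y' : Type) (O O' : finType)
  (P : comm_problem X Y O) (P' : comm_problem X' Y' O') : Prop :=
  exists (RA : X -> X') (RB : Y -> Y') (Rout : O' -> O),
    forall x y o', o' \in P' (RA x) (RB y) -> Rout o' \in P x y.

(* Main.v *)
(* At each node, a protocol for the composed problem leaves a rectangle A(x) * B(y) of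
   inputs of mKW_f for every pair (x, y) of gadget inputs. Let mu be the number of leaves
   that mKW_f needs on a rectangle. Walk down from the root, always into the child with the
   larger share of the sum over (x, y) of mu(A x, B y) w(x, y); relative to the number of
   pairs, this sum stays of order rho L, where L is the number of leaves below the node.
   The weight w discards the pairs in which x is not unbiased with respect to the support of
   B, or y with respect to that of A. This is measured by second moments of characters,
   which the discrepancy bounds as long as both supports are dense, i.e. no block of
   coordinates is too predictable. Density is restored either by passing to the
   sub-supports X, Y that maximize psi^G / (|X| |Y|), psi being the weighted sum, or, when
   the sum itself concentrates on one value of a block, by fixing that block and making the
   rows of f that it meets useless. The latter costs a factor 4 in mu per row, and the
   increase of density more than pays for it.

   Once L < s, the sum being at most L times the number of surviving pairs forces the
   supports to have density at least rho / 2. The small protocol that remains would solve S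
   in some row on this dense rectangle, which an adversary against decision trees of depth
   below Q(S) excludes, by the usual simulation that fixes blocks of coordinates of one
   player together with the corresponding gadget outputs. Hence mu < 2 rho L at the root,
   with rho = 2^(-Omega(Q(S) t)). *)
Require Import Defs.
From HB Require Import structures.
From mathcomp Require Import all_classical all_reals all_analysis.
From mathcomp Require Import all_boot all_order all_algebra.
From mathcomp Require Import ring lra zify.

Set Implicit Arguments.
Unset Strict Implicit.
Unset Printing Implicit Defensive.

Import Order.TTheory GRing.Theory Num.Theory.
Local Open Scope ring_scope.

(** * Blocks of coordinates and density *)

(** The obstacle is that the weight depends on the supports, while the supports must shrink again
    and again to stay dense. The indicator of being safe could jump when a support loses a few
    points, so [badness] is a sum of squares of normalized character sums: its mean changes by at
    most a small multiple of the lost fraction. The invariant at a node with $l$ leaves is $(\rho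
    l)^G D^2 \le \psi^G$, where $D$ is the density of the product of the supports and [G] is [K.+2].
    One factor $D$ pays for passing to maximizing sub-supports, the other for recomputing the weight
    afterwards. Child and parent satisfy the very same inequality, so no loss accumulates along the
    depth of the protocol. Two of the [K.+2] powers compensate for $D^2$; the other [K] bring back
    $\rho l \le 2\psi$, because $\rho^2 2^K \ge 1$.

    Three densities occur. The marginals of the sum must satisfy a stricter bound [r1] than the
    bound [r] of the supports, because maximality turns the first into the second with a loss of
    $2G$. Fixing gadget outputs weakens [r] to [2 * r2], and only the next turn of the player
    concerned restores it. *)

Section Agreement.

Variables (R : realFieldType) (C L : finType).
Local Notation Om := {ffun C -> L}.
Implicit Types (I J : {set C}) (x y a b : Om).

Definition agree I x a := [forall j in I, x j == a j].

Lemma agreeP I x a : reflect {in I, forall j, x j = a j} (agree I x a).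
Proof. by apply: (iffP 'forall_in_eqP) => H j; apply: H. Qed.

Lemma agree_sym I x a : agree I x a = agree I a x.
Proof. by apply/agreeP/agreeP => H j jI; rewrite H. Qed.

Lemma agree_refl I x : agree I x x.
Proof. by apply/agreeP. Qed.

Lemma agree_trans I y x z : agree I x y -> agree I y z -> agree I x z.
Proof. by move=> /agreeP h1 /agreeP h2; apply/agreeP => j jI; rewrite h1 ?h2. Qed.

Lemma agreeS I J x y : I \subset J -> agree J x y -> agree I x y.
Proof. by move=> /subsetP IJ /agreeP h; apply/agreeP => j /IJ /h. Qed.

Lemma agree0 x y : agree set0 x y.
Proof. by apply/agreeP => j; rewrite inE. Qed.

Lemma agreeU I J x y : agree (I :|: J) x y = agree I x y && agree J x y.
Proof.
apply/idP/andP => [h|[/agreeP h1 /agreeP h2]].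
  by split; apply: agreeS h; rewrite ?subsetUl ?subsetUr.
by apply/agreeP => j; rewrite inE => /orP[/h1|/h2].
Qed.

Definition merge I x y : Om := [ffun c => if c \in I then x c else y c].

Lemma agree_merge I J x a b :
  [disjoint I & J] ->
  agree (I :|: J) x (merge I a b) = agree I x a && agree J x b.
Proof.
move=> dIJ; rewrite agreeU; congr (_ && _).
  by apply/agreeP/agreeP => h j jI; move: (h j jI); rewrite ffunE jI.
by apply/agreeP/agreeP => h j jJ; move: (h j jJ);
   rewrite ffunE (disjointFl dIJ jJ).
Qed.

(* The number of points of Om once the coordinates in I are fixed. *)
Definition vol I : R := #|L|%:R ^+ #|~: I|.

Lemma sum_prod_in I (phi : C -> L -> R) :
  \sum_(a : Om) \prod_(j in I) phi j (a j) =
  vol I * \prod_(j in I) \sum_u phi j u.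
Proof.
pose psi j u : R := if j \in I then phi j u else 1.
transitivity (\sum_(a : Om) \prod_j psi j (a j)).
  by apply: eq_bigr => a _; rewrite big_mkcond.
rewrite -bigA_distr_bigA (bigID (mem I)) /= mulrC; congr (_ * _).
  rewrite /vol -prodr_const; apply: eq_big => [j|j /negbTE jI].
    by rewrite inE.
  by rewrite /psi jI sumr_const.
by apply: eq_bigr => j jI; rewrite /psi jI.
Qed.

Lemma sum_agree I x : \sum_(a : Om | agree I a x) (1 : R) = vol I.
Proof.
transitivity (\sum_(a : Om) \prod_(j in I) ((a j == x j)%:R : R)).
  rewrite big_mkcond; apply: eq_bigr => a _; case: ifP => [/agreeP h|/negbT].
    by rewrite big1 // => j jI; rewrite h ?eqxx.
  rewrite negb_forall => /existsP[j]; rewrite negb_imply => /andP[jI /negbTE e].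
  by rewrite (bigD1 j) //= e mul0r.
rewrite (sum_prod_in I (fun j u => (u == x j)%:R)) big1 ?mulr1 // => j jI.
by rewrite (bigD1 (x j)) //= eqxx big1 ?addr0 // => u /negbTE ->.
Qed.

Lemma vol_ge0 I : 0 <= vol I.
Proof. by rewrite exprn_ge0 ?ler0n. Qed.

Lemma vol_gt0 I : (0 < #|L|)%N -> 0 < vol I.
Proof. by move=> h; rewrite exprn_gt0 ?ltr0n. Qed.

Lemma volU I J : [disjoint I & J] -> vol I = vol (I :|: J) * #|L|%:R ^+ #|J|.
Proof.
move=> dIJ; rewrite /vol -exprD; congr (_ ^+ _).
have := cardsC I; have := cardsC (I :|: J).
have : #|I :|: J| = (#|I| + #|J|)%N.
  by rewrite cardsU (disjoint_setI0 dIJ) cards0 subn0.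
lia.
Qed.

Definition ind (X : {set Om}) x : R := (x \in X)%:R.

Lemma sum_ind (X : {set Om}) (P : pred Om) :
  \sum_(x | P x) ind X x = #|[set x in X | P x]|%:R.
Proof.
rewrite -sum1_card natr_sum [LHS]big_mkcond [RHS]big_mkcond.
by apply: eq_bigr => x _; rewrite inE /ind; case: (x \in X); case: (P x).
Qed.

Lemma sum_ind_card (X : {set Om}) : \sum_x ind X x = #|X|%:R.
Proof. by rewrite (sum_ind _ predT); congr (_%:R); apply: eq_card => x; rewrite !inE andbT. Qed.

Lemma card_agree_vol I (X : {set Om}) (a : Om) :
  {in X, forall x, agree I x a} -> #|X|%:R <= vol I.
Proof.
move=> h; rewrite -(sum_agree I a) -sum_ind_card [leRHS]big_mkcond.
apply: ler_sum => x _; rewrite /ind; case: (boolP (x \in X)) => [/h ->//|_].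
by case: ifP; rewrite ?ler01.
Qed.

(** Double counting: [phi] is constant on the classes of [agree I], and each class has [vol I]
    points and mass at most [K] under [nu]. *)
Lemma sum_weight_le I (nu phi : Om -> R) (K : R) :
  (forall a, \sum_(x | agree I x a) nu x <= K) ->
  (forall x, 0 <= phi x) ->
  (forall x y, agree I x y -> phi x = phi y) ->
  (\sum_x nu x * phi x) * vol I <= K * \sum_x phi x.
Proof.
move=> hK phi0 hphi; rewrite mulr_suml mulr_sumr.
have -> : \sum_x nu x * phi x * vol I =
    \sum_x \sum_(a | agree I x a) nu x * phi a.
  apply: eq_bigr => x _; rewrite -(sum_agree I x) mulr_sumr.
  rewrite (eq_bigl (agree I x)) => [|a]; last by rewrite agree_sym.
  by apply: eq_bigr => a /hphi ->; rewrite mulr1.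
rewrite (exchange_big_dep xpredT) //=; apply: ler_sum => a _.
by rewrite -mulr_suml ler_wpM2r ?hK.
Qed.

(** A blockwise min-entropy condition: with $r = |L|^{-(1-d)}$, every block $I$ inside [Fr] has
    min-entropy at least $(1-d)|I|\log|L|$. The measure is not normalized, so that indicators of
    sets and marginals of complexity are treated alike. *)
Definition dense (r : R) (Fr : {set C}) (nu : Om -> R) :=
  forall I a, I \subset Fr ->
    \sum_(x | agree I x a) nu x <= r ^+ #|I| * \sum_x nu x.

Lemma dense_sum r (Fr I : {set C}) (nu phi : Om -> R) :
  dense r Fr nu -> I \subset Fr -> (forall x, 0 <= phi x) ->
  (forall x y, agree I x y -> phi x = phi y) ->
  (\sum_x nu x * phi x) * vol I <= r ^+ #|I| * (\sum_x nu x) * \sum_x phi x.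
Proof. by move=> dn IF; apply: sum_weight_le => a; apply: dn. Qed.

Lemma dense_weak r r' (Fr : {set C}) (nu : Om -> R) :
  0 <= r -> r <= r' -> (forall x, 0 <= nu x) -> dense r Fr nu -> dense r' Fr nu.
Proof.
move=> r0 rr nu0 dn I a IF; apply: le_trans (dn _ _ IF) _.
by rewrite ler_wpM2r ?sumr_ge0 // lerXn2r ?nnegrE ?(le_trans r0).
Qed.

End Agreement.

(** Cauchy-Schwarz against the constant 1, read off from the nonnegative double sum of the squares
    of [F i - F j]. *)
Lemma sqr_sum_le (R : realFieldType) (I : finType) (P : pred I) (F : I -> R) :
  (\sum_(i | P i) F i) ^+ 2 <= #|P|%:R * \sum_(i | P i) F i ^+ 2.
Proof.
have : 0 <= \sum_(i | P i) \sum_(j | P j) (F i - F j) ^+ 2.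
  by apply: sumr_ge0 => i _; apply: sumr_ge0 => j _; apply: sqr_ge0.
set n := #|P|%:R; set s1 := \sum_(i | P i) F i.
set s2 := \sum_(i | P i) F i ^+ 2.
have inner i : \sum_(j | P j) (F i - F j) ^+ 2 = n * F i ^+ 2 - 2 * s1 * F i + s2.
  transitivity (\sum_(j | P j) (F i ^+ 2 + (- (2 * F i) * F j + F j ^+ 2))).
    by apply: eq_bigr => j _; ring.
  rewrite big_split big_split /= sumr_const -[_ *+ #|P|]mulr_natl -mulr_sumr.
  by rewrite -/s1 -/s2 -/n; ring.
under eq_bigr => i _ do rewrite inner.
rewrite big_split big_split /= sumrN -!mulr_sumr sumr_const -[s2 *+ _]mulr_natl.
by rewrite -/n -/s1 -/s2; nra.
Qed.

(** * Bias of the gadget on dense sets *)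

Section Moment.

Variables (R : realFieldType) (C L : finType) (gd : L -> L -> bool).
Local Notation Om := {ffun C -> L}.
Implicit Types (I J Fr : {set C}) (x y a b : Om) (X Y : {set Om}).

Definition sgn (u v : L) : R := (-1) ^+ gd u v.

Definition chi I x y := \prod_(j in I) sgn (x j) (y j).

(** The Gram matrix of the columns of the sign matrix of the gadget. Its Frobenius norm, bounded in
    [hgram], is what the second moment estimates use about the gadget. *)
Definition gram (v v' : L) := \sum_u sgn u v * sgn u v'.

(** The condition on the block [J] is there so that the estimates also control the density of the
    set of those y in [Y] that produce prescribed gadget outputs on another block. *)
Definition bias I J Y b x := \sum_(y in Y | agree J y b) chi I x y.

Lemma normr_chi I x y : `|chi I x y| = 1.
Proof.
rewrite /chi normr_prod big1 // => j _.
by rewrite /sgn; case: (gd _ _); rewrite ?expr1 ?normrN1 // normr1.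
Qed.

Lemma chi_agree I x x' y y' : agree I x x' -> agree I y y' ->
  chi I x y = chi I x' y'.
Proof.
by move=> /agreeP h1 /agreeP h2; apply: eq_bigr => j jI; rewrite h1 ?h2.
Qed.

Lemma bias_agree I J Y b x x' : agree I x x' -> bias I J Y b x = bias I J Y b x'.
Proof.
move=> h; apply: eq_bigr => y _; apply: chi_agree => //; exact: agree_refl.
Qed.

Lemma bias_agreer I J Y b b' x : agree J b b' -> bias I J Y b x = bias I J Y b' x.
Proof.
move=> h; apply: eq_bigl => y; congr (_ && _); apply/idP/idP => h'.
  exact: agree_trans h' h.
by apply: agree_trans h' _; rewrite agree_sym.
Qed.

Lemma normr_bias I J Y b x :
  `|bias I J Y b x| <= \sum_(y | agree J y b) ind R Y y.
Proof.
apply: le_trans (ler_norm_sum _ _ _) _.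
rewrite [leRHS]big_mkcond [leLHS]big_mkcond; apply: ler_sum => y _.
by rewrite /ind normr_chi; case: (y \in Y); case: ifP.
Qed.

Hypothesis L0 : (0 < #|L|)%N.

Variable h : R.
Hypothesis h0 : 0 <= h.
Hypothesis hgram : \sum_v \sum_v' gram v v' ^+ 2 <= h ^+ 2.

Lemma bias_sqr_sum I J Y b :
  \sum_x bias I J Y b x ^+ 2 =
  vol R L I * \sum_(y in Y | agree J y b) \sum_(y' in Y | agree J y' b)
    \prod_(j in I) gram (y j) (y' j).
Proof.
under eq_bigr => x _ do rewrite expr2 /bias big_distrlr /=.
rewrite exchange_big /= mulr_sumr; apply: eq_bigr => y _.
rewrite exchange_big /= mulr_sumr; apply: eq_bigr => y' _.
rewrite -(sum_prod_in I (fun j u => sgn u (y j) * sgn u (y' j))).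
by apply: eq_bigr => x _; rewrite -big_split.
Qed.

(** Cauchy-Schwarz in both variables leads to a sum of squared products of Gram entries. Density of
    [Y] then replaces each variable by a uniform one at the cost [K], and over all of [Om] the sum
    factors into one Frobenius norm per coordinate of [I]. *)
Lemma gram_sum_le (r : R) Fr I J Y b :
  0 <= r -> dense r Fr (ind R Y) -> I \subset Fr -> J \subset Fr ->
  [disjoint I & J] ->
  \sum_(y in Y | agree J y b) \sum_(y' in Y | agree J y' b)
    \prod_(j in I) gram (y j) (y' j) <=
  h ^+ #|I| * (r ^+ #|I| * (r ^+ #|J|) ^+ 2) * #|Y|%:R ^+ 2.
Proof.
move=> r0 dY IF JF dIJ.
set P := [pred y | (y \in Y) && agree J y b].
set K := r ^+ #|I| * r ^+ #|J| * (#|Y|%:R : R).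
have K0 : 0 <= K by rewrite !mulr_ge0 ?exprn_ge0 ?ler0n.
pose nu y : R := (P y)%:R.
have hK a : \sum_(y | agree I y a) nu y <= K.
  have := dY (I :|: J) (merge I a b); rewrite subUset IF JF sum_ind_card => /(_ isT).
  rewrite (eq_bigl (fun y => agree I y a && agree J y b)); last first.
    by move=> y; rewrite agree_merge.
  have -> : #|I :|: J| = (#|I| + #|J|)%N.
    by rewrite cardsU (disjoint_setI0 dIJ) cards0 subn0.
  rewrite exprD => hle; apply: le_trans hle.
  rewrite big_mkcondr /=; apply: ler_sum => y _; rewrite /nu /ind /=.
  by case: (agree J y b); rewrite ?andbT ?andbF.
have cP : (#|P|%:R : R) <= r ^+ #|J| * #|Y|%:R.
  have := dY J b JF; rewrite sum_ind_card; apply: le_trans.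
  rewrite -sum1_card natr_sum big_mkcondl big_mkcond [leRHS]big_mkcond /=.
  apply: ler_sum => y _; rewrite /ind.
  by case: (agree J y b); case: (y \in Y).
set g := fun y y' => \prod_(j in I) gram (y j) (y' j).
have gI y y' z z' : agree I y z -> agree I y' z' -> g y y' = g z z'.
  by move=> /agreeP h1 /agreeP h2; apply: eq_bigr => j jI; rewrite h1 ?h2.
have v0 : 0 < vol R L I by apply: vol_gt0.
have S1 : (\sum_(y | P y) \sum_(y' | P y') g y y' ^+ 2) * vol R L I ^+ 2 <=
          K ^+ 2 * (vol R L I ^+ 2 * (h ^+ 2) ^+ #|I|).
  have -> : \sum_(y | P y) \sum_(y' | P y') g y y' ^+ 2 =
            \sum_y nu y * \sum_y' nu y' * g y y' ^+ 2.
    rewrite big_mkcond; apply: eq_bigr => y _; rewrite /nu.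
    case: ifP; rewrite ?mul0r // mul1r => _.
    rewrite big_mkcond; apply: eq_bigr => y' _.
    by case: ifP; rewrite ?mul0r ?mul1r.
  have s0 y : 0 <= \sum_y' nu y' * g y y' ^+ 2.
    by apply: sumr_ge0 => y' _; rewrite mulr_ge0 ?ler0n ?sqr_ge0.
  have := @sum_weight_le R C L I nu (fun y => \sum_y' nu y' * g y y' ^+ 2) K hK s0.
  have hag y z : agree I y z -> \sum_y' nu y' * g y y' ^+ 2 = \sum_y' nu y' * g z y' ^+ 2.
    by move=> ?; apply: eq_bigr => y' _; rewrite (gI y y' z y') // agree_refl.
  move=> /(_ hag) /(ler_wpM2r (ltW v0)); rewrite -mulrA -expr2 => /le_trans; apply.
  rewrite -mulrA [K ^+ 2]expr2 -[K * K * _]mulrA ler_wpM2l // mulr_suml.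
  rewrite [K * _]mulrC.
  apply: (@le_trans _ _ (\sum_y K * \sum_y' g y y' ^+ 2)).
    apply: ler_sum => y _; apply: (@sum_weight_le R C L I nu (fun y' => g y y' ^+ 2)) => //.
      by move=> y'; apply: sqr_ge0.
    by move=> y' z' ?; rewrite (gI y y' y z') // agree_refl.
  rewrite -mulr_sumr [leRHS]mulrC ler_wpM2l //.
  have -> : \sum_y \sum_y' g y y' ^+ 2 =
      vol R L I ^+ 2 * (\sum_v \sum_v' gram v v' ^+ 2) ^+ #|I|.
    transitivity (\sum_(y : Om) vol R L I * \prod_(j in I) \sum_u gram (y j) u ^+ 2).
      apply: eq_bigr => y _.
      rewrite -(sum_prod_in I (fun j u => gram (y j) u ^+ 2)).
      by apply: eq_bigr => y' _; rewrite prodrXl.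
    rewrite -mulr_sumr (sum_prod_in I (fun j v => \sum_u gram v u ^+ 2)).
    by rewrite prodr_const mulrA expr2.
  rewrite ler_wpM2l ?sqr_ge0 // lerXn2r ?nnegrE ?sqr_ge0 //.
  by apply: sumr_ge0 => v _; apply: sumr_ge0 => v' _; apply: sqr_ge0.
have S2 : \sum_(y | P y) \sum_(y' | P y') g y y' ^+ 2 <= K ^+ 2 * (h ^+ 2) ^+ #|I|.
  rewrite -(ler_pM2r (exprn_gt0 2 v0)).
  by apply: le_trans S1 _; rewrite mulrCA mulrC mulrA.
have S3 : (\sum_(y | P y) \sum_(y' | P y') g y y') ^+ 2 <=
    (#|P|%:R * (K * h ^+ #|I|)) ^+ 2.
  apply: le_trans (sqr_sum_le _ _) _.
  rewrite [leRHS]exprMn [_ ^+ 2 in leRHS]expr2 -mulrA ler_wpM2l ?ler0n //.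
  apply: (@le_trans _ _ (\sum_(y | P y) #|P|%:R * \sum_(y' | P y') g y y' ^+ 2)).
    by apply: ler_sum => y _; apply: sqr_sum_le.
  rewrite -mulr_sumr ler_wpM2l ?ler0n // (le_trans S2) //.
  by rewrite [leRHS]exprMn -[(h ^+ _) ^+ 2]exprM mulnC exprM.
apply: le_trans (ler_norm _) _.
have := S3; rewrite -[leLHS]real_normK ?num_real // ler_sqr ?nnegrE ?normr_ge0 //; last first.
  by rewrite !mulr_ge0 ?ler0n ?exprn_ge0.
move=> /le_trans; apply.
apply: (@le_trans _ _ (r ^+ #|J| * #|Y|%:R * (K * h ^+ #|I|))).
  by rewrite ler_wpM2r // mulr_ge0 ?exprn_ge0.
by rewrite /K le_eqVlt; apply/orP; left; apply/eqP; ring.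
Qed.

(** The squared bias depends only on the coordinates in [I], so density of [nu] compares its mean
    with the uniform mean, which is a Gram sum. *)
Lemma bias_moment (rn r : R) Fr I J Y b (nu : Om -> R) :
  (forall x, 0 <= nu x) -> 0 <= r -> 0 <= rn ->
  dense rn Fr nu -> dense r Fr (ind R Y) -> I \subset Fr -> J \subset Fr ->
  [disjoint I & J] ->
  \sum_x nu x * bias I J Y b x ^+ 2 <=
  (rn * r * h) ^+ #|I| * (r ^+ #|J| * #|Y|%:R) ^+ 2 * \sum_x nu x.
Proof.
move=> nu0 r0 rn0 dn dY IF JF dIJ.
have v0 : 0 < vol R L I by apply: vol_gt0.
rewrite -(ler_pM2r v0).
have := @dense_sum R C L rn Fr I nu (fun x => bias I J Y b x ^+ 2) dn IF.
move=> /(_ (fun x => sqr_ge0 _)) /(_ (fun x x' e => congr1 (fun z => z ^+ 2) (bias_agree J Y b e))).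
move=> /le_trans; apply.
rewrite bias_sqr_sum.
set Q := \sum_(y in Y | _) _.
have hQ := gram_sum_le b r0 dY IF JF dIJ; rewrite -/Q in hQ.
have sn : 0 <= \sum_x nu x by apply: sumr_ge0.
apply: (@le_trans _ _ (rn ^+ #|I| * (\sum_x nu x) * (vol R L I *
   (h ^+ #|I| * (r ^+ #|I| * (r ^+ #|J|) ^+ 2) * #|Y|%:R ^+ 2)))).
  by rewrite ler_wpM2l ?mulr_ge0 ?exprn_ge0 // ler_wpM2l // ltW.
rewrite le_eqVlt; apply/orP; left; apply/eqP; rewrite !exprMn; ring.
Qed.

End Moment.

(** * Inputs that are unbiased against a dense set *)

Section Badness.

Variables (R : realFieldType) (C L : finType) (gd : L -> L -> bool).
Local Notation Om := {ffun C -> L}.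
Local Notation T := (#|L|%:R : R).
Local Notation wbias := (bias R gd).
Implicit Types (I J Fr : {set C}) (x y a b : Om) (X Y : {set Om}).

Variables (h tau r r2 sigma eps : R).

(** For a safe x the gadget outputs on a block are nearly uniform over y in [Y], even jointly with
    an event that fixes y on a disjoint block. *)
Definition safe Fr Y x := forall I J b,
  I \subset Fr -> J \subset Fr -> [disjoint I & J] -> I != set0 ->
  `|wbias I J Y b x| <= tau ^+ #|I| * r2 ^+ #|J| * #|Y|%:R.

(* For the pairs (I, J) left out, density of Y alone gives the bound in [safe]. *)
Definition relevant Fr I := [pred J : {set C} |
  [&& J \subset Fr, [disjoint I & J] & tau ^+ #|I| * r2 ^+ #|J| < r ^+ #|J|]].

Definition nonempty_sub Fr := [pred I : {set C} | (I \subset Fr) && (I != set0)].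

(** Every value on the block [J] is counted once, since it has [vol R L J] extensions b. All terms
    are nonnegative, so a sum below 1 bounds each of them. *)
Definition badness Fr Y x :=
  \sum_(I | nonempty_sub Fr I) \sum_(J | relevant Fr I J)
    (vol R L J)^-1 * \sum_b
      ((tau ^+ #|I| * r2 ^+ #|J|)^-1 * (wbias I J Y b x / #|Y|%:R)) ^+ 2.

Record params : Prop := Params {
  par_L : (0 < #|L|)%N;
  par_h : 0 <= h;
  par_gram : \sum_v \sum_v' gram R gd v v' ^+ 2 <= h ^+ 2;
  par_tau0 : 0 < tau;
  par_tau1 : tau <= 1;
  par_r0 : 0 < r;
  par_rr2 : r <= r2;
  par_r2 : 2 * r2 <= 1;
  par_Tr2 : 1 <= T * r2;
  par_sigma0 : 0 < sigma;
  par_sigma1 : sigma <= 1;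
  par_sigma : 2 * r2 * r * h <= (sigma * tau) ^+ 2;
  par_sum : \sum_(I : {set C} | I != set0)
      \sum_(J : {set C} | tau ^+ #|I| * r2 ^+ #|J| < r ^+ #|J|)
      (sigma / tau ^+ 2) ^+ #|I| * T ^+ (3 * #|J|) <= eps }.

Hypothesis par : params.

Let L0 := par_L par.
Let tau0 := par_tau0 par.
Let r0 := par_r0 par.
Let sigma0 := par_sigma0 par.

Let r20 : 0 < r2. Proof. exact: lt_le_trans r0 (par_rr2 par). Qed.
Let r1 : r <= 1. Proof. by have := par_rr2 par; have := par_r2 par; lra. Qed.
Let T1 : 1 <= T. Proof. by rewrite ler1n. Qed.

Let c I J := tau ^+ #|I| * r2 ^+ #|J|.
Let c0 I J : 0 < c I J. Proof. by rewrite mulr_gt0 ?exprn_gt0. Qed.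

Lemma badness_ge0 Fr Y x : 0 <= badness Fr Y x.
Proof.
apply: sumr_ge0 => I _; apply: sumr_ge0 => J _.
by rewrite mulr_ge0 ?invr_ge0 ?vol_ge0 // sumr_ge0 // => b _; rewrite sqr_ge0.
Qed.

Lemma sum_const_vol J (k : R) : (vol R L J)^-1 * \sum_(b : Om) k = T ^+ #|J| * k.
Proof.
have -> : \sum_(b : Om) k = vol R L (set0 : {set C}) * k.
  have [u _] := card_gt0P L0.
  rewrite -(sum_agree R set0 [ffun _ => u]) mulr_suml.
  by apply: eq_big => [a|a _]; rewrite ?agree0 ?mul1r.
have dJ : [disjoint (set0 : {set C}) & J] by rewrite -setI_eq0 set0I.
rewrite (volU _ _ dJ) set0U mulrA mulrA mulVf ?mul1r //.
by rewrite gt_eqF // vol_gt0.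
Qed.

Lemma badness_safe Fr Y x : dense r Fr (ind R Y) -> badness Fr Y x < 1 ->
  safe Fr Y x.
Proof.
move=> dY hb I J b IF JF dIJ I0.
have [rel|irrel] := boolP (relevant Fr I J); last first.
  apply: le_trans (normr_bias R gd _ _ _ _ _) _.
  apply: le_trans (dY J b JF) _; rewrite sum_ind_card ler_wpM2r ?ler0n //.
  by move: irrel; rewrite /= JF dIJ /= -leNgt.
have [Y0|Y0] := eqVneq #|Y| 0%N.
  rewrite Y0 mulr0 normr_le0; apply/eqP; rewrite /bias big1 // => y.
  by move/cards0_eq: Y0 => ->; rewrite inE.
have Yp : 0 < #|Y|%:R :> R by rewrite ltr0n lt0n.
set f := fun b : Om => ((c I J)^-1 * (wbias I J Y b x / #|Y|%:R)) ^+ 2.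
have h1 : f b <= badness Fr Y x.
  rewrite /badness (bigD1 I) /=; last by rewrite IF.
  rewrite (bigD1 J) /=; last by [].
  apply: (@le_trans _ _ ((vol R L J)^-1 * \sum_b' f b')); last first.
    rewrite -addrA lerDl addr_ge0 //.
      apply: sumr_ge0 => J' _.
      by rewrite mulr_ge0 ?invr_ge0 ?vol_ge0 // sumr_ge0 // => b' _; rewrite sqr_ge0.
    apply: sumr_ge0 => I' _; apply: sumr_ge0 => J' _.
    by rewrite mulr_ge0 ?invr_ge0 ?vol_ge0 // sumr_ge0 // => b' _; rewrite sqr_ge0.
  rewrite mulrC ler_pdivlMr ?vol_gt0 // -(sum_agree R J b) mulr_sumr big_mkcond.
  apply: ler_sum => b' _; case: ifP => [ag|_]; last exact: sqr_ge0.
  by rewrite mulr1 /f (bias_agreer R gd I Y x ag).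
have : f b <= 1 by apply: ltW; apply: le_lt_trans h1 hb.
rewrite /f -[leLHS]real_normK ?num_real // -[leRHS](expr1n _ 2).
rewrite ler_sqr ?nnegrE ?normr_ge0 ?ler01 // normrM gtr0_norm ?invr_gt0 //.
by rewrite mulrC ler_pdivrMr // mul1r normf_div [`|#|Y|%:R|]gtr0_norm // ler_pdivrMr.
Qed.

Section Weighted.

Variables (nu : Om -> R) (Fr : {set C}).
Hypothesis nu0 : forall x, 0 <= nu x.
Hypothesis dnu : dense (2 * r2) Fr nu.

Let S := \sum_x nu x.
Let S0 : 0 <= S. Proof. exact: sumr_ge0. Qed.

Lemma bias_moment_le I J Y b : I \subset Fr -> J \subset Fr -> [disjoint I & J] ->
  dense r Fr (ind R Y) ->
  \sum_x nu x * wbias I J Y b x ^+ 2 <=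
  ((sigma * tau) ^+ #|I| * r ^+ #|J| * #|Y|%:R) ^+ 2 * S.
Proof.
move=> IF JF dIJ dY; have r22 : 0 <= 2 * r2 by rewrite mulr_ge0 // ltW.
apply: le_trans (bias_moment L0 (par_h par) (par_gram par) b nu0 (ltW r0) r22 dnu dY IF JF dIJ) _.
rewrite ler_wpM2r // -[_ * _ * #|Y|%:R in leRHS]mulrA [leRHS]exprMn ler_wpM2r ?sqr_ge0 //.
rewrite -exprM mulnC exprM lerXn2r ?nnegrE ?sqr_ge0 ?(par_sigma par) //.
by rewrite mulr_ge0 ?(par_h par) // !mulr_ge0 ?ltW.
Qed.

(** The first moment is obtained from the second through $v \le l/2 + v^2/(2l)$, with $l =
    (\sigma\tau)^{|I|}$. The gain $r^{|J|}$ in the second moment is given up. *)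
Lemma bias_abs_le I J Y b : I \subset Fr -> J \subset Fr -> [disjoint I & J] ->
  dense r Fr (ind R Y) -> (0 < #|Y|)%N ->
  \sum_x nu x * `|wbias I J Y b x / #|Y|%:R| <= (sigma * tau) ^+ #|I| * S.
Proof.
move=> IF JF dIJ dY Y0; have Yp : 0 < #|Y|%:R :> R by rewrite ltr0n.
set l := (sigma * tau) ^+ #|I|.
have l0 : 0 < l by rewrite exprn_gt0 // mulr_gt0.
have hM := bias_moment_le b IF JF dIJ dY; rewrite -/l in hM.
have amgm x : nu x * `|wbias I J Y b x / #|Y|%:R| <=
    nu x * (l / 2) + (2 * l * #|Y|%:R ^+ 2)^-1 * (nu x * wbias I J Y b x ^+ 2).
  set u := wbias I J Y b x.
  have -> : (2 * l * #|Y|%:R ^+ 2)^-1 * (nu x * u ^+ 2) =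
     nu x * ((2 * l)^-1 * `|u / #|Y|%:R| ^+ 2).
    rewrite real_normK ?num_real // exprMn exprVn; field.
    by rewrite !gt_eqF.
  rewrite -mulrDr ler_wpM2l //; set v := `|_|.
  have -> : l / 2 + (2 * l)^-1 * v ^+ 2 = (l ^+ 2 + v ^+ 2) / (2 * l).
    by field; rewrite gt_eqF.
  rewrite ler_pdivlMr ?mulr_gt0 //; have := sqr_ge0 (l - v); nra.
apply: le_trans (ler_sum _ (fun x _ => amgm x)) _.
rewrite big_split /= -mulr_suml -mulr_sumr -/S.
apply: (@le_trans _ _ (S * (l / 2) + (2 * l * #|Y|%:R ^+ 2)^-1 *
  ((l * r ^+ #|J| * #|Y|%:R) ^+ 2 * S))).
  rewrite lerD2l ler_wpM2l // invr_ge0 !mulr_ge0 ?ltW // exprn_gt0 //.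
have -> : (2 * l * #|Y|%:R ^+ 2)^-1 * ((l * r ^+ #|J| * #|Y|%:R) ^+ 2 * S) =
    (r ^+ #|J|) ^+ 2 * (l / 2 * S).
  by field; rewrite !gt_eqF.
have rj : (r ^+ #|J|) ^+ 2 <= 1.
  by rewrite -exprM exprn_ile1 // ltW.
have : (r ^+ #|J|) ^+ 2 * (l / 2 * S) <= l / 2 * S.
  by rewrite ler_piMl // mulr_ge0 // divr_ge0 ?ltW.
lra.
Qed.

Lemma par_sum_Fr (k : R) : 0 <= k ->
  \sum_(I | nonempty_sub Fr I) \sum_(J | relevant Fr I J)
     (sigma / tau ^+ 2) ^+ #|I| * T ^+ (3 * #|J|) * k <= eps * k.
Proof.
move=> k0; under eq_bigr => I _ do rewrite -mulr_suml.
rewrite -mulr_suml ler_wpM2r //; apply: le_trans (par_sum par).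
have q0 I J : 0 <= (sigma / tau ^+ 2) ^+ #|I| * T ^+ (3 * #|J|).
  by rewrite mulr_ge0 ?exprn_ge0 ?ler0n // divr_ge0 ?exprn_ge0 // ltW.
rewrite [leLHS]big_mkcond [leRHS]big_mkcond; apply: ler_sum => I _ /=.
case: (I != set0); rewrite ?andbF ?andbT //.
case: ifP => _; last exact: sumr_ge0.
rewrite [leLHS]big_mkcond [leRHS]big_mkcond; apply: ler_sum => J _ /=.
by case: (_ < _); rewrite ?andbF ?andbT //; case: ifP.
Qed.

(** By the second moment and [r <= r2], each normalized square has mean at most
    [(sigma ^+ 2) ^+ #|I|]; there are [T ^+ #|J|] values on [J], and [par_sum] adds everything
    up. *)
Lemma badness_mean Y : dense r Fr (ind R Y) -> (0 < #|Y|)%N ->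
  \sum_x nu x * badness Fr Y x <= eps * S.
Proof.
move=> dY Y0; have Yp : 0 < #|Y|%:R :> R by rewrite ltr0n.
apply: le_trans (par_sum_Fr S0).
under eq_bigr => x _ do rewrite /badness mulr_sumr.
rewrite exchange_big /=; apply: ler_sum => I /andP[IF I0].
under eq_bigr => x _ do rewrite mulr_sumr.
rewrite exchange_big /=; apply: ler_sum => J /and3P[JF dIJ _].
under eq_bigr => x _ do rewrite mulrCA mulr_sumr.
rewrite -mulr_sumr exchange_big /=.
have inner (b : Om) : \sum_x nu x * ((tau ^+ #|I| * r2 ^+ #|J|)^-1 *
    (wbias I J Y b x / #|Y|%:R)) ^+ 2 <= (sigma ^+ 2) ^+ #|I| * S.
  have -> : \sum_x nu x * ((tau ^+ #|I| * r2 ^+ #|J|)^-1 *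
    (wbias I J Y b x / #|Y|%:R)) ^+ 2 =
    ((c I J * #|Y|%:R) ^+ 2)^-1 * \sum_x nu x * wbias I J Y b x ^+ 2.
    rewrite mulr_sumr; apply: eq_bigr => x _; rewrite -/(c I J).
    have tk : 0 < tau ^+ #|I| by rewrite exprn_gt0.
    have rk : 0 < r2 ^+ #|J| by rewrite exprn_gt0.
    by field; rewrite !gt_eqF.
  rewrite mulrC ler_pdivrMr; last by rewrite exprn_gt0 // mulr_gt0 // c0.
  apply: le_trans (bias_moment_le b IF JF dIJ dY) _.
  have -> : (sigma ^+ 2) ^+ #|I| * S * (c I J * #|Y|%:R) ^+ 2 =
      (sigma ^+ #|I| * (c I J * #|Y|%:R)) ^+ 2 * S.
    by rewrite exprAC; ring.
  rewrite ler_wpM2r //.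
  have a0 : 0 <= sigma ^+ #|I| by rewrite exprn_ge0 // ltW.
  have b0 : 0 <= tau ^+ #|I| by rewrite exprn_ge0 // ltW.
  have q0 : 0 <= r ^+ #|J| by rewrite exprn_ge0 // ltW.
  have rj : r ^+ #|J| <= r2 ^+ #|J|.
    by rewrite lerXn2r ?nnegrE ?(par_rr2 par) ?ltW.
  rewrite [(sigma * tau) ^+ _]exprMn; apply: lerXn2r; rewrite ?nnegrE.
  - by rewrite mulr_ge0 ?ler0n // mulr_ge0 // mulr_ge0.
  - by rewrite mulr_ge0 // mulr_ge0 ?ler0n // ltW.
  - by rewrite /c !mulrA ler_wpM2r ?ler0n // ler_wpM2l // mulr_ge0.
apply: (@le_trans _ _ ((vol R L J)^-1 * \sum_(b : Om) ((sigma ^+ 2) ^+ #|I| * S))).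
  by rewrite ler_wpM2l ?invr_ge0 ?vol_ge0 //; apply: ler_sum.
rewrite sum_const_vol mulrA ler_wpM2r // [leLHS]mulrC.
have e1 : T ^+ #|J| <= T ^+ (3 * #|J|) by rewrite ler_weXn2l // leq_pmull.
have e2 : sigma ^+ 2 <= sigma / tau ^+ 2.
  rewrite ler_pdivlMr ?exprn_gt0 //.
  have := par_tau1 par; have := par_sigma1 par; move: tau0 sigma0 => ? ? ? ?.
  have : tau ^+ 2 <= 1 by rewrite exprn_ile1 // ltW.
  have : 0 <= tau ^+ 2 by rewrite sqr_ge0.
  by nra.
have e3 : (sigma ^+ 2) ^+ #|I| <= (sigma / tau ^+ 2) ^+ #|I|.
  by apply: lerXn2r => //; rewrite nnegrE ?sqr_ge0 // (le_trans _ e2) ?sqr_ge0.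
by apply: ler_pM => //; rewrite exprn_ge0 ?sqr_ge0 ?ler0n.
Qed.

(** Normalized biases are averages of numbers of absolute value at most 1. The points of [Y] outside
    [Y'] and the change of normalization contribute one lost fraction each. *)
Lemma bias_cont I J Y Y' b x : Y' \subset Y -> (0 < #|Y'|)%N ->
  `|wbias I J Y b x / #|Y|%:R - wbias I J Y' b x / #|Y'|%:R| <=
  2 * (1 - #|Y'|%:R / #|Y|%:R).
Proof.
move=> sY Y'0; have Y0 : (0 < #|Y|)%N by apply: leq_trans Y'0 (subset_leq_card sY).
have Yp : 0 < #|Y|%:R :> R by rewrite ltr0n.
have Y'p : 0 < #|Y'|%:R :> R by rewrite ltr0n.
have YY' : #|Y'|%:R <= #|Y|%:R :> R by rewrite ler_nat subset_leq_card.
have bnd (Z : {set Om}) : `|wbias I J Z b x| <= #|Z|%:R.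
  apply: le_trans (normr_bias R gd _ _ _ _ _) _; rewrite -sum_ind_card big_mkcond.
  by apply: ler_sum => y _; case: ifP => // _; apply: ler0n.
have split : wbias I J Y b x = wbias I J Y' b x + wbias I J (Y :\: Y') b x.
  rewrite /bias big_mkcondr [X in X + _]big_mkcondr [X in _ + X]big_mkcondr /=.
  rewrite (big_setID Y') /=; congr (_ + _).
  by rewrite (setIidPr sY).
have cD : #|Y :\: Y'|%:R = #|Y|%:R - #|Y'|%:R :> R.
  by rewrite cardsD (setIidPr sY) natrB // subset_leq_card.
rewrite split mulrDl.
have -> : wbias I J Y' b x / #|Y|%:R + wbias I J (Y :\: Y') b x / #|Y|%:R -
    wbias I J Y' b x / #|Y'|%:R =
    wbias I J (Y :\: Y') b x / #|Y|%:R -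
    wbias I J Y' b x / #|Y'|%:R * (1 - #|Y'|%:R / #|Y|%:R).
  by field; rewrite !gt_eqF.
apply: le_trans (ler_normB _ _) _.
have t0 : 0 <= 1 - #|Y'|%:R / #|Y|%:R :> R by rewrite subr_ge0 ler_pdivrMr // mul1r.
have p1 : `|wbias I J (Y :\: Y') b x / #|Y|%:R| <= 1 - #|Y'|%:R / #|Y|%:R.
  rewrite normf_div [`|#|Y|%:R|]gtr0_norm // ler_pdivrMr //.
  by rewrite mulrBl mul1r divfK ?gt_eqF // -cD.
have p2 : `|wbias I J Y' b x / #|Y'|%:R * (1 - #|Y'|%:R / #|Y|%:R)| <=
    1 - #|Y'|%:R / #|Y|%:R.
  rewrite normrM [`|1 - _|]ger0_norm // ler_piMl //.
  by rewrite normf_div [`|#|Y'|%:R|]gtr0_norm // ler_pdivrMr // mul1r.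
lra.
Qed.

(** A difference of squares is the difference times the sum. [bias_cont] bounds the difference at
    every point by the lost fraction of [Y], and the first moment makes the sum small on average, so
    both small factors appear in the result. *)
Lemma badness_cont Y Y' : dense r Fr (ind R Y) -> dense r Fr (ind R Y') ->
  Y' \subset Y -> (0 < #|Y'|)%N ->
  \sum_x nu x * `|badness Fr Y x - badness Fr Y' x| <=
  4 * eps * (1 - #|Y'|%:R / #|Y|%:R) * S.
Proof.
move=> dY dY' sY Y'0; have Y0 : (0 < #|Y|)%N by apply: leq_trans Y'0 (subset_leq_card sY).
set th := 1 - _.
have th0 : 0 <= th.
  rewrite /th subr_ge0 ler_pdivrMr ?ltr0n // mul1r ler_nat.
  exact: subset_leq_card.
pose nb I J b x := wbias I J Y b x / #|Y|%:R.
pose nb' I J b x := wbias I J Y' b x / #|Y'|%:R.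
pose d I J b x := (c I J ^+ 2)^-1 * (2 * th * (`|nb I J b x| + `|nb' I J b x|)).
have d0 I J b x : 0 <= d I J b x.
  by rewrite !mulr_ge0 ?invr_ge0 ?sqr_ge0 // addr_ge0.
have step1 x : `|badness Fr Y x - badness Fr Y' x| <=
   \sum_(I | nonempty_sub Fr I) \sum_(J | relevant Fr I J)
    (vol R L J)^-1 * \sum_b d I J b x.
  rewrite /badness -sumrB; apply: le_trans (ler_norm_sum _ _ _) _.
  apply: ler_sum => I _; rewrite -sumrB; apply: le_trans (ler_norm_sum _ _ _) _.
  apply: ler_sum => J _; rewrite -mulrBr normrM ger0_norm ?invr_ge0 ?vol_ge0 //.
  rewrite ler_wpM2l ?invr_ge0 ?vol_ge0 // -sumrB.
  apply: le_trans (ler_norm_sum _ _ _) _; apply: ler_sum => b _.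
  have e u : ((c I J)^-1 * u) ^+ 2 = (c I J ^+ 2)^-1 * u ^+ 2.
    by rewrite exprMn exprVn.
  rewrite -/(c I J) -/(nb I J b x) -/(nb' I J b x) !e -mulrBr normrM.
  rewrite ger0_norm ?invr_ge0 ?sqr_ge0 // /d ler_wpM2l ?invr_ge0 ?sqr_ge0 //.
  rewrite subr_sqr normrM; apply: ler_pM => //; first exact: (bias_cont I J b x sY Y'0).
  exact: ler_normD.
apply: (@le_trans _ _ (\sum_x nu x * \sum_(I | nonempty_sub Fr I)
   \sum_(J | relevant Fr I J) (vol R L J)^-1 * \sum_b d I J b x)).
  by apply: ler_sum => x _; rewrite ler_wpM2l.
have tS0 : 0 <= 4 * th * S by rewrite !mulr_ge0.
have -> : 4 * eps * th * S = eps * (4 * th * S) by ring.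
apply: le_trans (par_sum_Fr tS0).
under eq_bigr => x _ do rewrite mulr_sumr.
rewrite exchange_big /=; apply: ler_sum => I /andP[IF I0].
under eq_bigr => x _ do rewrite mulr_sumr.
rewrite exchange_big /=; apply: ler_sum => J /and3P[JF dIJ _].
under eq_bigr => x _ do rewrite mulrCA mulr_sumr.
rewrite -mulr_sumr exchange_big /=.
set l := (sigma * tau) ^+ #|I|.
have inner (b : Om) : \sum_x nu x * d I J b x <= (c I J ^+ 2)^-1 * (4 * th * (l * S)).
  have -> : \sum_x nu x * d I J b x = (c I J ^+ 2)^-1 * (2 * th *
     (\sum_x nu x * `|nb I J b x| + \sum_x nu x * `|nb' I J b x|)).
    rewrite -big_split !mulr_sumr; apply: eq_bigr => x _ /=.
    by rewrite /d -mulrDr; ring.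
  rewrite ler_wpM2l ?invr_ge0 ?sqr_ge0 //.
  have h1 := bias_abs_le b IF JF dIJ dY Y0.
  have h2 := bias_abs_le b IF JF dIJ dY' Y'0.
  rewrite -/l in h1 h2.
  have -> : 4 * th * (l * S) = 2 * th * (l * S + l * S) by ring.
  by rewrite ler_wpM2l ?mulr_ge0 // lerD.
apply: (@le_trans _ _ ((vol R L J)^-1 *
    \sum_(b : Om) ((c I J ^+ 2)^-1 * (4 * th * (l * S))))).
  by rewrite ler_wpM2l ?invr_ge0 ?vol_ge0 //; apply: ler_sum.
rewrite sum_const_vol.
have -> : T ^+ #|J| * ((c I J ^+ 2)^-1 * (4 * th * (l * S))) =
   T ^+ #|J| * (l / c I J ^+ 2) * (4 * th * S) by ring.
rewrite ler_wpM2r //.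
have -> : l / c I J ^+ 2 = (sigma / tau) ^+ #|I| * ((r2 ^+ #|J|)^-1) ^+ 2.
  rewrite /l /c [(sigma * tau) ^+ _]exprMn [(sigma / tau) ^+ _]expr_div_n; field.
  by rewrite !expf_neq0 ?gt_eqF.
have tau2 : 0 < tau ^+ 2 by rewrite exprn_gt0.
have e1 : (sigma / tau) ^+ #|I| <= (sigma / tau ^+ 2) ^+ #|I|.
  apply: lerXn2r; rewrite ?nnegrE ?(ltW (divr_gt0 _ _)) //.
  rewrite (ler_pM2l sigma0) lef_pV2 ?posrE // expr2 ler_piMl ?(ltW tau0) //.
  exact: par_tau1 par.
have e2 : (r2 ^+ #|J|)^-1 <= T ^+ #|J|.
  rewrite -exprVn; apply: lerXn2r; rewrite ?nnegrE ?invr_ge0 ?ler0n ?(ltW r20) //.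
  by rewrite -[leLHS]mul1r ler_pdivrMr // (par_Tr2 par).
have e0 : 0 <= (r2 ^+ #|J|)^-1 by rewrite invr_ge0 exprn_ge0 // ltW.
rewrite mulrCA; apply: ler_pM => //.
- by rewrite exprn_ge0 // divr_ge0 ?ltW.
- by rewrite mulr_ge0 ?exprn_ge0 ?ler0n ?sqr_ge0.
have -> : (3 * #|J| = #|J| + #|J| * 2)%N by rewrite mulSn mulnC.
rewrite [leRHS]exprD [X in _ <= _ * X]exprM.
rewrite ler_wpM2l ?exprn_ge0 ?ler0n //; apply: lerXn2r => //.
by rewrite nnegrE exprn_ge0 ?ler0n.
Qed.

End Weighted.

(** Markov's inequality for the mean badness. *)
Lemma unsafe_le Fr X Y : dense (2 * r2) Fr (ind R X) -> dense r Fr (ind R Y) ->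
  (0 < #|Y|)%N ->
  #|[set x in X | ~~ (badness Fr Y x < 1)]|%:R <= eps * #|X|%:R.
Proof.
move=> dX dY Y0; have i0 x : 0 <= ind R X x by apply: ler0n.
have H := badness_mean i0 dX dY Y0; rewrite sum_ind_card in H.
apply: le_trans H; rewrite -sum_ind_card; apply: ler_sum => x _.
rewrite /ind inE; case: (x \in X); rewrite /= ?mul0r // mul1r.
by case: ltP => //= ?; rewrite badness_ge0.
Qed.

End Badness.

(** * Fixing gadget outputs: Fourier expansion *)

Section Fourier.

Variables (R : realFieldType) (C L : finType) (gd : L -> L -> bool).
Local Notation Om := {ffun C -> L}.
Local Notation wbias := (bias R gd).
Implicit Types (I J Fr : {set C}) (x y a b : Om) (X Y : {set Om}).

Lemma prod1D (I : {set C}) (u : C -> R) :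
  \prod_(j in I) (1 + u j) = \sum_(A : {set C} | A \subset I) \prod_(j in A) u j.
Proof.
transitivity (\prod_j ((if j \in I then u j else 0) + 1)).
  rewrite big_mkcond; apply: eq_bigr => j _; case: ifP => _; first exact: addrC.
  by rewrite add0r.
rewrite bigA_distr [RHS]big_mkcond; apply: eq_bigr => A _.
rewrite -big_mkcond /=; case: ifP => [/subsetP AI|/negbT /subsetPn[j jA jI]].
  by apply: eq_bigr => j /AI ->.
by rewrite (bigD1 j) //= (negbTE jI) mul0r.
Qed.

Definition zset I x (w : {ffun C -> bool}) Y :=
  [set y in Y | [forall j in I, gd (x j) (y j) == w j]].

Lemma zsetE I J x w Y b :
  #|[set y in zset I x w Y | agree J y b]|%:R =
  (2 ^+ #|I|)^-1 * \sum_(A : {set C} | A \subset I)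
     (\prod_(j in A) (-1) ^+ w j) * wbias A J Y b x.
Proof.
pose e j y : R := (gd (x j) (y j) == w j)%:R.
have eE j y : e j y = 2^-1 * (1 + (-1) ^+ w j * sgn R gd (x j) (y j)).
  by rewrite /e /sgn; case: (w j); case: (gd _ _); rewrite /= ?expr0 ?expr1; field.
transitivity (\sum_(y in Y | agree J y b) \prod_(j in I) e j y).
  rewrite -sum1_card natr_sum [LHS]big_mkcond [RHS]big_mkcond.
  apply: eq_bigr => y _; rewrite !inE /=; case: (y \in Y) => //=.
  case: (agree J y b); rewrite ?andbF ?andbT //.
  case: ifP => [/'forall_in_eqP h|/negbT].
    by rewrite big1 // => j jI; rewrite /e h ?eqxx.
  rewrite negb_forall => /existsP[j]; rewrite negb_imply => /andP[jI h].
  by rewrite (bigD1 j) //= /e (negbTE h) mul0r.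
under eq_bigr => y _.
  under eq_bigr => j _ do rewrite eE.
  rewrite big_split /= prodr_const exprVn prod1D; over.
rewrite -mulr_sumr exchange_big /=; congr (_ * _); apply: eq_bigr => A _.
rewrite /bias mulr_sumr; apply: eq_bigr => y _.
by rewrite /chi -big_split.
Qed.

Variables (h tau r r2 sigma eps : R).
Hypothesis par : params C gd h tau r r2 sigma eps.
Hypothesis htau : (1 + tau) ^+ #|C| <= 4 / 3.

Let r0 := par_r0 par.
Let tau0 := par_tau0 par.
Let r20 : 0 < r2. Proof. exact: lt_le_trans r0 (par_rr2 par). Qed.

Lemma sum_tau I : \sum_(A : {set C} | A \subset I) tau ^+ #|A| <= 4 / 3.
Proof.
have -> : \sum_(A : {set C} | A \subset I) tau ^+ #|A| = (1 + tau) ^+ #|I|.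
  by rewrite -prodr_const prod1D; apply: eq_bigr => A _; rewrite prodr_const.
apply: le_trans htau; apply: ler_weXn2l; last exact: max_card.
by rewrite lerDl ltW.
Qed.

Section Zset.

Variables (Fr I : {set C}) (x : Om) (Y : {set Om}) (w : {ffun C -> bool}).
Hypotheses (dY : dense r Fr (ind R Y)) (sx : safe gd tau r2 Fr Y x)
  (IF : I \subset Fr).

Let normr_sgnprod (A : {set C}) : `|\prod_(j in A) ((-1) ^+ w j : R)| = 1.
Proof.
by rewrite normr_prod big1 // => j _; case: (w j); rewrite ?expr1 ?normrN1 ?normr1.
Qed.

Lemma zset_le J b : J \subset Fr -> [disjoint I & J] ->
  #|[set y in zset I x w Y | agree J y b]|%:R <=
  (2 ^+ #|I|)^-1 * (4 / 3 * r2 ^+ #|J| * #|Y|%:R).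
Proof.
move=> JF dIJ; rewrite zsetE ler_wpM2l ?invr_ge0 ?exprn_ge0 //.
apply: (@le_trans _ _ (\sum_(A : {set C} | A \subset I)
   tau ^+ #|A| * (r2 ^+ #|J| * #|Y|%:R))); last first.
  rewrite -mulr_suml -[leRHS]mulrA ler_wpM2r ?sum_tau //.
  by rewrite mulr_ge0 ?ler0n ?exprn_ge0 ?ltW.
apply: ler_sum => A AI; apply: le_trans (ler_norm _) _.
rewrite normrM normr_sgnprod mul1r mulrA.
have [->|A0] := eqVneq A set0.
  apply: le_trans (normr_bias _ _ _ _ _ _ _) _.
  apply: le_trans (dY b JF) _; rewrite sum_ind_card ler_wpM2r ?ler0n //.
  rewrite cards0 mul1r; apply: lerXn2r; rewrite ?nnegrE ?(par_rr2 par) ?ltW //.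
apply: sx => //; first exact: subset_trans AI IF.
exact: disjointWl AI dIJ.
Qed.

(** The empty character contributes [#|Y|]; by safety all the others together contribute at most a
    third of it, since [sum_tau] leaves [1 / 3] for them. In particular every output pattern w
    occurs when [Y] is nonempty. *)
Lemma zset_ge :
  (2 ^+ #|I|)^-1 * (2 / 3 * #|Y|%:R) <= #|zset I x w Y|%:R :> R.
Proof.
have -> : #|zset I x w Y| = #|[set y in zset I x w Y | agree set0 y x]|.
  by apply: eq_card => y; rewrite !inE agree0 andbT.
rewrite zsetE ler_wpM2l ?invr_ge0 ?exprn_ge0 //.
have st := sum_tau I.
rewrite (bigD1 set0) ?sub0set //= cards0 expr0 in st.
rewrite (bigD1 set0) ?sub0set //= big_set0 mul1r.
have -> : wbias set0 set0 Y x x = #|Y|%:R.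
  rewrite -sum1_card natr_sum; apply: eq_big => y; first by rewrite agree0 andbT.
  by rewrite /chi big_set0.
set s := \sum_(i | _) _ in st.
have : `|\sum_(A : {set C} | (A \subset I) && (A != set0))
    (\prod_(j in A) (-1) ^+ w j) * wbias A set0 Y x x| <= s * #|Y|%:R.
  apply: le_trans (ler_norm_sum _ _ _) _; rewrite mulr_suml.
  apply: ler_sum => A /andP[AI A0].
  rewrite normrM normr_sgnprod mul1r.
  have := sx x (subset_trans AI IF) (sub0set _) _ A0.
  by rewrite cards0 expr0 mulr1; apply; rewrite -setI_eq0 setI0.
rewrite ler_norml => /andP[+ _]; have : (0 : R) <= #|Y|%:R by apply: ler0n.
nra.
Qed.

(** The constants [4 / 3] of [zset_le] and [2 / 3] of [zset_ge] leave a factor 2, which [2 ^+ #|J|]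
    absorbs because [J] is nonempty. This is the origin of the bound [2 * r2]. *)
Lemma zset_dense : (0 < #|Y|)%N -> dense (2 * r2) (Fr :\: I) (ind R (zset I x w Y)).
Proof.
move=> Y0 J b JF; rewrite sum_ind_card sum_ind.
have [->|J0] := eqVneq J set0.
  rewrite cards0 expr0 mul1r ler_nat; apply: subset_leq_card.
  by apply/subsetP => y; rewrite inE => /andP[].
have JFr : J \subset Fr by apply: subset_trans JF (subsetDl _ _).
have dIJ : [disjoint I & J].
  rewrite disjoint_sym disjoints_subset; apply: subset_trans JF _.
  by rewrite setDE subsetIr.
apply: le_trans (zset_le b JFr dIJ) _.
have zg := zset_ge.
set q := (2 ^+ #|I|)^-1 in zg *; set Z := #|zset _ _ _ _|%:R in zg *.
have q0 : 0 <= q by rewrite invr_ge0 exprn_ge0.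
rewrite exprMn; set a := r2 ^+ #|J|; have a0 : 0 <= a by rewrite exprn_ge0 // ltW.
have e2 : 2 <= 2 ^+ #|J| :> R.
  by rewrite -{1}[2]expr1 ler_weXn2l ?ler1n // card_gt0.
have Z0 : 0 <= Z by apply: ler0n.
have : a * (q * (2 / 3 * #|Y|%:R)) <= a * Z by rewrite ler_wpM2l.
have : 0 <= a * Z by rewrite mulr_ge0.
have : 2 * (a * Z) <= 2 ^+ #|J| * (a * Z) by rewrite ler_wpM2r // mulr_ge0.
nra.
Qed.

End Zset.

End Fourier.

Section Restore.

Variables (R : realFieldType) (C L : finType).
Local Notation Om := {ffun C -> L}.

(* Fixing a block that maximizes the density loss restores density, as any
   further violation would enlarge the maximal block. *)
Lemma restore_dense (r : R) (Fr : {set C}) (X : {set Om}) :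
  0 < r -> X != set0 ->
  exists (I : {set C}) (a : Om), [/\ I \subset Fr,
    r ^+ #|I| * #|X|%:R <= #|[set x in X | agree I x a]|%:R &
    dense r (Fr :\: I) (ind R [set x in X | agree I x a])].
Proof.
move=> r0 /set0Pn[x0 x0X].
pose F (p : {set C} * Om) : R := #|[set x in X | agree p.1 x p.2]|%:R / r ^+ #|p.1|.
pose P := [pred p : {set C} * Om | p.1 \subset Fr].
have P0 : P (set0, x0) by rewrite /= sub0set.
case: (@Order.TotalTheory.arg_maxP _ _ _ (set0, x0) P F P0) => -[I a] /= IF mx.
exists I, a; split => //.
  have := mx (set0, x0) P0; rewrite /F /= cards0 expr0 divr1.
  have -> : [set x in X | agree set0 x x0] = X.
    by apply/setP => x; rewrite inE agree0 andbT.
  by rewrite ler_pdivlMr ?exprn_gt0 // mulrC.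
move=> J b JF; rewrite sum_ind_card sum_ind.
have dIJ : [disjoint I & J].
  rewrite disjoint_sym disjoints_subset; apply: subset_trans JF _.
  by rewrite setDE subsetIr.
have /(mx (_, merge I a b)) : P (I :|: J, merge I a b).
  by rewrite /= subUset IF (subset_trans JF (subsetDl _ _)).
rewrite /F /=.
have -> : [set x in X | agree (I :|: J) x (merge I a b)] =
    [set x in [set x in X | agree I x a] | agree J x b].
  by apply/setP => x; rewrite !inE agree_merge // andbA.
rewrite cardsU (disjoint_setI0 dIJ) cards0 subn0 exprD.
by rewrite ler_pdivrMr ?mulr_gt0 ?exprn_gt0 // mulrA divfK ?gt_eqF ?exprn_gt0 // mulrC.
Qed.

End Restore.

(** * Lifting of small protocols *)

Lemma disjointDU (C : finType) (A B I : {set C}) :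
  [disjoint A & B] -> [disjoint A :\: I & B :|: I].
Proof.
move=> /disjoint_setI0 AB; rewrite -setI_eq0 setIUr setDE setIAC AB set0I set0U.
by rewrite -setIA (setIC _ I) setICr setI0.
Qed.

Section Turn.

Variables (R : realFieldType) (C L : finType).
Local Notation Om := {ffun C -> L}.
Implicit Types (I J Fr F : {set C}) (x y a b : Om) (X Y : {set Om})
  (z w : {ffun C -> bool}).

Variables (adv : {set C} -> {ffun C -> bool} -> nat -> Prop).
Hypothesis adv_step : forall F z k j, j \notin F -> adv F z k ->
  exists2 w : {ffun C -> bool}, {in F, w =1 z} & adv (j |: F) w k.-1.

Lemma adv_answer F z k I : [disjoint I & F] -> adv F z k ->
  exists2 w : {ffun C -> bool}, {in F, w =1 z} & adv (F :|: I) w (k - #|I|).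
Proof.
move: I {2}#|I| (erefl #|I|) => I n; elim: n => [|n IHn] in F z k I *.
  move/cards0_eq => -> _ az; exists z => //.
  by rewrite setU0 cards0 subn0.
move=> cI dIF az; have : I != set0 by rewrite -card_gt0 cI.
case/set0Pn => j jI.
have jF : j \notin F by rewrite (disjointFr dIF jI).
have [z' z'z az'] := adv_step jF az.
have cIj : #|I :\ j| = n by move: cI; rewrite (cardsD1 j) jI => -[].
have dIj : [disjoint I :\ j & j |: F].
  rewrite -setI_eq0 -subset0; apply/subsetP => i; rewrite !inE.
  by case: eqP => //= _ /andP[iI iF]; rewrite (disjointFr dIF iI) in iF.
have [w wz' aw] := IHn _ _ _ _ cIj dIj az'.
exists w => [i iF|].
  by rewrite wz' ?z'z // inE iF orbT.
move: aw; rewrite cIj cI -subn1 -subnDA add1n.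
suff -> : j |: F :|: I :\ j = F :|: I by [].
by rewrite setUAC setD1K // setUC.
Qed.

(* [Cx] (resp. [Cy]) is a set of coordinates on which X (resp. Y) is constant,
   [F] is the set of queried coordinates, answered according to z. *)
Definition state (q : nat) (gd : L -> L -> bool) X Y Cx Cy Fr F z :=
  [/\ {in X &, forall x x', agree Cx x x'}, {in Y &, forall y y', agree Cy y y'},
      [disjoint Fr & Cx] && [disjoint Fr & Cy] && [disjoint Fr & F],
      (forall x y j, x \in X -> y \in Y -> j \in F -> gd (x j) (y j) = z j) &
      adv F z (q - #|F|)].

Definition flip (gd : L -> L -> bool) u v := gd v u.

Lemma state_flip q gd X Y Cx Cy Fr F z :
  state q gd X Y Cx Cy Fr F z -> state q (flip gd) Y X Cy Cx Fr F z.
Proof.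
case=> cx cy /andP[/andP[d1 d2] d3] hz az; split => //; first by rewrite d1 d2 d3.
by move=> y x j yY xX jF; apply: hz.
Qed.

Lemma state_sub q gd X Y Cx Cy Fr F z X' Y' : X' \subset X -> Y' \subset Y ->
  state q gd X Y Cx Cy Fr F z -> state q gd X' Y' Cx Cy Fr F z.
Proof.
move=> /subsetP sX /subsetP sY [cx cy d hz az]; split => //.
- by move=> x x' /sX xX /sX x'X; apply: cx.
- by move=> x x' /sY xX /sY x'X; apply: cy.
- by move=> x y j /sX xX /sY yY; apply: hz.
Qed.

Variables (q : nat) (gd : L -> L -> bool) (h tau r r2 sigma eps g : R).
Hypothesis par : params C gd h tau r r2 sigma eps.
Hypothesis htau : (1 + tau) ^+ #|C| <= 4 / 3.
Hypothesis hg0 : 0 <= g.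
Hypothesis hg : 4 * g <= r * #|L|%:R.
Hypothesis heps : eps <= 1 / 4.

Let L0 := par_L par.
Let r0 := par_r0 par.

(** Relative to the subcube in which the coordinates of [Cx] are fixed; hence fixing a predictable
    block increases it. *)
Definition density X (Cx : {set C}) : R := #|X|%:R / vol R L Cx.

Lemma density_ge0 X Cx : 0 <= density X Cx.
Proof. by rewrite divr_ge0 ?ler0n ?vol_ge0. Qed.

Lemma density_le1 X Cx : {in X &, forall x x', agree Cx x x'} -> density X Cx <= 1.
Proof.
move=> cx; rewrite ler_pdivrMr ?vol_gt0 // mul1r.
have [->|/set0Pn[x xX]] := eqVneq X set0; first by rewrite cards0 vol_ge0.
by apply: (@card_agree_vol R C L Cx X x) => x' x'X; apply: cx.
Qed.

(** The outcome of one turn of the first player: a block [I] of X is fixed and its gadget outputs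
    are answered by w. X regains density [r], whereas Y is left with [2 * r2], so the players have
    to alternate. *)
Definition turned X Y Cx Cy Fr F (D : R) :=
  exists I X' Y' (w : {ffun C -> bool}), [/\ I \subset Fr, X' \subset X, Y' \subset Y,
    (0 < #|X'|)%N && (0 < #|Y'|)%N &
   [/\ state q gd X' Y' (Cx :|: I) Cy (Fr :\: I) (F :|: I) w,
    dense r (Fr :\: I) (ind R X'), dense (2 * r2) (Fr :\: I) (ind R Y') &
    D * g ^+ #|I| <= density X' (Cx :|: I) * density Y' Cy]].

(** Let $k = |I|$. Fixing the block keeps a share $r^k$ of X in a subcube smaller by $|L|^k$, and
    prescribing its outputs keeps at least a share $4^{-k}$ of Y. As [4 * g <= r * #|L|%:R], the
    product of the densities grows by $g^k$ at least. *)
Lemma turn_safe X Y Cx Cy Fr F z :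
  state q gd X Y Cx Cy Fr F z -> (0 < #|X|)%N -> (0 < #|Y|)%N ->
  {in X, forall x, safe gd tau r2 Fr Y x} -> dense r Fr (ind R Y) ->
  turned X Y Cx Cy Fr F (density X Cx * density Y Cy).
Proof.
move=> st X0 Y0 sX dY; have [cx cy /andP[/andP[d1 d2] d3] hz az] := st.
have Xn : X != set0 by rewrite -card_gt0.
have [I [a [IF cX' dX']]] := restore_dense Fr r0 Xn.
set X' := [set x in X | _] in cX' dX'.
have X'0 : (0 < #|X'|)%N.
  rewrite -(ltr0n R); apply: lt_le_trans cX'.
  by rewrite mulr_gt0 ?exprn_gt0 ?ltr0n.
have X'X : X' \subset X by apply/subsetP => x; rewrite inE => /andP[].
have dIF : [disjoint I & F] by apply: disjointWl IF d3.
have [w wz aw] := adv_answer dIF az.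
have [x xX'] := card_gt0P X'0.
have xX := subsetP X'X _ xX'.
set Y' := zset gd I x w Y.
have Y'Y : Y' \subset Y by apply/subsetP => y; rewrite inE => /andP[].
have Y'ge := zset_ge par htau w (sX _ xX) IF; rewrite -/Y' in Y'ge.
have Y'0 : (0 < #|Y'|)%N.
  rewrite -(ltr0n R); apply: lt_le_trans Y'ge.
  by rewrite mulr_gt0 ?invr_gt0 ?exprn_gt0 // mulr_gt0 ?ltr0n // divr_gt0.
have dICx : [disjoint Cx & I] by rewrite disjoint_sym; apply: disjointWl IF d1.
exists I, X', Y', w; split => //; first by rewrite X'0 Y'0.
split => //.
- split.
  + move=> u v uX' vX'; rewrite agreeU; apply/andP; split.
      by apply: cx; apply: (subsetP X'X).
    move: uX' vX'; rewrite !inE => /andP[_ ua] /andP[_ va].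
    by apply: agree_trans ua _; rewrite agree_sym.
  + by move=> u v uY' vY'; apply: cy; apply: (subsetP Y'Y).
  + by rewrite !disjointDU // (disjointWl (subsetDl _ _)).
  + move=> u v j uX' vY'; rewrite inE => /orP[jF|jI].
      by rewrite wz // (hz u v j) ?(subsetP X'X) ?(subsetP Y'Y).
    move: vY'; rewrite inE => /andP[_ /forall_inP/(_ j jI)/eqP <-].
    move: uX' xX'; rewrite !inE => /andP[_ /agreeP ua] /andP[_ /agreeP xa].
    by rewrite ua // xa.
  + by rewrite cardsU (disjoint_setI0 (_ : [disjoint F & I])) ?cards0 ?subn0 1?disjoint_sym // subnDA.
- exact: (zset_dense par htau w dY (sX _ xX) IF Y0).
rewrite /density (volU R L dICx).
set V := vol R L (Cx :|: I); set W := vol R L Cy; set k := #|I| in cX' Y'ge *.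
have V0 : 0 < V by apply: vol_gt0.
have W0 : 0 < W by apply: vol_gt0.
have Tk : 0 < (#|L|%:R : R) ^+ k by rewrite exprn_gt0 // ltr0n.
(* A turn with empty [I] must lose nothing, since such turns are not compensated by any query; there
   Y' is all of Y. For k > 0 the factor [2 / 3] is absorbed by passing from [2 ^+ k] to [4 ^+ k]. *)
have Y'4 : (4 ^+ k)^-1 * #|Y|%:R <= #|Y'|%:R :> R.
  have [k0|k0] := posnP k.
    rewrite k0 expr0 invr1 mul1r ler_nat; apply: subset_leq_card.
    apply/subsetP => y yY; rewrite inE yY; apply/forall_inP => j.
    by move/eqP: k0; rewrite cards_eq0 => /eqP ->; rewrite inE.
  apply: le_trans Y'ge; rewrite mulrA ler_wpM2r ?ler0n //.
  have -> : (4 : R) ^+ k = 2 ^+ k * 2 ^+ k by rewrite -exprMn; congr (_ ^+ _); ring.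
  rewrite invfM ler_wpM2l ?invr_ge0 ?exprn_ge0 //.
  rewrite -[leRHS]invrK lef_pV2 ?posrE ?exprn_gt0 ?divr_gt0 ?ltr0n //.
  have : 2 <= 2 ^+ k :> R by rewrite -{1}[2]expr1 ler_weXn2l ?ler1n.
  have -> : (2 / 3 : R)^-1 = 3 / 2 by field.
  lra.
have gk : g ^+ k <= (r * #|L|%:R / 4) ^+ k.
  apply: lerXn2r; rewrite ?nnegrE ?divr_ge0 ?mulr_ge0 ?ler0n ?(ltW r0) //.
  by rewrite ler_pdivlMr // mulrC.
have -> : #|X|%:R / (V * #|L|%:R ^+ k) * (#|Y|%:R / W) * g ^+ k =
    g ^+ k * (#|X|%:R * #|Y|%:R / (#|L|%:R ^+ k * (V * W))).
  by field; rewrite !gt_eqF.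
apply: (@le_trans _ _ ((r * #|L|%:R / 4) ^+ k *
    (#|X|%:R * #|Y|%:R / (#|L|%:R ^+ k * (V * W))))).
  by rewrite ler_wpM2r // divr_ge0 ?mulr_ge0 ?ler0n // ltW.
have -> : (r * #|L|%:R / 4) ^+ k * (#|X|%:R * #|Y|%:R / (#|L|%:R ^+ k * (V * W))) =
    (r ^+ k * #|X|%:R) * ((4 ^+ k)^-1 * #|Y|%:R) / (V * W).
  rewrite expr_div_n exprMn; field.
  by rewrite !gt_eqF // exprn_gt0.
have -> : #|X'|%:R / V * (#|Y'|%:R / W) = #|X'|%:R * #|Y'|%:R / (V * W) :> R.
  by field; rewrite !gt_eqF.
rewrite ler_wpM2r ?invr_ge0 ?mulr_ge0 ?(ltW V0) ?(ltW W0) //.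
apply: ler_pM => //; rewrite mulr_ge0 ?invr_ge0 ?exprn_ge0 ?ler0n //.
exact: ltW.
Qed.

(** Half of X survives the bit that was sent and at most a quarter of X is unsafe, so a quarter of X
    remains for [turn_safe]. *)
Lemma turn X Y Cx Cy Fr F z X1 :
  state q gd X Y Cx Cy Fr F z -> (0 < #|X|)%N -> (0 < #|Y|)%N ->
  dense (2 * r2) Fr (ind R X) -> dense r Fr (ind R Y) ->
  X1 \subset X -> (#|X| <= 2 * #|X1|)%N ->
  turned X1 Y Cx Cy Fr F (density X Cx * density Y Cy / 4).
Proof.
move=> st X0 Y0 dX dY sX cX.
pose X2 := [set x in X1 | badness gd tau r r2 Fr Y x < 1].
have X2X : X2 \subset X.
  by apply: subset_trans sX; apply/subsetP => x; rewrite inE => /andP[].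
have cX2 : #|X|%:R / 4 <= #|X2|%:R :> R.
  have := unsafe_le par dX dY Y0; set U := [set x in X | _].
  have : (#|X1| <= #|X2| + #|U|)%N.
    rewrite -(cardsID X2 X1) leq_add //.
      by apply: subset_leq_card; apply/subsetP => x; rewrite !inE => /andP[].
    apply: subset_leq_card; apply/subsetP => x; rewrite !inE => /andP[+ xX1].
    by rewrite xX1 (subsetP sX).
  rewrite -(ler_nat R) natrD; move: cX; rewrite -(ler_nat R) natrM.
  have : (0 : R) <= #|X|%:R by apply: ler0n.
  move: heps; nra.
have X20 : (0 < #|X2|)%N.
  by rewrite -(ltr0n R); apply: lt_le_trans cX2; rewrite divr_gt0 ?ltr0n.
have st2 := state_sub X2X (subxx _) st.
have sf : {in X2, forall x, safe gd tau r2 Fr Y x}.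
  by move=> x; rewrite inE => /andP[_ hb]; apply: (badness_safe par dY hb).
have [I [X' [Y' [w [IF X'X Y'Y c0 [st' dX' dY' hD]]]]]] := turn_safe st2 X20 Y0 sf dY.
exists I, X', Y', w; split => //.
  by apply: subset_trans X'X _; apply/subsetP => x; rewrite inE => /andP[].
split => //; apply: le_trans hD; rewrite ler_wpM2r ?exprn_ge0 //.
rewrite mulrAC ler_wpM2r ?density_ge0 // /density mulrAC.
by rewrite ler_wpM2r ?invr_ge0 ?vol_ge0.
Qed.

End Turn.

(** * Balanced cutting of protocols *)

Section ProtocolSplit.

Variables (X Y O : Type).
Implicit Types p : protocol X Y O.

Lemma protocol_leaves_gt0 p : (0 < protocol_leaves p)%N.
Proof. by elim: p => //= _ p0 h0 p1 h1; rewrite addn_gt0 h0. Qed.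

(** Walk into the child with more leaves until at most [K] of them are left: the parent had more
    than [K], so more than half of [K] remain. The inputs that reach this subtree form a rectangle;
    outside it the subtree can be cut out, its sibling taking the place of the parent. *)
Lemma protocol_split (K : nat) p : (0 < K < protocol_leaves p)%N ->
  exists (a : X -> bool) (b : Y -> bool) (pv pr : protocol X Y O),
    [/\ (protocol_leaves pv <= K)%N, (K < 2 * protocol_leaves pv)%N,
        (protocol_leaves pr + protocol_leaves pv = protocol_leaves p)%N &
        forall x y, protocol_eval p x y =
          if a x && b y then protocol_eval pv x y else protocol_eval pr x y].
Proof.
case/andP=> K0; elim: p => [ o|c p0 IH0 p1 IH1|c p0 IH0 p1 IH1] /=.
- by case: K K0.
- move=> Kp; have [le01|lt10] := leqP (protocol_leaves p0) (protocol_leaves p1).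
    have [K1|{IH0}/IH1[a [b [pv [pr [h1 h2 h3 h4]]]]]] := leqP (protocol_leaves p1) K.
      by exists c, xpredT, p1, p0; split => // [|x y]; [lia|rewrite andbT].
    exists (fun x => c x && a x), b, pv, (PAlice c p0 pr); split => //=; first lia.
    by move=> x y; case: (c x) => //=.
  have [K1|{IH1}/IH0[a [b [pv [pr [h1 h2 h3 h4]]]]]] := leqP (protocol_leaves p0) K.
    exists (fun x => ~~ c x), xpredT, p0, p1; split => //; [lia|lia|].
    by move=> x y; rewrite andbT; case: (c x).
  exists (fun x => ~~ c x && a x), b, pv, (PAlice c pr p1); split => //=; first lia.
  by move=> x y; case: (c x) => //=.
- move=> Kp; have [le01|lt10] := leqP (protocol_leaves p0) (protocol_leaves p1).
    have [K1|{IH0}/IH1[a [b [pv [pr [h1 h2 h3 h4]]]]]] := leqP (protocol_leaves p1) K.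
      by exists xpredT, c, p1, p0; split => //; lia.
    exists a, (fun y => c y && b y), pv, (PBob c p0 pr); split => //=; first lia.
    by move=> x y; case: (c y) => //=; rewrite andbF.
  have [K1|{IH1}/IH0[a [b [pv [pr [h1 h2 h3 h4]]]]]] := leqP (protocol_leaves p0) K.
    exists xpredT, (fun y => ~~ c y), p0, p1; split => //; [lia|lia|].
    by move=> x y /=; case: (c y).
  exists a, (fun y => ~~ c y && b y), pv, (PBob c pr p1); split => //=; first lia.
  by move=> x y; case: (c y) => //=; rewrite andbF.
Qed.

End ProtocolSplit.

Lemma half_set (I : finType) (X : {set I}) (a : I -> bool) :
  (#|X| <= 2 * #|[set x in X | a x]|)%N \/ (#|X| <= 2 * #|[set x in X | ~~ a x]|)%N.
Proof.
have : (#|X| = #|[set x in X | a x]| + #|[set x in X | ~~ a x]|)%N.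
  rewrite -(cardsID [set x | a x] X).
  by congr (_ + _)%N; apply: eq_card => x; rewrite !inE // andbC.
lia.
Qed.

Section Lifting.

Variables (R : realFieldType) (C L : finType) (W : Type).
Local Notation Om := {ffun C -> L}.
Implicit Types (I J Fr F Cx Cy : {set C}) (x y a b : Om) (X Y : {set Om})
  (z w : {ffun C -> bool}).

Variables (gd : L -> L -> bool) (good : W -> {ffun C -> bool} -> Prop)
  (Lc : {set C}).

Variables (adv : {set C} -> {ffun C -> bool} -> nat -> Prop).
Hypothesis adv_step : forall F z k j, j \notin F -> adv F z k ->
  exists2 w : {ffun C -> bool}, {in F, w =1 z} & adv (j |: F) w k.-1.
Hypothesis adv_end : forall F z k o, adv F z k.+1 ->
  exists2 w : {ffun C -> bool}, {in F, w =1 z} &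
    forall w' : {ffun C -> bool}, {in Lc, w' =1 w} -> ~ good o w'.

Variables (q : nat) (h tau r r2 sigma eps g Theta : R).
Hypothesis par : params C gd h tau r r2 sigma eps.
Hypothesis parf : params C (flip gd) h tau r r2 sigma eps.
Hypothesis htau : (1 + tau) ^+ #|C| <= 4 / 3.
Hypothesis hg1 : 1 <= g.
Hypothesis hg : 4 * g <= r * #|L|%:R.
Hypothesis heps : eps <= 1 / 4.
Hypothesis hTheta : 0 <= Theta < g ^+ q.

Definition output x y : {ffun C -> bool} := [ffun c => gd (x c) (y c)].

Let g0 : 0 <= g. Proof. by apply: le_trans hg1. Qed.

Let aux1 (u v : R) : 4 * u <= 3 * v -> u <= 3 / 4 * v.
Proof. by lra. Qed.

(** This fixes the exponent 10: a round costs a factor 4 in density for each player and leaves at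
    most three quarters of the leaves, and $(3/4)^{10} \le 1/16$. *)
Let aux2 (i k : nat) : (4 * i <= 3 * k)%N -> (i%:R : R) ^+ 10 <= k%:R ^+ 10 / 16.
Proof.
rewrite -(ler_nat R) !natrM => /aux1 ik.
apply: (@le_trans _ _ ((3 / 4 * k%:R) ^+ 10)).
  by apply: lerXn2r; rewrite // nnegrE ?ler0n // mulr_ge0 ?ler0n // divr_ge0.
rewrite exprMn mulrC ler_wpM2l ?exprn_ge0 ?ler0n //.
by rewrite !exprS expr0; lra.
Qed.

Let aux3 (d d1 u : R) : d / 4 * u <= d1 -> d / 16 * u <= d1 / 4.
Proof. by lra. Qed.

(** The last inequality is a budget. A queried coordinate multiplies both sides by at least [g]; a
    round of cutting loses 16 on the right and gains as much through the leaves on the left. As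
    densities are at most 1 and [Theta < g ^+ q], fewer than [q] coordinates are queried, and at a
    leaf the adversary can still refute the output. *)
Lemma lifting (p : protocol Om Om W) X Y Cx Cy Fr F z :
  state adv q gd X Y Cx Cy Fr F z -> (0 < #|X|)%N -> (0 < #|Y|)%N ->
  Fr :|: F = Lc -> dense (2 * r2) Fr (ind R X) -> dense r Fr (ind R Y) ->
  (forall x y, x \in X -> y \in Y -> good (protocol_eval p x y) (output x y)) ->
  g ^+ #|F| * (protocol_leaves p)%:R ^+ 10 <=
    Theta * (density R X Cx * density R Y Cy) -> False.
Proof.
have [n] := ubnP (protocol_leaves p); elim: n => // n IHn in p X Y Cx Cy Fr F z *.
rewrite ltnS => pn st X0 Y0 FrF dX dY hp hD.
have [p1|p2] := leqP (protocol_leaves p) 1.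
  have [ o po] : exists o, forall x y, protocol_eval p x y = o.
    case: p p1 {pn hp hD} => [ o _|c p0 p1 /=|c p0 p1 /=]; first by exists o.
      by rewrite leqNgt (leq_add (protocol_leaves_gt0 p0) (protocol_leaves_gt0 p1)).
    by rewrite leqNgt (leq_add (protocol_leaves_gt0 p0) (protocol_leaves_gt0 p1)).
  have := unsafe_le par dX dY Y0; set U := [set x in X | _] => cU.
  have /subsetPn[x xX xU] : ~~ (X \subset U).
    apply/negP => /subset_leq_card; rewrite -(ler_nat R).
    have : 0 < #|X|%:R :> R by rewrite ltr0n.
    by move: heps cU; nra.
  have sx : safe gd tau r2 Fr Y x.
    by apply: (badness_safe par dY); move: xU; rewrite inE xX negbK.
  have [cx cy _ hz az] := st.
  have Fq : (#|F| < q)%N.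
    have [hT0 hT] := andP hTheta.
    have dd : density R X Cx * density R Y Cy <= 1.
      have b1 := density_le1 par cx; have b2 := density_le1 par cy.
      by rewrite mulr_ile1 ?density_ge0.
    have : g ^+ #|F| < g ^+ q.
      apply: le_lt_trans hT.
      apply: (@le_trans _ _ (Theta * (density R X Cx * density R Y Cy))); last first.
        by rewrite -[leRHS]mulr1 ler_wpM2l // dd.
      apply: le_trans hD; rewrite ler_peMr ?exprn_ge0 // exprn_ege1 //.
      by rewrite ler1n protocol_leaves_gt0.
    by rewrite ltnNge; apply: contraL => qF; rewrite -leNgt ler_weXn2l.
  move: az; rewrite -(subnSK Fq) => az; have [w wz bad] := adv_end o az.
  (* A safe x admits some y that produces the adversary's bits on all free coordinates at once. *)
  have := zset_ge par htau w sx (subxx Fr).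
  have [->|/set0Pn[y]] := eqVneq (zset gd Fr x w Y) set0.
    rewrite cards0; have : 0 < #|Y|%:R :> R by rewrite ltr0n.
    have : 0 < (2 ^+ #|Fr| : R)^-1 by rewrite invr_gt0 exprn_gt0.
    by move=> u v; rewrite leNgt mulr_gt0 // mulr_gt0 // divr_gt0.
  rewrite inE => /andP[yY /forall_inP hy] _.
  apply: (bad (output x y)); last by have := hp _ _ xX yY; rewrite po.
  move=> j; rewrite -FrF inE ffunE => /orP[jFr|jF]; first exact/eqP/hy.
  by rewrite (hz _ _ _ xX yY jF) wz.
set m := protocol_leaves p in pn p2 hD.
have lt34 k : (1 < k)%N -> (0 < 3 * k %/ 4 < k)%N by clear; lia.
have Km := lt34 _ p2.
have le34 i k : (i <= 3 * k %/ 4)%N -> (4 * i <= 3 * k)%N by clear; lia.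
have [a [b [pv [pr [h1 h2 h3 h4]]]]] := protocol_split Km; rewrite -/m in h3.
have D0 : 0 <= density R X Cx * density R Y Cy by rewrite mulr_ge0 ?density_ge0.
(* The rectangle cut out by [protocol_split] costs one bit of each player, hence two turns. *)
have go (X1 : {set Om}) (b' : Om -> bool) (pv' pr' : protocol Om Om W) :
    X1 \subset X -> (#|X| <= 2 * #|X1|)%N ->
    (protocol_leaves pv' <= 3 * m %/ 4)%N -> (protocol_leaves pr' <= 3 * m %/ 4)%N ->
    (forall x y, x \in X1 -> y \in Y -> protocol_eval p x y =
       if b' y then protocol_eval pv' x y else protocol_eval pr' x y) -> False.
  move=> sX1 cX1 lv lr hb.
  have [I1 [X' [Y' [w1 [I1F X'X Y'Y /andP[X'0 Y'0] [st1 dX' dY' hD1]]]]]] :=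
    turn adv_step par htau g0 hg heps st X0 Y0 dX dY sX1 cX1.
  have go2 (Y1 : {set Om}) (p' : protocol Om Om W) :
     Y1 \subset Y' -> (#|Y'| <= 2 * #|Y1|)%N -> (protocol_leaves p' <= 3 * m %/ 4)%N ->
     (forall x y, x \in X' -> y \in Y1 -> protocol_eval p x y = protocol_eval p' x y) ->
     False.
    move=> sY1 cY1 lp' he.
    have [I2 [Y2 [X2 [w2 [I2F Y2Y X2X /andP[Y20 X20] [st2 dY2 dX2 hD2]]]]]] :=
      turn adv_step parf htau g0 hg heps (state_flip st1) Y'0 X'0 dY' dX' sY1 cY1.
    apply: (IHn p' _ _ _ _ _ _ _ _ (state_flip st2)) => //.
    - by apply: leq_trans pn; apply: leq_ltn_trans lp' _; case/andP: Km.
    - rewrite -FrF; apply/setP => j; rewrite !inE.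
      have := subsetP I2F j; have := subsetP I1F j; rewrite !inE.
      case: (j \in I1) => /=; case: (j \in I2) => //=; case: (j \in Fr) => //=;
      rewrite ?orbT ?orbF // => h5 h6; by [have := h5 isT | have := h6 isT].
    - move=> x y xX yY; rewrite -he //; last 1 first.
      + exact: (subsetP Y2Y).
      + by apply: hp; [apply: (subsetP sX1)|]; 
           [apply: (subsetP X'X)|apply: (subsetP Y'Y); apply: (subsetP sY1)];
           rewrite ?(subsetP X2X) ?(subsetP Y2Y).
      + exact: (subsetP X2X).
    - have [_ _ /andP[_ dFrF] _ _] := st.
      have [_ _ /andP[_ dFrF1] _ _] := st1.
      have cF1 : #|F :|: I1| = (#|F| + #|I1|)%N.
        rewrite cardsU setIC (disjoint_setI0 (disjointWl I1F dFrF)).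
        by rewrite cards0 subn0.
      have cF2 : #|F :|: I1 :|: I2| = (#|F| + #|I1| + #|I2|)%N.
        rewrite cardsU setIC (disjoint_setI0 (disjointWl I2F dFrF1)).
        by rewrite cards0 subn0 cF1.
      rewrite cF2 !exprD [density R X2 _ * _]mulrC.
      set D := density R X Cx * density R Y Cy in hD hD1 D0.
      set D1 := density R X' _ * _ in hD1.
      rewrite [density R Y' Cy * _]mulrC -/D1 in hD2.
      set D2 := density R Y2 _ * _ in hD2 *.
      set e0 := g ^+ #|F| in hD *; set e1 := g ^+ #|I1| in hD1 *.
      set e2 := g ^+ #|I2| in hD2 *.
      have e1p : 0 <= e1 by rewrite exprn_ge0.
      have e2p : 0 <= e2 by rewrite exprn_ge0.
      have e0p : 0 <= e0 by rewrite exprn_ge0.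
      have [T0 _] := andP hTheta.
      have lp : (protocol_leaves p')%:R ^+ 10 <= (m%:R : R) ^+ 10 / 16.
        exact: aux2 (le34 _ _ lp').
      have D2ge : D / 16 * e1 * e2 <= D2.
        apply: le_trans hD2; by rewrite ler_wpM2r // aux3.
      apply: (@le_trans _ _ (e0 * e1 * e2 * (m%:R ^+ 10 / 16))).
        by rewrite ler_wpM2l ?mulr_ge0.
      apply: (@le_trans _ _ (Theta * (D / 16 * e1 * e2))); last by rewrite ler_wpM2l.
      have -> : e0 * e1 * e2 * (m%:R ^+ 10 / 16) = e1 * e2 / 16 * (e0 * m%:R ^+ 10).
        by ring.
      have -> : Theta * (D / 16 * e1 * e2) = e1 * e2 / 16 * (Theta * D) by ring.
      by rewrite ler_wpM2l ?divr_ge0 ?mulr_ge0.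
  have sub (P : pred Om) : [set y in Y' | P y] \subset Y'.
    by apply/subsetP => y; rewrite inE => /andP[].
  have inX x : x \in X' -> x \in X1 by apply: (subsetP X'X).
  case: (half_set Y' b') => hY.
    apply: (go2 _ pv' (sub _) hY lv) => x y xX; rewrite inE => /andP[yY by'].
    by rewrite hb ?by' ?inX // (subsetP Y'Y).
  apply: (go2 _ pr' (sub _) hY lr) => x y xX; rewrite inE => /andP[yY /negbTE by'].
  by rewrite hb ?by' ?inX // (subsetP Y'Y).
have sub (P : pred Om) : [set x in X | P x] \subset X.
  by apply/subsetP => x; rewrite inE => /andP[].
have lr : (protocol_leaves pr <= 3 * m %/ 4)%N.
  by move: h1 h2 h3; clear; move: (protocol_leaves pv) (protocol_leaves pr) m => i j k; lia.
case: (half_set X a) => hX.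
  apply: (go _ b pv pr (sub _) hX h1 lr) => x y; rewrite inE => /andP[xX ax] yY.
  by rewrite h4 ax.
apply: (go _ b pr pr (sub _) hX lr lr) => x y; rewrite inE => /andP[xX /negbTE ax] yY.
by rewrite h4 ax; case: (b y).
Qed.

End Lifting.

(** * The potential of a family of rectangles *)

Section Measure.

Variables (R : realFieldType) (C L U V : finType).
Local Notation Om := {ffun C -> L}.
Implicit Types (I Cx Cy : {set C}) (x y a : Om) (X Y : {set Om})
  (A : Om -> {set U}) (B : Om -> {set V}) (w : Om -> Om -> R).

Variables (mu : {set U} -> {set V} -> nat).
Hypothesis mu0l : forall S, mu set0 S = 0%N.
Hypothesis mu0r : forall S, mu S set0 = 0%N.

Definition supp (Z : finType) (A : Om -> {set Z}) := [set x | A x != set0].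

Definition restr (Z : finType) (A : Om -> {set Z}) X x := if x \in X then A x else set0.

Definition le_fam (Z : finType) (A' A : Om -> {set Z}) := forall x, A' x \subset A x.

Definition wsum w A B : R := \sum_x \sum_y (mu (A x) (B y))%:R * w x y.

Definition nsum A B : R := \sum_x \sum_y (mu (A x) (B y))%:R.

Definition marg A B x : R := \sum_y (mu (A x) (B y))%:R.

Lemma marg_ge0 A B x : 0 <= marg A B x.
Proof. by apply: sumr_ge0 => y _; apply: ler0n. Qed.

Lemma nsum_ge0 A B : 0 <= nsum A B.
Proof. by apply: sumr_ge0 => x _; apply: marg_ge0. Qed.

Lemma le_restr (Z : finType) (A : Om -> {set Z}) X : le_fam (restr A X) A.
Proof. by move=> x; rewrite /restr; case: ifP => // _; apply: sub0set. Qed.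

Lemma le_fam_trans (Z : finType) (A1 A2 A3 : Om -> {set Z}) :
  le_fam A1 A2 -> le_fam A2 A3 -> le_fam A1 A3.
Proof. by move=> h1 h2 x; apply: subset_trans (h1 x) (h2 x). Qed.

Lemma supp_sub (Z : finType) (A A' : Om -> {set Z}) : le_fam A' A -> supp A' \subset supp A.
Proof.
move=> h; apply/subsetP => x; rewrite !inE; apply: contra => /eqP e.
by rewrite -subset0 -e.
Qed.

Lemma supp_restr (Z : finType) (A : Om -> {set Z}) X :
  X \subset supp A -> supp (restr A X) = X.
Proof.
move=> /subsetP h; apply/setP => x; rewrite !inE /restr.
by case: ifP => [/h|]; rewrite ?inE // eqxx.
Qed.

Lemma notin_supp (Z : finType) (A : Om -> {set Z}) x : x \notin supp A -> A x = set0.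
Proof. by rewrite inE negbK => /eqP. Qed.

Lemma wsum_ge0 w A B : (forall x y, 0 <= w x y) -> 0 <= wsum w A B.
Proof.
by move=> w0; apply: sumr_ge0 => x _; apply: sumr_ge0 => y _; rewrite mulr_ge0 ?ler0n.
Qed.

Lemma wsum_le_nsum w A B : (forall x y, w x y <= 1) -> wsum w A B <= nsum A B.
Proof.
move=> w1; apply: ler_sum => x _; apply: ler_sum => y _.
by rewrite ler_piMr ?ler0n.
Qed.

Lemma wsum_bound w A B X Y (k : nat) :
  (forall x y, w x y <= 1) ->
  (forall x y, x \in supp A -> x \notin X -> w x y <= 0) ->
  (forall x y, y \in supp B -> y \notin Y -> w x y <= 0) ->
  (forall x y, (mu (A x) (B y) <= k)%N) ->
  wsum w A B <= k%:R * (#|X|%:R * #|Y|%:R).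
Proof.
move=> w1 wX wY hk.
rewrite -!sum_ind_card big_distrlr /= mulr_sumr; apply: ler_sum => x _.
rewrite mulr_sumr; apply: ler_sum => y _; rewrite /ind.
have kk : (mu (A x) (B y))%:R * w x y <= k%:R.
  apply: (@le_trans _ _ (mu (A x) (B y))%:R); last by rewrite ler_nat.
  by rewrite ler_piMr ?ler0n.
have [xX|xX] := boolP (x \in X); have [yY|yY] := boolP (y \in Y);
  rewrite /= ?mulr1 // ?mulr0 ?mul0r ?mulr0.
- have [yB|/notin_supp ->] := boolP (y \in supp B); last by rewrite mu0r mul0r.
  by rewrite mulr_ge0_le0 ?ler0n ?wY.
- have [xA|/notin_supp ->] := boolP (x \in supp A); last by rewrite mu0l mul0r.
  by rewrite mulr_ge0_le0 ?ler0n ?wX.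
- have [xA|/notin_supp ->] := boolP (x \in supp A); last by rewrite mu0l mul0r.
  by rewrite mulr_ge0_le0 ?ler0n ?wX.
Qed.

Lemma marg_restr A B X x : marg (restr A X) B x = ind R X x * marg A B x.
Proof.
rewrite /marg /restr /ind; case: (x \in X); first by rewrite mul1r.
by rewrite mul0r big1 // => y _; rewrite mu0l.
Qed.

Hypothesis mu_subl : forall (S S0 S1 : {set U}) (S' : {set V}),
  S \subset S0 :|: S1 -> (mu S S' <= mu S0 S' + mu S1 S')%N.

Lemma wsum_split w A A0 A1 B : (forall x y, 0 <= w x y) ->
  (forall x, A x \subset A0 x :|: A1 x) -> wsum w A B <= wsum w A0 B + wsum w A1 B.
Proof.
move=> w0 hA; rewrite -big_split /=; apply: ler_sum => x _.
rewrite -big_split /=; apply: ler_sum => y _.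
by rewrite -mulrDl ler_wpM2r // -natrD ler_nat mu_subl.
Qed.

Variables (Rw : finType) (row : C -> Rw) (la : Rw -> pred U) (lb : Rw -> pred V).
Implicit Types Lv : {set Rw}.

Hypothesis mu_kill : forall i (S : {set U}) (S' : {set V}),
  (mu S S' <= mu [set u in S | la i u] S' + mu S [set v in S' | lb i v] + 1)%N.

Definition frees Lv := [set c | row c \in Lv].

(* Rows outside [Lv] are dead: no output in them is correct on the current inputs. *)
Definition live A B Cx Cy Lv :=
  [/\ {in supp A &, forall x x', agree Cx x x'},
      {in supp B &, forall y y', agree Cy y y'},
      [disjoint frees Lv & Cx] && [disjoint frees Lv & Cy] &
      forall i, i \notin Lv -> (forall x u, u \in A x -> la i u) \/
                              (forall y v, v \in B y -> lb i v)].

Lemma live_sub A B A' B' Cx Cy Lv : le_fam A' A -> le_fam B' B ->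
  live A B Cx Cy Lv -> live A' B' Cx Cy Lv.
Proof.
move=> hA hB [cA cB d hd]; split => //.
- by move=> x x' /(subsetP (supp_sub hA)) h1 /(subsetP (supp_sub hA)); apply: cA.
- by move=> x x' /(subsetP (supp_sub hB)) h1 /(subsetP (supp_sub hB)); apply: cB.
- move=> i /hd[h|h]; [left|right] => x u; first by move/(subsetP (hA x)); apply: h.
  by move/(subsetP (hB x)); apply: h.
Qed.

(** Summed over all pairs of the supports, the 1 in [mu_kill] costs at most [c], at most half of the
    sum; so one of the two restrictions keeps a quarter. The factor [4 ^+ #|s|] in the hypothesis
    keeps [c] that small until the last row. *)
Lemma kill_rows (s : {set Rw}) A B (c : R) :
  #|supp A|%:R * #|supp B|%:R <= c -> 2 * c * 4 ^+ #|s| <= nsum A B ->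
  exists A' B', [/\ le_fam A' A, le_fam B' B, nsum A B <= 4 ^+ #|s| * nsum A' B' &
    forall i, i \in s -> (forall x u, u \in A' x -> la i u) \/
                         (forall y v, v \in B' y -> lb i v)].
Proof.
move: {2}#|s| (erefl #|s|) => n; elim: n => [|n IHn] in s A B *.
  move=> /[dup] cs /cards0_eq -> _ hN; exists A, B; split => //.
  - by rewrite cards0 expr0 mul1r.
  - by move=> i; rewrite inE.
move=> cs hc hN; have /set0Pn[i is_] : s != set0 by rewrite -card_gt0 cs.
have cs' : #|s :\ i| = n by move: cs; rewrite (cardsD1 i) is_ => -[].
pose A0 x := [set u in A x | la i u]; pose B1 y := [set v in B y | lb i v].
have A0A : le_fam A0 A by move=> x; apply/subsetP => u; rewrite inE => /andP[].
have B1B : le_fam B1 B by move=> x; apply/subsetP => u; rewrite inE => /andP[].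
have c0 : 0 <= c by apply: le_trans hc; rewrite mulr_ge0 ?ler0n.
have e4 : 1 <= 4 ^+ n :> R by rewrite exprn_ege1 // ler1n.
have hk : nsum A B <= nsum A0 B + nsum A B1 + c.
  apply: le_trans (_ : nsum A0 B + nsum A B1 + #|supp A|%:R * #|supp B|%:R <= _);
    last by rewrite lerD2l.
  rewrite -!sum_ind_card big_distrlr /= -!big_split /=; apply: ler_sum => x _.
  rewrite -!big_split /=; apply: ler_sum => y _; rewrite /ind.
  have [xA|/notin_supp ->] := boolP (x \in supp A); last first.
    by rewrite mu0l !addr_ge0 ?ler0n // mulr_ge0 ?ler0n.
  have [yB|/notin_supp ->] := boolP (y \in supp B); last first.
    by rewrite mu0r !addr_ge0 ?ler0n // mulr_ge0 ?ler0n.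
  by rewrite mul1r -!natrD ler_nat mu_kill.
have recur A' B' : le_fam A' A -> le_fam B' B -> nsum A B <= 4 * nsum A' B' ->
  (forall x u, u \in A' x -> la i u) \/ (forall y v, v \in B' y -> lb i v) ->
  exists A'' B'', [/\ le_fam A'' A, le_fam B'' B,
    nsum A B <= 4 ^+ n.+1 * nsum A'' B'' &
    forall i, i \in s -> (forall x u, u \in A'' x -> la i u) \/
                         (forall y v, v \in B'' y -> lb i v)].
  move=> hA hB hN' hi.
  have hc' : #|supp A'|%:R * #|supp B'|%:R <= c.
    apply: le_trans hc; apply: ler_pM; rewrite ?ler0n // ler_nat subset_leq_card //.
      exact: supp_sub.
    exact: supp_sub.
  have hN2 : 2 * c * 4 ^+ #|s :\ i| <= nsum A' B'.
    by move: hN hN'; rewrite cs cs' exprS; lra.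
  have [A2 [B2 [hA2 hB2 hN3 hs]]] := IHn _ _ _ cs' hc' hN2.
  exists A2, B2; split.
  - exact: le_fam_trans hA2 hA.
  - exact: le_fam_trans hB2 hB.
  - by move: hN' hN3; rewrite cs' exprS; lra.
  - move=> j js; have [->|ji] := eqVneq j i; last by apply: hs; rewrite !inE ji.
    case: hi => h; [left|right] => x u; first by move/(subsetP (hA2 x)); apply: h.
    by move/(subsetP (hB2 x)); apply: h.
rewrite cs; have : 2 * c <= nsum A B.
  by apply: le_trans hN; rewrite ler_peMr ?mulr_ge0 // exprn_ege1 // ler1n.
move=> h2c; have [h0|h1] := lerP (nsum A B) (4 * nsum A0 B).
  by apply: (recur A0 B) => //; left => x u; rewrite inE => /andP[].
apply: (recur A B1) => //; first by lra.
by right => x u; rewrite inE => /andP[].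
Qed.

(** With $k = |I|$, fixing the block keeps more than a share $r_1^k$ of the sum and divides the
    volume by $|L|^k$; at most $k$ rows meet the block, and killing them costs at most $4^k$. Since
    $r_1|L| \ge 16$, the normalized sum grows by $4^k$, which is at least 4. *)
Lemma kill_violation A B Cx Cy Lv (r1 : R) I a :
  (0 < #|L|)%N -> 0 < r1 -> 16 <= r1 * #|L|%:R ->
  live A B Cx Cy Lv -> 2 * (vol R L Cx * vol R L Cy) <= nsum A B ->
  I \subset frees Lv ->
  r1 ^+ #|I| * nsum A B < \sum_(x | agree I x a) marg A B x ->
  exists A' B' Cx' Lv', [/\ (#|Lv'| < #|Lv|)%N, le_fam A' A, le_fam B' B,
    live A' B' Cx' Cy Lv' &
    4 * nsum A B / (vol R L Cx * vol R L Cy) <=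
      nsum A' B' / (vol R L Cx' * vol R L Cy)].
Proof.
move=> L0 r10 r1T lv hN IF hv.
have I0 : I != set0.
  apply: contraL hv => /eqP ->; rewrite -leNgt cards0 expr0 mul1r.
  rewrite /nsum [leLHS]big_mkcond; apply: ler_sum => x _; case: ifP => // _.
  exact: marg_ge0.
have [cA cB /andP[dx dy] hd] := lv.
pose A1 := restr A [set x | agree I x a].
have A1A : le_fam A1 A by apply: le_restr.
have N1 : nsum A1 B = \sum_(x | agree I x a) marg A B x.
  rewrite [RHS]big_mkcond; apply: eq_bigr => x _; rewrite [LHS]marg_restr /ind inE.
  by case: ifP; rewrite ?mul1r ?mul0r.
set s := row @: I.
have sI : (#|s| <= #|I|)%N by apply: leq_imset_card.
have s0 : s != set0 by case/set0Pn: I0 => j jI; apply/set0Pn; exists (row j); apply: imset_f.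
have sLv : s \subset Lv.
  by apply/subsetP => i /imsetP[j /(subsetP IF)]; rewrite inE => jL ->.
have constA1 : {in supp A1 &, forall x x', agree (Cx :|: I) x x'}.
  move=> x x' hx hx'; rewrite agreeU cA ?(subsetP (supp_sub A1A)) //=.
  move: hx hx'; rewrite !inE /A1 /restr !inE.
  case: ifP => [h1|]; rewrite ?eqxx // => _; case: ifP => [h2|]; rewrite ?eqxx // => _.
  by apply: agree_trans h1 _; rewrite agree_sym.
have volc (Z : finType) (F : Om -> {set Z}) Cz :
    {in supp F &, forall x x', agree Cz x x'} -> #|supp F|%:R <= vol R L Cz.
  move=> cF; have [->|/set0Pn[x xF]] := eqVneq (supp F) set0.
    by rewrite cards0 vol_ge0.
  by apply: (@card_agree_vol R C L Cz _ x) => y yF; apply: cF.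
set c := vol R L (Cx :|: I) * vol R L Cy.
have c0 : 0 < c by rewrite mulr_gt0 ?vol_gt0.
have hc : #|supp A1|%:R * #|supp B|%:R <= c.
  by apply: ler_pM; rewrite ?ler0n //; apply: volc.
have dIC : [disjoint Cx & I] by rewrite disjoint_sym; apply: disjointWl IF dx.
have vE : vol R L Cx * vol R L Cy = c * #|L|%:R ^+ #|I|.
  by rewrite (volU R L dIC) /c; ring.
set k := #|I| in hv sI vE.
have Tk : 0 < (#|L|%:R : R) ^+ k by rewrite exprn_gt0 // ltr0n.
have rk : 0 < r1 ^+ k by rewrite exprn_gt0.
have e16 : 16 ^+ k <= r1 ^+ k * #|L|%:R ^+ k.
  rewrite -exprMn; apply: lerXn2r => //; rewrite nnegrE ?ler0n //.
  by rewrite mulr_ge0 ?ler0n // ltW.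
have e44 : (16 : R) ^+ k = 4 ^+ k * 4 ^+ k by rewrite -exprMn; congr (_ ^+ _); ring.
have k0 : (0 < k)%N by rewrite card_gt0.
have e4 : 4 <= 4 ^+ k :> R by rewrite -{1}[4]expr1 ler_weXn2l // ler1n.
have esk : 4 ^+ #|s| <= 4 ^+ k :> R by rewrite ler_weXn2l // ler1n.
rewrite -N1 in hv; rewrite vE in hN.
have N1ge : 2 * c * 16 ^+ k <= nsum A1 B.
  apply: (@le_trans _ _ (r1 ^+ k * nsum A B)); last exact: ltW.
  apply: (@le_trans _ _ (r1 ^+ k * (2 * (c * #|L|%:R ^+ k)))); last by rewrite ler_wpM2l // ltW.
  have -> : r1 ^+ k * (2 * (c * #|L|%:R ^+ k)) = 2 * c * (r1 ^+ k * #|L|%:R ^+ k) by ring.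
  by rewrite ler_wpM2l // mulr_ge0 // ltW.
have hN1 : 2 * c * 4 ^+ #|s| <= nsum A1 B.
  apply: le_trans N1ge; apply: ler_wpM2l; first by rewrite mulr_ge0 // ltW.
  by apply: le_trans esk _; rewrite e44 ler_peMr ?exprn_ge0 // exprn_ege1 // ler1n.
have [A' [B' [hA' hB' hN' hs]]] := kill_rows hc hN1.
exists A', B', (Cx :|: I), (Lv :\: s); split.
- have /proper_card : Lv :\: s \proper Lv.
    rewrite properEneq subsetDl andbT; apply: contra s0 => /eqP e.
    rewrite -subset0; apply/subsetP => i is_.
    by have := subsetP sLv _ is_; rewrite -e inE is_.
  by [].
- exact: le_fam_trans hA' A1A.
- exact: hB'.
- have [cA1' cB' _ _] := live_sub (le_fam_trans hA' A1A) hB' lv.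
  have sA' : supp A' \subset supp A1 by apply: supp_sub.
  have hd' : forall i, i \notin Lv :\: s ->
     (forall x u, u \in A' x -> la i u) \/ (forall y v, v \in B' y -> lb i v).
    move=> i; rewrite inE negb_and negbK => /orP[/hs //|/hd[h|h]]; [left|right] => x u.
      by move/(subsetP (le_fam_trans hA' A1A x)); apply: h.
    by move/(subsetP (hB' x)); apply: h.
  have fs : frees (Lv :\: s) \subset frees Lv.
    by apply/subsetP => j; rewrite !inE => /andP[].
  split => //.
    by move=> x x' hx hx'; apply: constA1; apply: (subsetP sA').
  rewrite (disjointWl fs dy) andbT -setI_eq0 -subset0; apply/subsetP => j.
  rewrite inE [j \in _ :|: _]inE => /andP[jf /orP[jC|jI]].
    by move: (disjointFr dx (subsetP fs _ jf)); rewrite jC.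
  by move: jf; rewrite !inE => /andP[/negP[]]; apply: imset_f.
rewrite vE -/c.
have -> : 4 * nsum A B / (c * #|L|%:R ^+ k) = (4 * nsum A B / #|L|%:R ^+ k) / c.
  by field; rewrite !gt_eqF.
rewrite ler_wpM2r ?invr_ge0 ?(ltW c0) // ler_pdivrMr //.
have : 4 ^+ #|s| * nsum A' B' <= 4 ^+ k * nsum A' B' by rewrite ler_wpM2r ?nsum_ge0.
have N0 := nsum_ge0 A B; have N0' := nsum_ge0 A' B'.
move=> h1; have h2 : r1 ^+ k * nsum A B <= 4 ^+ k * nsum A' B' by lra.
have h3 : r1 ^+ k * #|L|%:R ^+ k * nsum A B <= 4 ^+ k * (nsum A' B' * #|L|%:R ^+ k).
  rewrite mulrAC [leRHS]mulrA ler_wpM2r //; exact: ltW.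
have h4 : 4 ^+ k * 4 ^+ k * nsum A B <= r1 ^+ k * #|L|%:R ^+ k * nsum A B.
  by rewrite ler_wpM2r // -e44.
have h5 : 4 ^+ k * (4 * nsum A B) <= 4 ^+ k * (nsum A' B' * #|L|%:R ^+ k).
  apply: le_trans (le_trans h4 h3); rewrite -mulrA ler_wpM2l ?exprn_ge0 //.
  by rewrite ler_wpM2r.
by rewrite -(ler_pM2l (lt_le_trans _ e4)).
Qed.

End Measure.

Lemma bernoulli (R : realFieldType) (u : R) G : 0 <= u <= 1 ->
  1 - G%:R * u <= (1 - u) ^+ G.
Proof.
case/andP=> u0 u1; elim: G => [|G IHG]; first by rewrite mul0r subr0 expr0.
rewrite exprS; apply: (@le_trans _ _ ((1 - u) * (1 - G%:R * u))).
  have : 0 <= G%:R * u * u by rewrite !mulr_ge0 ?ler0n.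
  by rewrite -natr1; lra.
by rewrite ler_wpM2l // subr_ge0.
Qed.

Section Swap.

Variables (R : realFieldType) (C L U V : finType).
Local Notation Om := {ffun C -> L}.

Definition swap (mu : {set U} -> {set V} -> nat) S' S := mu S S'.

Lemma wsum_swap mu (w : Om -> Om -> R) A B :
  wsum (swap mu) (fun y x => w x y) B A = wsum mu w A B.
Proof. by rewrite /wsum exchange_big. Qed.

Lemma nsum_swap mu (A : Om -> {set U}) (B : Om -> {set V}) :
  nsum R (swap mu) B A = nsum R mu A B.
Proof. by rewrite /nsum exchange_big. Qed.

End Swap.

(** * Density of maximizing supports *)

Section Slice.

Variables (R : realFieldType) (C L U V : finType).
Local Notation Om := {ffun C -> L}.
Implicit Types (I Fr : {set C}) (x y a : Om) (X Y : {set Om})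
  (A : Om -> {set U}) (B : Om -> {set V}) (w : Om -> Om -> R).

Variables (mu : {set U} -> {set V} -> nat).
Hypothesis mu0l : forall S, mu set0 S = 0%N.

Variables (r r1 : R) (G : nat).
Hypotheses (r10 : 0 < r1) (G0 : (0 < G)%N) (rG : 2 * G%:R * r1 <= r) (rlt1 : r < 1).

(* Removing a too heavy block [agree I x a] from the support would lose a smaller
   fraction of the weight than of the support, against maximality. *)
Lemma slice_dense w A B Fr :
  (forall x y, 0 <= w x y <= 1) ->
  0 < wsum mu w A B -> nsum R mu A B <= 2 * wsum mu w A B ->
  dense r1 Fr (marg R mu A B) ->
  (forall X, X \subset supp A -> X != set0 ->
     wsum mu w (restr A X) B ^+ G * #|supp A|%:R <= wsum mu w A B ^+ G * #|X|%:R) ->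
  dense r Fr (ind R (supp A)).
Proof.
move=> w01 psi0 hN dm mx I a IF; rewrite sum_ind_card sum_ind.
have [->|I0] := eqVneq I set0.
  rewrite cards0 expr0 mul1r ler_nat; apply: subset_leq_card.
  by apply/subsetP => x; rewrite !inE => /andP[].
have k0 : (0 < #|I|)%N by rewrite card_gt0.
set k := #|I| in k0 *; set psi := wsum mu w A B in psi0 hN mx.
set XI := [set x in supp A | agree I x a].
pose wm x := \sum_y (mu (A x) (B y))%:R * w x y.
have wm0 x : 0 <= wm x.
  apply: sumr_ge0 => y _; rewrite mulr_ge0 ?ler0n //.
  by case/andP: (w01 x y).
have wmm x : wm x <= marg R mu A B x.
  apply: ler_sum => y _; rewrite ler_piMr ?ler0n //.
  by case/andP: (w01 x y).
set pI := \sum_(x | agree I x a) wm x.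
have r1n : r1 <= 1.
  have : 1 <= G%:R :> R by rewrite ler1n.
  move: rG rlt1 r10; nra.
have hpI : pI <= 2 * r1 ^+ k * psi.
  apply: (@le_trans _ _ (\sum_(x | agree I x a) marg R mu A B x)).
    by apply: ler_sum.
  apply: le_trans (dm I a IF) _; rewrite [2 * _]mulrC -mulrA.
  by rewrite ler_wpM2l // exprn_ge0 // ltW.
pose X := supp A :\: XI.
have psiX : wsum mu w (restr A X) B = psi - pI.
  have -> : psi - pI = \sum_(x | ~~ agree I x a) wm x.
    by rewrite /psi /wsum (bigID (fun x => agree I x a)) /= addrAC subrr add0r.
  rewrite [RHS]big_mkcond; apply: eq_bigr => x _.
  have [xA|/notin_supp e] := boolP (x \in supp A); last first.
    rewrite /restr e if_same /wm e big1 => [|y _]; last by rewrite mu0l mul0r.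
    by rewrite if_same.
  rewrite /restr /X /XI !inE; move: xA; rewrite inE => ->; rewrite andbT.
  by case: (agree I x a) => //=; rewrite big1 // => y _; rewrite mu0l mul0r.
have rk1 : r1 ^+ k <= r1 by rewrite -[leRHS]expr1 ler_wiXn2l // ltW.
have Gr1 : 2 * r1 < 1.
  have : 1 <= G%:R :> R by rewrite ler1n.
  move: rG rlt1 r10; nra.
have rk0 : 0 < r1 ^+ k by rewrite exprn_gt0.
have X0 : X != set0.
  apply/eqP => e; move: psiX; rewrite e => /esym.
  have -> : wsum mu w (restr A set0) B = 0.
    by rewrite /wsum big1 // => x _; rewrite big1 // => y _; rewrite /restr inE mu0l mul0r.
  move=> e2; move: hpI psi0 rk1 Gr1; nra.
have sX : X \subset supp A by apply: subsetDl.
have := mx X sX X0; rewrite psiX => hmx.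
rewrite leNgt; apply/negP => hI.
have S0 : 0 < #|supp A|%:R :> R.
  by rewrite ltr0n; apply: leq_trans (subset_leq_card sX); rewrite card_gt0.
have cX : #|X|%:R = #|supp A|%:R - #|XI|%:R :> R.
  rewrite cardsD (setIidPr _) ?natrB //.
    by apply: subset_leq_card; apply/subsetP => x; rewrite inE => /andP[].
  by apply/subsetP => x; rewrite inE => /andP[].
have u01 : 0 <= 2 * r1 ^+ k <= 1 by rewrite mulr_ge0 ?(ltW rk0) //; move: rk1 Gr1; lra.
have hG : (psi * (1 - 2 * r1 ^+ k)) ^+ G <= (psi - pI) ^+ G.
  have u1 : 0 <= 1 - 2 * r1 ^+ k by rewrite subr_ge0; case/andP: u01.
  have p1 : psi * (1 - 2 * r1 ^+ k) <= psi - pI by move: hpI; lra.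
  by apply: lerXn2r; rewrite ?nnegrE ?(le_trans _ p1) ?mulr_ge0 // ltW.
have psiG : 0 < psi ^+ G by rewrite exprn_gt0.
have h1 : (1 - 2 * r1 ^+ k) ^+ G * #|supp A|%:R <= #|X|%:R.
  rewrite -(ler_pM2l psiG); apply: le_trans hmx; rewrite mulrA -exprMn.
  by rewrite ler_wpM2r // ltW.
have h2 : (1 - G%:R * (2 * r1 ^+ k)) * #|supp A|%:R <= #|X|%:R.
  by apply: le_trans h1; rewrite ler_wpM2r ?bernoulli // ltW.
have h3 : r ^+ k <= 2 * G%:R * r1 ^+ k.
  have h4 : r ^+ k * #|supp A|%:R <= 2 * G%:R * r1 ^+ k * #|supp A|%:R.
    by move: h2 hI; rewrite cX; lra.
  by rewrite -(ler_pM2r S0).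
have h5 : (2 * G%:R * r1) ^+ k <= r ^+ k.
  apply: lerXn2r => //; rewrite nnegrE ?mulr_ge0 ?ler0n ?(ltW r10) //.
  by apply: le_trans rG; rewrite !mulr_ge0 ?ler0n ?(ltW r10).
have h6 : 2 * G%:R * r1 ^+ k <= (2 * G%:R * r1) ^+ k.
  rewrite exprMn ler_wpM2r ?(ltW rk0) // -[leLHS]expr1 ler_weXn2l //.
  have : 1 <= G%:R :> R by rewrite ler1n.
  lra.
have h7 : 2 * G%:R * r1 ^+ k * #|supp A|%:R <= r ^+ k * #|supp A|%:R.
  by rewrite ler_wpM2r ?ler0n // (le_trans h6).
by move: h2 hI h7; rewrite cX; lra.
Qed.

End Slice.

(** * The weight of a pair of gadget inputs *)

Section Weights.

Variables (R : realFieldType) (C L U V : finType) (gd : L -> L -> bool).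
Local Notation Om := {ffun C -> L}.
Implicit Types (I Fr : {set C}) (x y a : Om) (X Y : {set Om})
  (A : Om -> {set U}) (B : Om -> {set V}) (w : Om -> Om -> R).

Variables (h tau r r2 sigma eps : R).
Hypothesis par : params C gd h tau r r2 sigma eps.
Hypothesis parf : params C (flip gd) h tau r r2 sigma eps.

Local Notation badx Fr := (badness gd tau r r2 Fr).
Local Notation bady Fr := (badness (flip gd) tau r r2 Fr).

(** It vanishes as soon as one badness reaches 1, so only safe inputs count; above 0 it is linear in
    the two badnesses and inherits their mean and continuity estimates. *)
Definition weight Fr X Y x y : R :=
  Num.max 0 (1 - badx Fr Y x - bady Fr X y).

Lemma weight01 Fr X Y x y : 0 <= weight Fr X Y x y <= 1.
Proof.
rewrite /weight le_max lexx /= ge_max ler01 /=.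
have := badness_ge0 gd tau r r2 Fr Y x; have := badness_ge0 (flip gd) tau r r2 Fr X y; lra.
Qed.

Lemma weight_badx Fr X Y x y : 1 <= badx Fr Y x -> weight Fr X Y x y <= 0.
Proof. by rewrite /weight ge_max lexx /=; have := badness_ge0 (flip gd) tau r r2 Fr X y; lra. Qed.

Lemma weight_bady Fr X Y x y : 1 <= bady Fr X y -> weight Fr X Y x y <= 0.
Proof. by rewrite /weight ge_max lexx /=; have := badness_ge0 gd tau r r2 Fr Y x; lra. Qed.

Variables (mu : {set U} -> {set V} -> nat).

Section Mean.

Variables (A : Om -> {set U}) (B : Om -> {set V}) (Fr : {set C}).
Hypothesis dA : dense (2 * r2) Fr (marg R mu A B).
Hypothesis dB : dense (2 * r2) Fr (marg R (swap mu) B A).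

Let m x y : R := (mu (A x) (B y))%:R.
Let m0 x y : 0 <= m x y. Proof. exact: ler0n. Qed.

Let marg_sum (f : Om -> R) :
  \sum_x \sum_y m x y * f x = \sum_x marg R mu A B x * f x.
Proof. by apply: eq_bigr => x _; rewrite mulr_suml. Qed.

Let marg_sumr (f : Om -> R) :
  \sum_x \sum_y m x y * f y = \sum_y marg R (swap mu) B A y * f y.
Proof. by rewrite exchange_big; apply: eq_bigr => x _; rewrite mulr_suml. Qed.

Let sum_marg : \sum_x marg R mu A B x = nsum R mu A B.
Proof. by []. Qed.

Let sum_margr : \sum_x marg R (swap mu) B A x = nsum R mu A B.
Proof. by rewrite -nsum_swap. Qed.

Lemma weight_mean X Y : dense r Fr (ind R X) -> dense r Fr (ind R Y) ->
  (0 < #|X|)%N -> (0 < #|Y|)%N ->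
  (1 - 2 * eps) * nsum R mu A B <= wsum mu (weight Fr X Y) A B.
Proof.
move=> dX dY X0 Y0.
have h1 := badness_mean par (marg_ge0 R mu A B) dA dY Y0.
have h2 := badness_mean parf (marg_ge0 R (swap mu) B A) dB dX X0.
rewrite sum_marg -marg_sum in h1; rewrite sum_margr -marg_sumr in h2.
apply: (@le_trans _ _ (\sum_x \sum_y m x y * (1 - badx Fr Y x - bady Fr X y))); last first.
  apply: ler_sum => x _; apply: ler_sum => y _; rewrite ler_wpM2l //.
  by rewrite /weight le_max lexx orbT.
have -> : \sum_x \sum_y m x y * (1 - badx Fr Y x - bady Fr X y) =
   nsum R mu A B - \sum_x \sum_y m x y * badx Fr Y x - \sum_x \sum_y m x y * bady Fr X y.
  rewrite -!sumrB; apply: eq_bigr => x _; rewrite -!sumrB; apply: eq_bigr => y _.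
  by rewrite /m; ring.
lra.
Qed.

(** The maximum with 0 is 1-Lipschitz. Only the supports that define the weight change here; [A] and
    [B] are the same on both sides. *)
Lemma weight_cont X Y X' Y' :
  dense r Fr (ind R X) -> dense r Fr (ind R Y) ->
  dense r Fr (ind R X') -> dense r Fr (ind R Y') ->
  X' \subset X -> Y' \subset Y -> (0 < #|X'|)%N -> (0 < #|Y'|)%N ->
  wsum mu (weight Fr X Y) A B <= wsum mu (weight Fr X' Y') A B +
    4 * eps * ((1 - #|X'|%:R / #|X|%:R) + (1 - #|Y'|%:R / #|Y|%:R)) * nsum R mu A B.
Proof.
move=> dX dY dX' dY' sX sY X0 Y0.
have h1 := badness_cont par (marg_ge0 R mu A B) dA dY dY' sY Y0.
have h2 := badness_cont parf (marg_ge0 R (swap mu) B A) dB dX dX' sX X0.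
rewrite sum_marg -marg_sum in h1; rewrite sum_margr -marg_sumr in h2.
apply: (@le_trans _ _ (wsum mu (weight Fr X' Y') A B +
  (\sum_x \sum_y m x y * `|badx Fr Y x - badx Fr Y' x| +
   \sum_x \sum_y m x y * `|bady Fr X y - bady Fr X' y|))); last first.
  by rewrite lerD2l; apply: le_trans (lerD h1 h2) _; rewrite le_eqVlt;
    apply/orP; left; apply/eqP; ring.
rewrite -!big_split /=; apply: ler_sum => x _; rewrite -!big_split /=.
apply: ler_sum => y _; rewrite -!mulrDr ler_wpM2l //.
set p := badx Fr Y x; set p' := badx Fr Y' x; set s := bady Fr X y; set s' := bady Fr X' y.
have e1 : p' - p <= `|p - p'| by rewrite distrC ler_norm.
have e2 : s' - s <= `|s - s'| by rewrite distrC ler_norm.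
rewrite /weight -/p -/p' -/s -/s' ge_max; apply/andP; split.
  by rewrite !addr_ge0 // le_max lexx.
apply: (@le_trans _ _ (1 - p' - s' + (`|p - p'| + `|s - s'|))); first by lra.
by rewrite lerD2r le_max lexx orbT.
Qed.

End Mean.

End Weights.

Lemma dense_dec (R : realFieldType) (C L : finType) (r : R) (Fr : {set C})
    (nu : {ffun C -> L} -> R) :
  dense r Fr nu \/ exists (I : {set C}) a, I \subset Fr /\
    r ^+ #|I| * \sum_x nu x < \sum_(x | agree I x a) nu x.
Proof.
pose P (Ia : {set C} * {ffun C -> L}) := (Ia.1 \subset Fr) &&
  (r ^+ #|Ia.1| * \sum_x nu x < \sum_(x | agree Ia.1 x Ia.2) nu x).
have [/existsP[[I a] /andP[IF h]]|/existsPn h] := boolP [exists Ia, P Ia].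
  by right; exists I, a.
left=> I a IF; have := h (I, a); rewrite /P /= IF /= -leNgt; exact.
Qed.

Section Cleanup.

Variables (R : realFieldType) (C L U V : finType).
Local Notation Om := {ffun C -> L}.
Implicit Types (I Fr : {set C}) (x y a : Om) (X Y : {set Om})
  (A : Om -> {set U}) (B : Om -> {set V}) (w : Om -> Om -> R).

Variables (mu : {set U} -> {set V} -> nat).
Hypothesis mu0l : forall S, mu set0 S = 0%N.
Hypothesis mu0r : forall S, mu S set0 = 0%N.

Lemma wsum_supp w A B : 0 < wsum mu w A B -> supp A != set0 /\ supp B != set0.
Proof.
move=> h; split; apply: contraTneq h => e; rewrite /wsum big1 ?ltxx // => x _;
  rewrite big1 // => y _.
  by rewrite (notin_supp (_ : x \notin supp A)) ?mu0l ?mul0r // e inE.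
by rewrite (notin_supp (_ : y \notin supp B)) ?mu0r ?mul0r // e inE.
Qed.

Lemma eq_wsum w A A' B B' : A =1 A' -> B =1 B' -> wsum mu w A B = wsum mu w A' B'.
Proof. by move=> eA eB; apply: eq_bigr => x _; apply: eq_bigr => y _; rewrite eA eB. Qed.

Lemma restr_supp (Z : finType) (A : Om -> {set Z}) : restr A (supp A) =1 A.
Proof. by move=> x; rewrite /restr; case: ifPn => // /notin_supp. Qed.

Lemma restr_restr (Z : finType) (A : Om -> {set Z}) X X' :
  X' \subset X -> restr (restr A X) X' =1 restr A X'.
Proof. by move=> /subsetP s x; rewrite /restr; case: ifP => // /s ->. Qed.

Variables (r r1 : R) (G : nat).
Hypotheses (r10 : 0 < r1) (G0 : (0 < G)%N) (rG : 2 * G%:R * r1 <= r) (rlt1 : r < 1).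

(** The weight is kept fixed while the supports vary. Maximality of $\psi^G/(|X||Y|)$ in X alone and
    in Y alone is what [slice_dense] asks for, provided that the marginals are dense; if they are
    not, a heavy block is returned instead. *)
Lemma cleanup w A B Fr :
  (forall x y, 0 <= w x y <= 1) -> 0 < wsum mu w A B ->
  (forall A' B', le_fam A' A -> le_fam B' B ->
     dense r1 Fr (marg R mu A' B') -> dense r1 Fr (marg R (swap mu) B' A') ->
     nsum R mu A' B' <= 2 * wsum mu w A' B') ->
  exists A' B', [/\ le_fam A' A, le_fam B' B, 0 < wsum mu w A' B',
    wsum mu w A B ^+ G * (#|supp A'|%:R * #|supp B'|%:R) <=
    wsum mu w A' B' ^+ G * (#|supp A|%:R * #|supp B|%:R) &
    [\/ exists (I : {set C}) a, I \subset Fr /\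
          r1 ^+ #|I| * nsum R mu A' B' < \sum_(x | agree I x a) marg R mu A' B' x,
        exists (I : {set C}) a, I \subset Fr /\
          r1 ^+ #|I| * nsum R (swap mu) B' A' <
          \sum_(x | agree I x a) marg R (swap mu) B' A' x |
        [/\ dense r1 Fr (marg R mu A' B'), dense r1 Fr (marg R (swap mu) B' A'),
            dense r Fr (ind R (supp A')) & dense r Fr (ind R (supp B'))]]].
Proof.
move=> w01 psi0 H; have [A0 B0] := wsum_supp psi0.
pose P (Z : {set Om} * {set Om}) :=
  [&& Z.1 \subset supp A, Z.2 \subset supp B, Z.1 != set0 & Z.2 != set0].
pose psi (Z : {set Om} * {set Om}) := wsum mu w (restr A Z.1) (restr B Z.2).
pose F Z := psi Z ^+ G / (#|Z.1|%:R * #|Z.2|%:R).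
have P0 : P (supp A, supp B) by rewrite /P /= !subxx A0 B0.
have psiE : psi (supp A, supp B) = wsum mu w A B.
  by apply: eq_wsum => x; apply: restr_supp.
have card0 (X : {set Om}) : X != set0 -> 0 < #|X|%:R :> R.
  by move=> X0; rewrite ltr0n card_gt0.
case: (Order.TotalTheory.arg_maxP F P0) => -[X Y] /and4P[/= sX sY X0 Y0] mx.
have w0 x y : 0 <= w x y by case/andP: (w01 x y).
have XYp : 0 < #|X|%:R * #|Y|%:R :> R by rewrite mulr_gt0 ?card0.
have ABp : 0 < #|supp A|%:R * #|supp B|%:R :> R by rewrite mulr_gt0 ?card0.
have mx0 := mx _ P0; rewrite /F psiE /= in mx0.
have p0 : 0 < psi (X, Y).
  rewrite lt_neqAle wsum_ge0 // andbT; apply: contraTneq mx0 => <-.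
  by rewrite expr0n gtn_eqF // mul0r -ltNge divr_gt0 // exprn_gt0.
set A' := restr A X; set B' := restr B Y.
have sA' : supp A' = X by apply: supp_restr.
have sB' : supp B' = Y by apply: supp_restr.
exists A', B'; split=> //; try exact: le_restr.
  by move: mx0; rewrite sA' sB' ler_pdivrMr // mulrAC ler_pdivlMr.
have [dA|h] := dense_dec r1 Fr (marg R mu A' B'); last exact: Or31.
have [dB|h] := dense_dec r1 Fr (marg R (swap mu) B' A'); last exact: Or32.
have hN : nsum R mu A' B' <= 2 * wsum mu w A' B' by apply: H => //; apply: le_restr.
apply: Or33; split => //.
- apply: (slice_dense mu0l r10 G0 rG rlt1 w01 p0 hN dA) => X1 sX1 X10.
  rewrite sA' in sX1 *.
  have P1 : P (X1, Y) by rewrite /P /= (subset_trans sX1) // sY X10.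
  have := mx _ P1; rewrite /F /=.
  have -> : psi (X1, Y) = wsum mu w (restr A' X1) B'.
    by apply: eq_wsum => // x; rewrite restr_restr.
  rewrite ler_pdivrMr ?mulr_gt0 ?card0 // mulrAC ler_pdivlMr //.
  by rewrite -/A' -/B' !mulrA ler_pM2r ?card0.
- have wS : wsum (swap mu) (fun y x => w x y) B' A' = wsum mu w A' B' by apply: wsum_swap.
  have p0' : 0 < wsum (swap mu) (fun y x => w x y) B' A' by rewrite wS.
  have hN' : nsum R (swap mu) B' A' <= 2 * wsum (swap mu) (fun y x => w x y) B' A'.
    by rewrite wS nsum_swap.
  apply: (slice_dense (mu := swap mu) mu0r r10 G0 rG rlt1 _ p0' hN' dB) => [x y|Y1 sY1 Y10].
    exact: w01.
  rewrite wsum_swap wS; rewrite sB' in sY1 *.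
  have P1 : P (X, Y1) by rewrite /P /= (subset_trans sY1) // sX X0.
  have := mx _ P1; rewrite /F /=.
  have -> : psi (X, Y1) = wsum mu w A' (restr B' Y1).
    by apply: eq_wsum => // x; rewrite restr_restr.
  rewrite ler_pdivrMr ?mulr_gt0 ?card0 // mulrAC ler_pdivlMr //.
  by rewrite -/A' -/B' ![#|X|%:R * _]mulrC !mulrA ler_pM2r ?card0.
Qed.

End Cleanup.

(** From $D \ge \psi/l$ one gets, with $u = \rho l$, that $u^K u^2 \le \psi^K l^2$. If $2\psi < u$,
    then $2^K\rho^2 < 1$ follows, against the hypothesis. *)
Lemma potential_lb (R : realFieldType) (K : nat) (rho l psi D : R) :
  0 < rho -> 0 < l -> 0 <= psi -> 0 < D -> psi <= l * D ->
  (rho * l) ^+ K.+2 * D ^+ 2 <= psi ^+ K.+2 ->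
  (0 < K)%N -> 1 <= rho ^+ 2 * 2 ^+ K -> rho * l <= 2 * psi.
Proof.
move=> rho0 l0 psi0 D0 hD hpsi K0 hK; rewrite leNgt; apply/negP => lt.
set u := rho * l in hpsi lt.
have u0 : 0 < u by rewrite mulr_gt0.
have psip : 0 < psi.
  rewrite lt_neqAle psi0 andbT; apply: contraTneq hpsi => <-.
  by rewrite expr0n /= -ltNge mulr_gt0 ?exprn_gt0.
have h1 : (2 * psi) ^+ K < u ^+ K.
  by rewrite ltrXn2r ?nnegrE ?gtn_eqF ?lt ?(ltW u0) ?mulr_ge0.
have h2 : u ^+ K.+2 * psi ^+ 2 <= psi ^+ K.+2 * l ^+ 2.
  apply: (@le_trans _ _ (u ^+ K.+2 * (l * D) ^+ 2)).
    rewrite ler_wpM2l ?exprn_ge0 ?(ltW u0) // ler_sqr ?nnegrE //.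
    by rewrite mulr_ge0 // ltW.
  by rewrite (exprMn _ l D) mulrCA mulrC ler_wpM2r ?sqr_ge0.
have {}h2 : u ^+ K * u ^+ 2 <= psi ^+ K * l ^+ 2.
  have p2 : 0 < psi ^+ 2 by rewrite exprn_gt0.
  rewrite -(ler_pM2r p2) -!exprD addn2; apply: le_trans h2 _.
  by rewrite -[K.+2]addn2 exprD mulrAC.
have h3 : (2 * psi) ^+ K * u ^+ 2 < psi ^+ K * l ^+ 2.
  by apply: lt_le_trans h2; rewrite ltr_pM2r ?exprn_gt0.
have pl : 0 < psi ^+ K * l ^+ 2 by rewrite mulr_gt0 ?exprn_gt0.
have : (2 * psi) ^+ K * u ^+ 2 = psi ^+ K * l ^+ 2 * (rho ^+ 2 * 2 ^+ K).
  by rewrite /u !exprMn; ring.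
move=> e; rewrite e in h3; move: h3; rewrite ltNge => /negP; apply.
by rewrite ler_peMr // ltW.
Qed.

(** * The descent in a protocol for the composed problem *)

Section ProtocolMap.

Variables (X Y X' Y' O O' : Type).

Fixpoint protocol_map (f : X' -> X) (g : Y' -> Y) (k : O -> O') (p : protocol X Y O) :
    protocol X' Y' O' :=
  match p with
  | PLeaf o => PLeaf _ _ (k o)
  | PAlice a p0 p1 => PAlice (fun x => a (f x)) (protocol_map f g k p0) (protocol_map f g k p1)
  | PBob b p0 p1 => PBob (fun y => b (g y)) (protocol_map f g k p0) (protocol_map f g k p1)
  end.

Lemma leaves_protocol_map f g k p :
  protocol_leaves (protocol_map f g k p) = protocol_leaves p.
Proof. by elim: p => //= _ p0 -> p1 ->. Qed.

Lemma eval_protocol_map f g k p x y :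
  protocol_eval (protocol_map f g k p) x y = k (protocol_eval p (f x) (g y)).
Proof. by elim: p => //= a p0 -> p1 ->; case: ifP. Qed.

Fixpoint protocol_flip (p : protocol X Y O) : protocol Y X O :=
  match p with
  | PLeaf o => PLeaf _ _ o
  | PAlice a p0 p1 => PBob a (protocol_flip p0) (protocol_flip p1)
  | PBob b p0 p1 => PAlice b (protocol_flip p0) (protocol_flip p1)
  end.

Lemma leaves_protocol_flip p : protocol_leaves (protocol_flip p) = protocol_leaves p.
Proof. by elim: p => //= _ p0 -> p1 ->. Qed.

Lemma eval_protocol_flip p x y : protocol_eval (protocol_flip p) y x = protocol_eval p x y.
Proof. by elim: p => //= a p0 -> p1 ->. Qed.

End ProtocolMap.

Lemma live_swap (C L U V Rw : finType) (row : C -> Rw) (la : Rw -> pred U) (lb : Rw -> pred V)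
    (A : {ffun C -> L} -> {set U}) (B : {ffun C -> L} -> {set V}) Cx Cy Lv :
  live row la lb A B Cx Cy Lv -> live row lb la B A Cy Cx Lv.
Proof. by case=> cA cB; rewrite andbC => d h; split => // i /h[]; [right|left]. Qed.

Lemma ler_normalize (R : realFieldType) (G : nat) (a b e e' v : R) : 0 < v ->
  a ^+ G * e' <= b ^+ G * e -> (a / v) ^+ G * (e' / v) <= (b / v) ^+ G * (e / v).
Proof.
move=> v0 h; rewrite !expr_div_n !mulf_div ler_wpM2r // invr_ge0.
by rewrite mulr_ge0 ?exprn_ge0 // ltW.
Qed.

(** By Bernoulli's inequality the power [G] of the potential loses at most a fraction
    $8G\varepsilon\theta \le \theta/2$, where $\theta$ is the sum of the two lost fractions, and the
    new density satisfies $D' \le D(1-\theta/2)$. So replacing the remaining factor $D$ by $D'$ pays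
    for the new weight. *)
Lemma shrink_potential (R : realFieldType) (G : nat) (a psi psi' D D' tX tY eps : R) :
  0 <= a -> 0 <= psi -> 0 <= D -> 0 <= tX <= 1 -> 0 <= tY <= 1 -> 0 <= eps ->
  (0 < G)%N -> 16 * G%:R * eps <= 1 -> D' = D * (tX * tY) ->
  a * (D * D') <= psi ^+ G ->
  psi * (1 - 8 * eps * ((1 - tX) + (1 - tY))) <= psi' -> a * D' ^+ 2 <= psi' ^+ G.
Proof.
move=> a0 p0 D0 /andP[x0 x1] /andP[y0 y1] e0 G0 hG eD ha hp.
set th := (1 - tX) + (1 - tY) in hp; set u := 8 * eps * th in hp.
have th0 : 0 <= th by rewrite addr_ge0 ?subr_ge0.
have xy : tX * tY <= 1 - th / 2.
  have : 0 <= (1 - tX) * tY + tX * (1 - tY) by rewrite addr_ge0 ?mulr_ge0 ?subr_ge0.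
  by rewrite /th; lra.
have xy0 : 0 <= tX * tY by rewrite mulr_ge0.
have u0 : 0 <= u by rewrite !mulr_ge0.
have Gu : G%:R * u <= th / 2.
  have -> : G%:R * u = 16 * G%:R * eps * (th / 2) by rewrite /u; field.
  by rewrite ler_piMl // divr_ge0.
have G1 : 1 <= G%:R :> R by rewrite ler1n.
have u1 : u <= 1.
  have : u <= G%:R * u by rewrite ler_peMl.
  by rewrite /th in Gu *; lra.
have pu : 0 <= psi * (1 - u) by rewrite mulr_ge0 // subr_ge0.
apply: (@le_trans _ _ ((psi * (1 - u)) ^+ G)); last first.
  by apply: lerXn2r; rewrite ?nnegrE // (le_trans pu).
have D'0 : 0 <= D' by rewrite eD mulr_ge0.
have -> : a * D' ^+ 2 = a * (D * D') * (tX * tY) by rewrite {1}expr2 {1}eD; ring.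
rewrite exprMn; apply: ler_pM => //; first by rewrite !mulr_ge0.
apply: le_trans (bernoulli G _); last by rewrite u0.
by move: xy Gu; lra.
Qed.

(** Averaging: some child has at least the parent's ratio of potential to number of leaves. The
    factor [E] is common because supports and weight are still those of the parent. *)
Lemma heavier_child (R : realFieldType) (G : nat) (rho l0 l1 psi psi0 psi1 E : R) :
  0 <= rho -> 0 < l0 -> 0 < l1 -> 0 <= psi -> psi <= psi0 + psi1 ->
  (rho * (l0 + l1)) ^+ G * E <= psi ^+ G ->
  (rho * l0) ^+ G * E <= psi0 ^+ G \/ (rho * l1) ^+ G * E <= psi1 ^+ G.
Proof.
move=> rho0 l00 l10 p0 hp hG.
have l0' : 0 < l0 + l1 by rewrite addr_gt0.
have child (k pk : R) : 0 < k -> psi * k <= pk * (l0 + l1) ->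
    (rho * k) ^+ G * E <= pk ^+ G.
  move=> k0 hk; have lG : 0 < (l0 + l1) ^+ G by rewrite exprn_gt0.
  rewrite -(ler_pM2r lG) -(exprMn _ pk).
  apply: (@le_trans _ _ ((psi * k) ^+ G)); last first.
    by apply: lerXn2r; rewrite ?nnegrE ?(le_trans _ hk) ?mulr_ge0 // ltW.
  have -> : (rho * k) ^+ G * E * (l0 + l1) ^+ G = (rho * (l0 + l1)) ^+ G * E * k ^+ G.
    by rewrite !(exprMn _ rho); ring.
  by rewrite (exprMn _ psi) ler_wpM2r // exprn_ge0 // ltW.
have [h0|h0] := lerP (psi * l0) (psi0 * (l0 + l1)); first by left; apply: child.
right; apply: child => //.
have : psi * (l0 + l1) <= (psi0 + psi1) * (l0 + l1) by rewrite ler_wpM2r // ltW.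
by move: h0; lra.
Qed.

Lemma sum_const2 (R : pzSemiRingType) (I J : finType) (k : R) :
  \sum_(i : I) \sum_(j : J) k = k * (#|I|%:R * #|J|%:R).
Proof.
rewrite (eq_bigr (fun=> k *+ #|J|)) => [|i _]; last by rewrite sumr_const.
by rewrite sumr_const -mulrnA -natrM mulr_natr mulnC.
Qed.

(** * The invariant along the descent *)

Section Embedding.

Variables (R : realFieldType) (C L U V Rw W : finType).
Local Notation Om := {ffun C -> L}.
Implicit Types (I Fr F Cx Cy : {set C}) (x y a : Om) (X Y : {set Om})
  (A : Om -> {set U}) (B : Om -> {set V}) (w : Om -> Om -> R) (Lv : {set Rw})
  (p : protocol (U * Om) (V * Om) W).

Variables (mu : {set U} -> {set V} -> nat) (row : C -> Rw) (rowof : W -> Rw)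
  (la : Rw -> pred U) (lb : Rw -> pred V) (good : W -> {ffun C -> bool} -> Prop).
Hypothesis mu0l : forall S, mu set0 S = 0%N.
Hypothesis mu0r : forall S, mu S set0 = 0%N.
Hypothesis mu_subl : forall (S S0 S1 : {set U}) (S' : {set V}),
  S \subset S0 :|: S1 -> (mu S S' <= mu S0 S' + mu S1 S')%N.
Hypothesis mu_subr : forall (S S0 S1 : {set V}) (S' : {set U}),
  S \subset S0 :|: S1 -> (mu S' S <= mu S' S0 + mu S' S1)%N.
Hypothesis mu_kill : forall i (S : {set U}) (S' : {set V}),
  (mu S S' <= mu [set u in S | la i u] S' + mu S [set v in S' | lb i v] + 1)%N.
Hypothesis mu_prot : forall (p : protocol U V Rw) (S : {set U}) (S' : {set V}),
  (forall u v, u \in S -> v \in S' ->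
     ~~ la (protocol_eval p u v) u && ~~ lb (protocol_eval p u v) v) ->
  (mu S S' <= protocol_leaves p)%N.

Variables (gd : L -> L -> bool) (adv : {set C} -> {ffun C -> bool} -> nat -> Prop).
Hypothesis adv_step : forall F z k j, j \notin F -> adv F z k ->
  exists2 w : {ffun C -> bool}, {in F, w =1 z} & adv (j |: F) w k.-1.
Hypothesis adv_end : forall F z k o, adv F z k.+1 ->
  exists2 w : {ffun C -> bool}, {in F, w =1 z} &
    forall w' : {ffun C -> bool}, (forall c, row c = rowof o -> w' c = w c) ->
      ~ good o w'.

Variables (q s K : nat) (h tau r r1 r2 sigma eps g Theta rho : R).
Variable (z0 : {ffun C -> bool}).
Hypothesis adv0 : adv set0 z0 q.
Hypothesis par : params C gd h tau r r2 sigma eps.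
Hypothesis parf : params C (flip gd) h tau r r2 sigma eps.
Hypothesis htau : (1 + tau) ^+ #|C| <= 4 / 3.
Hypothesis hg1 : 1 <= g.
Hypothesis hg : 4 * g <= r * #|L|%:R.
Hypothesis hTheta : 0 <= Theta < g ^+ q.
Hypothesis rho01 : 0 < rho <= 1.
Hypothesis hrho : 1 <= rho ^+ 2 * 2 ^+ K.
Hypothesis K0 : (0 < K)%N.
Hypothesis s1 : (1 < s)%N.
Hypothesis rhos : 4 <= rho * s%:R.
Hypothesis hs : 8 * s%:R ^+ 10 <= Theta * rho.
Hypothesis r10 : 0 < r1.
Hypothesis r1T : 16 <= r1 * #|L|%:R.
Hypothesis r1r : 2 * K.+2%:R * r1 <= r.
Hypothesis rlt1 : r < 1.
Hypothesis Keps : 16 * K.+2%:R * eps <= 1.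

Let G1 : 1 <= K.+2%:R :> R. Proof. by rewrite ler1n. Qed.
Let r0 := par_r0 par.
Let eps0 : 0 <= eps.
Proof.
apply: le_trans (par_sum par); apply: sumr_ge0 => I _; apply: sumr_ge0 => J _.
rewrite mulr_ge0 ?exprn_ge0 ?ler0n //.
by rewrite divr_ge0 ?exprn_ge0 // ltW ?(par_sigma0 par) ?(par_tau0 par).
Qed.
Let eps4 : 16 * eps <= 1.
Proof.
apply: le_trans Keps; rewrite ler_wpM2r // ler_peMr //.
Qed.
Let heps : eps <= 1 / 4. Proof. by move: eps4 eps0; lra. Qed.
Let r1r2 : r1 <= 2 * r2.
Proof.
have := par_rr2 par; suff : r1 <= r by move: r0; lra.
apply: le_trans r1r; rewrite ler_peMl ?(ltW r10) //.
have : 2 <= K.+2%:R :> R by rewrite ler_nat.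
lra.
Qed.
Let L0 := par_L par.
Let G0 : (0 < K.+2)%N. Proof. by []. Qed.

Definition correct p A B := forall x y u v, u \in A x -> v \in B y ->
  let o := protocol_eval p (u, x) (v, y) in
  [/\ ~~ la (rowof o) u, ~~ lb (rowof o) v & good o (output gd x y)].

Lemma correct_sub p A B A' B' : le_fam A' A -> le_fam B' B ->
  correct p A B -> correct p A' B'.
Proof.
by move=> hA hB hp x y u v uA vB; apply: hp; [apply: (subsetP (hA x))|apply: (subsetP (hB y))].
Qed.

Lemma mu_leaves p A B x y : correct p A B -> (mu (A x) (B y) <= protocol_leaves p)%N.
Proof.
move=> hp; rewrite -(leaves_protocol_map (fun u => (u, x)) (fun v => (v, y)) rowof).
by apply: mu_prot => u v uA vB; rewrite eval_protocol_map; case: (hp x y u v uA vB) => -> ->.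
Qed.

Local Notation vl Cx Cy := (vol R L Cx * vol R L Cy).

Let vl0 Cx Cy : 0 < vl Cx Cy. Proof. by rewrite mulr_gt0 ?vol_gt0. Qed.

(* A protocol on the inputs alone, obtained by fixing [u \in A x] and [v \in B y]
   as functions of [x] and [y]. *)
Lemma fix_outer p A B Cx Cy Lv : live row la lb A B Cx Cy Lv -> correct p A B ->
  (0 < #|supp A|)%N -> (0 < #|supp B|)%N ->
  exists p' : protocol Om Om W, protocol_leaves p' = protocol_leaves p /\
    forall x y, x \in supp A -> y \in supp B ->
      rowof (protocol_eval p' x y) \in Lv /\ good (protocol_eval p' x y) (output gd x y).
Proof.
move=> [_ _ _ dead] hp /card_gt0P[xa] xaA /card_gt0P[yb ybB].
have /set0Pn[u0 _] : A xa != set0 by move: xaA; rewrite inE.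
have /set0Pn[v0 _] : B yb != set0 by move: ybB; rewrite inE.
pose a x := odflt u0 [pick u in A x]; pose b y := odflt v0 [pick v in B y].
have aP x : x \in supp A -> a x \in A x.
  rewrite inE => /set0Pn[u uA]; rewrite /a; case: pickP => //= e.
  by have := e u; rewrite uA.
have bP y : y \in supp B -> b y \in B y.
  rewrite inE => /set0Pn[u uA]; rewrite /b; case: pickP => //= e.
  by have := e u; rewrite uA.
exists (protocol_map (fun x => (a x, x)) (fun y => (b y, y)) id p).
split=> [|x y /aP xA /bP yB]; first exact: leaves_protocol_map.
rewrite eval_protocol_map; have [hla hlb hgood] := hp _ _ _ _ xA yB; split => //.
apply/negPn/negP => /dead[h1|h1]; first by rewrite (h1 _ _ xA) in hla.
by rewrite (h1 _ _ yB) in hlb.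
Qed.

(** X is only known to consist of safe points. One turn makes it dense and weakens Y, so the
    simulation goes on with the roles exchanged, which is why [p] takes y before x. All outputs lie
    in live rows, whose coordinates belong to [frees row Lv], so the adversary can refute them
    there. *)
Lemma lifting_safe gd' Lv X Y Cx Cy (p : protocol Om Om W) :
  params C gd' h tau r r2 sigma eps -> params C (flip gd') h tau r r2 sigma eps ->
  {in X &, forall x x', agree Cx x x'} -> {in Y &, forall y y', agree Cy y y'} ->
  [disjoint frees row Lv & Cx] && [disjoint frees row Lv & Cy] ->
  (0 < #|X|)%N -> (0 < #|Y|)%N ->
  {in X, forall x, safe gd' tau r2 (frees row Lv) Y x} ->
  dense r (frees row Lv) (ind R Y) ->
  (forall x y, x \in X -> y \in Y -> rowof (protocol_eval p y x) \in Lv /\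
     good (protocol_eval p y x) (output gd' x y)) ->
  (protocol_leaves p)%:R ^+ 10 <= Theta * (density R X Cx * density R Y Cy) -> False.
Proof.
move=> par' parf' cX cY dC X0 Y0 sX dY hp hl.
have g0 : 0 <= g by apply: le_trans hg1.
have st : state adv q gd' X Y Cx Cy (frees row Lv) set0 z0.
  split => //; last by rewrite cards0 subn0.
    by rewrite dC -setI_eq0 setI0 eqxx.
  by move=> x y j; rewrite inE.
have [I [X1 [Y1 [w [IF X1X Y1Y /andP[X10 Y10] [st1 dX1 dY1 hD]]]]]] :=
  turn_safe adv_step par' htau g0 hg st X0 Y0 sX dY.
have adv_end' F z k o : adv F z k.+1 -> exists2 w : {ffun C -> bool}, {in F, w =1 z} &
    forall w' : {ffun C -> bool}, {in frees row Lv, w' =1 w} ->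
      ~ (rowof o \in Lv /\ good o w').
  move=> /(adv_end o)[w' wz bad]; exists w' => // w2 e [oL gw]; apply: (bad w2) => // c co.
  by apply: e; rewrite inE co.
apply: (lifting (good := fun o z => rowof o \in Lv /\ good o z) adv_step adv_end'
  parf' par' htau hg1 hg heps hTheta (p := p) (state_flip st1)) => //.
- rewrite set0U; apply/setP => j; rewrite in_setU in_setD.
  by have [/(subsetP IF) ->|_] := boolP (j \in I); rewrite ?orbT ?orbF.
- by move=> y x yY xX; apply: hp; [apply: (subsetP X1X)|apply: (subsetP Y1Y)].
- rewrite set0U [density R Y1 _ * _]mulrC; have [T0 _] := andP hTheta.
  apply: le_trans (_ : Theta * (density R X Cx * density R Y Cy * g ^+ #|I|) <= _).
    by rewrite mulrA mulrC ler_wpM2r // exprn_ge0.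
  by rewrite ler_wpM2l.
Qed.

Lemma wsum_le_supp p A B w : correct p A B -> (forall x y, 0 <= w x y <= 1) ->
  wsum mu w A B <= (protocol_leaves p)%:R * (#|supp A|%:R * #|supp B|%:R).
Proof.
move=> hp w01; apply: (wsum_bound mu0l mu0r).
- by move=> x y; case/andP: (w01 x y).
- by move=> x y ->.
- by move=> x y ->.
- by move=> x y; apply: mu_leaves hp.
Qed.

Let leaves0 (p : protocol (U * Om) (V * Om) W) : 0 < (protocol_leaves p)%:R :> R.
Proof. by rewrite ltr0n protocol_leaves_gt0. Qed.

Let rho0 : 0 < rho. Proof. by case/andP: rho01. Qed.

Definition violation A B Lv :=
  (exists (I : {set C}) a, I \subset frees row Lv /\
     r1 ^+ #|I| * nsum R mu A B < \sum_(x | agree I x a) marg R mu A B x) \/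
  (exists (I : {set C}) a, I \subset frees row Lv /\
     r1 ^+ #|I| * nsum R (swap mu) B A < \sum_(x | agree I x a) marg R (swap mu) B A x).

(** With at least [s] leaves, [rhos] makes the normalized sum at least 2, as [kill_violation]
    requires. Its gain 4 lifts the lower bound from $\rho l/2$ to $2\rho l$, the threshold in
    [heavy_excluded], and there are fewer live rows. *)
Lemma heavy_kill p A B Cx Cy Lv : live row la lb A B Cx Cy Lv -> correct p A B ->
  (s <= protocol_leaves p)%N -> rho * (protocol_leaves p)%:R * vl Cx Cy <= 2 * nsum R mu A B ->
  violation A B Lv ->
  exists A' B' Cx' Cy' Lv', [/\ (#|Lv'| < #|Lv|)%N, correct p A' B',
    live row la lb A' B' Cx' Cy' Lv' &
    2 * (rho * (protocol_leaves p)%:R) * vl Cx' Cy' <= nsum R mu A' B'].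
Proof.
move=> lv hp sp; set l := (protocol_leaves p)%:R => hN viol.
have v0 := vl0 Cx Cy.
have rl : 4 <= rho * l.
  by apply: le_trans rhos _; rewrite ler_wpM2l ?(ltW rho0) // ler_nat.
have N2 : 2 * vl Cx Cy <= nsum R mu A B.
  have : 4 * vl Cx Cy <= rho * l * vl Cx Cy by rewrite ler_wpM2r // ltW.
  by move: hN; lra.
have Nr : 2 * (rho * l) <= 4 * nsum R mu A B / vl Cx Cy.
  by rewrite ler_pdivlMr //; move: hN; lra.
case: viol => -[I [a [IF hv]]].
  have [A' [B' [Cx' [Lv' [cL hA hB lv' hN']]]]] :=
    kill_violation mu0l mu0r mu_kill L0 r10 r1T lv N2 IF hv.
  exists A', B', Cx', Cy, Lv'; split => //; first exact: correct_sub hp.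
  by rewrite -ler_pdivlMr //; apply: le_trans hN'.
rewrite -(nsum_swap R mu) [vl _ _]mulrC in N2 Nr.
have mu_kill' i (S : {set V}) (S' : {set U}) :
    (swap mu S S' <= swap mu [set v in S | lb i v] S' +
       swap mu S [set u in S' | la i u] + 1)%N.
  by rewrite /swap [X in (_ <= X + _)%N]addnC mu_kill.
have [B' [A' [Cy' [Lv' [cL hB hA lv' hN']]]]] :=
  kill_violation (mu := swap mu) mu0r mu0l mu_kill' L0 r10 r1T (live_swap lv) N2 IF hv.
exists A', B', Cx, Cy', Lv'; split => //; first exact: correct_sub hp.
  exact: live_swap.
by rewrite -(nsum_swap R mu) [vl Cx Cy']mulrC -ler_pdivlMr ?vl0 //; apply: le_trans hN'.
Qed.

Definition potential A B Lv X Y :=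
  wsum mu (weight gd tau r r2 (frees row Lv) X Y) A B.

Definition clean A B Cx Cy Lv (l : R) :=
  let D := #|supp A|%:R * #|supp B|%:R / vl Cx Cy in
  [/\ live row la lb A B Cx Cy Lv, (0 < #|supp A|)%N && (0 < #|supp B|)%N,
      dense r (frees row Lv) (ind R (supp A)), dense r (frees row Lv) (ind R (supp B)) &
      (rho * l) ^+ K.+2 * D ^+ 2 <=
      (potential A B Lv (supp A) (supp B) / vl Cx Cy) ^+ K.+2].

Let w01 Fr X Y x y : 0 <= weight gd tau r r2 Fr X Y x y <= 1.
Proof. exact: weight01. Qed.

Lemma D_le1 A B Cx Cy Lv : live row la lb A B Cx Cy Lv ->
  #|supp A|%:R * #|supp B|%:R / vl Cx Cy <= 1 :> R.
Proof.
case=> cA cB _ _; have -> : #|supp A|%:R * #|supp B|%:R / vl Cx Cy =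
    density R (supp A) Cx * density R (supp B) Cy by rewrite /density invfM mulrACA.
by rewrite mulr_ile1 ?density_ge0 ?(density_le1 par).
Qed.

Let weight_mean' A B Fr X Y :
  dense r1 Fr (marg R mu A B) -> dense r1 Fr (marg R (swap mu) B A) ->
  dense r Fr (ind R X) -> dense r Fr (ind R Y) -> (0 < #|X|)%N -> (0 < #|Y|)%N ->
  nsum R mu A B <= 2 * wsum mu (weight gd tau r r2 Fr X Y) A B.
Proof.
move=> dA dB dX dY X0 Y0.
have dA2 := dense_weak (ltW r10) r1r2 (marg_ge0 R mu A B) dA.
have dB2 := dense_weak (ltW r10) r1r2 (marg_ge0 R (swap mu) B A) dB.
have := weight_mean par parf dA2 dB2 dX dY X0 Y0.
have := nsum_ge0 R mu A B; move: heps; set N := nsum R mu A B; set Q := wsum mu _ A B.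
move=> h1 h2; have : eps * N <= 1 / 4 * N by rewrite ler_wpM2r.
lra.
Qed.

(** Induction on the number of live rows. The supports are not yet dense, so [cleanup] is run with
    weight 1: a violation kills rows, and otherwise the families are clean. The factor 2 in the
    hypothesis pays for introducing the weight at that point. *)
Lemma heavy_excluded p : (s <= protocol_leaves p)%N ->
  (forall A B Cx Cy Lv, correct p A B ->
     clean A B Cx Cy Lv (protocol_leaves p)%:R -> False) ->
  forall A B Cx Cy Lv, correct p A B -> live row la lb A B Cx Cy Lv ->
    2 * (rho * (protocol_leaves p)%:R) * vl Cx Cy <= nsum R mu A B -> False.
Proof.
move=> sp noclean A B Cx Cy Lv; set l := (protocol_leaves p)%:R.
have [n] := ubnP #|Lv|; elim: n => // n IHn in A B Cx Cy Lv *; rewrite ltnS => cn.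
move=> hp lv hN; have v0 := vl0 Cx Cy.
have l0 : 0 < l by apply: leaves0.
have rl0 : 0 < rho * l by rewrite mulr_gt0.
have one x y : 0 <= (fun _ _ => 1 : R) x y <= 1 by rewrite ler01 lexx.
have wN A' B' : wsum mu (fun _ _ => 1) A' B' = nsum R mu A' B'.
  by apply: eq_bigr => x _; apply: eq_bigr => y _; rewrite mulr1.
have N0 : 0 < nsum R mu A B.
  by apply: lt_le_trans hN; rewrite mulr_gt0 // mulr_gt0.
have N0' : 0 < wsum mu (fun _ _ => 1 : R) A B by rewrite wN.
have [|A' [B' [hA hB N'0 hG viol]]] :=
    cleanup mu0l mu0r r10 G0 r1r rlt1 (Fr := frees row Lv) one N0'.
  by move=> A' B' _ _ _ _; rewrite wN ler_peMl ?nsum_ge0 ?ler1n.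
rewrite !wN in hG N'0.
have hp' := correct_sub hA hB hp; have lv' := live_sub hA hB lv.
have [A'0 B'0] : supp A' != set0 /\ supp B' != set0.
  by apply: (@wsum_supp R C L U V mu mu0l mu0r (fun _ _ => 1)); rewrite wN.
set D' := #|supp A'|%:R * #|supp B'|%:R / vl Cx Cy : R.
have D'1 : D' <= 1 := D_le1 lv'.
have D'0 : 0 < D' by rewrite divr_gt0 // mulr_gt0 // ltr0n card_gt0.
set nu := nsum R mu A' B' / vl Cx Cy.
have nu0 : 0 < nu by rewrite divr_gt0.
have nuD : nu <= l * D'.
  by rewrite /D' mulrA ler_wpM2r ?invr_ge0 ?(ltW v0) // -wN wsum_le_supp.
have hG2 : (2 * (rho * l)) ^+ K.+2 * D' <= nu ^+ K.+2.
  apply: le_trans (_ : (nsum R mu A B / vl Cx Cy) ^+ K.+2 * D' <= _).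
    rewrite ler_wpM2r ?(ltW D'0) //; apply: lerXn2r; rewrite ?nnegrE.
    - by rewrite mulr_ge0 // ltW.
    - by rewrite divr_ge0 // ltW.
    - by rewrite ler_pdivlMr.
  apply: le_trans (ler_normalize v0 hG) _; rewrite -/nu ler_piMr ?exprn_ge0 ?(ltW nu0) //.
  exact: D_le1 lv.
have nul : rho * l <= 2 * nu.
  apply: (potential_lb rho0 l0 (ltW nu0) D'0 nuD _ K0 hrho).
  apply: le_trans hG2; apply: ler_pM.
  - by rewrite exprn_ge0 // ltW.
  - exact: sqr_ge0.
  - apply: lerXn2r; rewrite ?nnegrE ?(mulr_ge0 _ (ltW rl0)) ?(ltW rl0) //.
    by rewrite ler_peMl ?(ltW rl0) // ler1n.
  - by rewrite expr2 ler_piMl // ltW.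
have heavy : rho * l * vl Cx Cy <= 2 * nsum R mu A' B'.
  by rewrite -ler_pdivlMr // -mulrA.
have kill : ~ violation A' B' Lv.
  move=> viol'.
  have [A2 [B2 [Cx2 [Cy2 [Lv2 [cL hp2 lv2 hN2]]]]]] := heavy_kill lv' hp' sp heavy viol'.
  exact: IHn (leq_trans cL cn) hp2 lv2 hN2.
case: viol => [viol|viol|[dA dB dX dY]].
- by apply: kill; left.
- by apply: kill; right.
have X0 : (0 < #|supp A'|)%N by rewrite card_gt0.
have Y0 : (0 < #|supp B'|)%N by rewrite card_gt0.
apply: (noclean A' B' Cx Cy Lv hp'); split => //; first by rewrite X0.
rewrite -/D' -/l; set psi := potential _ _ _ _ _.
have hpsi : nu <= 2 * (psi / vl Cx Cy).
  by rewrite mulrA ler_wpM2r ?invr_ge0 ?(ltW v0) // weight_mean'.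
have h2 : 0 < 2 ^+ K.+2 :> R by rewrite exprn_gt0.
rewrite -(ler_pM2l h2) mulrA -!exprMn.
apply: le_trans (_ : (2 * (rho * l)) ^+ K.+2 * D' <= _).
  apply: ler_wpM2l; first by rewrite exprn_ge0 // mulr_ge0 // ltW.
  by rewrite expr2 ler_piMl // ltW.
apply: le_trans hG2 _; apply: lerXn2r; rewrite ?nnegrE ?(ltW nu0) //.
exact: le_trans (ltW nu0) hpsi.
Qed.

(** The potential of the child is measured with the parent's supports and weight. Below [s] leaves
    the player who did not speak still has the dense support of the parent, and the other player has
    many safe points against it, so [lifting_safe] applies. From [s] leaves on, [cleanup] yields a
    clean pair or a violation, and [heavy_excluded] handles the latter. *)
Lemma clean_child p A B A' B' Cx Cy Lv (l := (protocol_leaves p)%:R) :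
  (forall A B Cx Cy Lv, correct p A B -> clean A B Cx Cy Lv l -> (s <= protocol_leaves p)%N -> False) ->
  live row la lb A B Cx Cy Lv -> (0 < #|supp A|)%N && (0 < #|supp B|)%N ->
  dense r (frees row Lv) (ind R (supp A)) -> dense r (frees row Lv) (ind R (supp B)) ->
  le_fam A' A -> le_fam B' B -> supp A' = supp A \/ supp B' = supp B ->
  correct p A' B' ->
  (rho * l) ^+ K.+2 * (#|supp A|%:R * #|supp B|%:R / vl Cx Cy) ^+ 2 <=
    (potential A' B' Lv (supp A) (supp B) / vl Cx Cy) ^+ K.+2 -> False.
Proof.
move=> noclean lv /andP[X0 Y0] dX dY hA hB hAB hp.
have v0 := vl0 Cx Cy.
have l0 : 0 < l by apply: leaves0.
have rl0 : 0 < rho * l by rewrite mulr_gt0.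
set X := supp A in X0 dX hAB *; set Y := supp B in Y0 dY hAB *.
set w := weight gd tau r r2 (frees row Lv) X Y.
set D := #|X|%:R * #|Y|%:R / vl Cx Cy; set psi := potential A' B' Lv X Y / vl Cx Cy.
have D0 : 0 < D by rewrite divr_gt0 // mulr_gt0 // ltr0n.
have D1 : D <= 1 := D_le1 lv.
have cards (Z Z' : {set Om}) : Z \subset Z' -> #|Z|%:R <= #|Z'|%:R :> R.
  by move=> sZ; rewrite ler_nat subset_leq_card.
have psi0 : 0 <= psi by rewrite divr_ge0 ?(ltW v0) // wsum_ge0 // => x y; case/andP: (w01 (frees row Lv) X Y x y).
move=> hG; have psip : 0 < psi.
  rewrite lt_neqAle psi0 andbT; apply: contraTneq hG => <-.
  by rewrite expr0n /= -ltNge mulr_gt0 ?exprn_gt0.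
have w01' x y : 0 <= w x y <= 1 by apply: w01.
have lv' := live_sub hA hB lv.
have [sl|ls] := leqP s (protocol_leaves p); last first.
  have psiD : psi <= l * D.
    rewrite /D mulrA ler_wpM2r ?invr_ge0 ?(ltW v0) //.
    apply: le_trans (wsum_le_supp hp w01') _; rewrite ler_wpM2l ?(ltW l0) //.
    by apply: ler_pM; rewrite ?ler0n ?cards // supp_sub.
  have hlb := potential_lb rho0 l0 psi0 D0 psiD hG K0 hrho.
  (* The weight vanishes outside [Xs] and [Ys], and every rectangle costs at most [l] leaves; so the
     lower bound on the potential becomes one on the number of safe pairs. *)
  pose Xs := [set x in supp A' | badness gd tau r r2 (frees row Lv) Y x < 1].
  pose Ys := [set y in supp B' | badness (flip gd) tau r r2 (frees row Lv) X y < 1].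
  have sXs : Xs \subset supp A' by apply/subsetP => x; rewrite inE => /andP[].
  have sYs : Ys \subset supp B' by apply/subsetP => x; rewrite inE => /andP[].
  have hs' : rho / 2 * vl Cx Cy <= #|Xs|%:R * #|Ys|%:R.
    have hb : wsum mu w A' B' <= l * (#|Xs|%:R * #|Ys|%:R).
      apply: (wsum_bound mu0l mu0r).
      - by move=> x y; case/andP: (w01' x y).
      - move=> x y xA; rewrite inE xA /= -leNgt; exact: weight_badx.
      - move=> x y yB; rewrite inE yB /= -leNgt; exact: weight_bady.
      - by move=> x y; apply: mu_leaves hp.
    rewrite -(ler_pM2l l0); apply: le_trans hb.
    move: hlb; rewrite /psi mulrA ler_pdivlMr // -/w /potential -/w; lra.
  have XY0 : 0 < #|Xs|%:R * #|Ys|%:R :> R.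
    by apply: lt_le_trans hs'; rewrite mulr_gt0 // divr_gt0.
  have Xs0 : (0 < #|Xs|)%N.
    by rewrite lt0n; apply: contraTneq XY0 => ->; rewrite mul0r ltxx.
  have Ys0 : (0 < #|Ys|)%N.
    by rewrite lt0n; apply: contraTneq XY0 => ->; rewrite mulr0 ltxx.
  have A'0 : (0 < #|supp A'|)%N by apply: leq_trans Xs0 (subset_leq_card sXs).
  have B'0 : (0 < #|supp B'|)%N by apply: leq_trans Ys0 (subset_leq_card sYs).
  have [p' [lp hp']] := fix_outer lv' hp A'0 B'0.
  have [cA cB dC _] := lv'.
  have hl : l ^+ 10 <= Theta * (#|Xs|%:R * #|Ys|%:R / vl Cx Cy).
    have [T0 _] := andP hTheta.
    apply: le_trans (_ : Theta * (rho / 2) <= _); last by rewrite ler_wpM2l // ler_pdivlMr.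
    apply: le_trans (_ : s%:R ^+ 10 <= _).
      by apply: lerXn2r; rewrite ?nnegrE ?ler0n // ler_nat ltnW.
    have s0 : 0 <= s%:R ^+ 10 :> R by rewrite exprn_ge0 ?ler0n.
    by move: hs s0; lra.
  have densE (P Q : {set Om}) : density R P Cx * density R Q Cy = #|P|%:R * #|Q|%:R / vl Cx Cy.
    by rewrite /density mulf_div.
  have grow (P Q P' Q' : {set Om}) : P \subset P' -> Q \subset Q' ->
      l ^+ 10 <= Theta * (#|P|%:R * #|Q|%:R / vl Cx Cy) ->
      (protocol_leaves p')%:R ^+ 10 <= Theta * (density R P' Cx * density R Q' Cy).
    move=> sP sQ; rewrite lp densE => /le_trans; apply.
    have [T0 _] := andP hTheta; rewrite ler_wpM2l // ler_wpM2r ?invr_ge0 ?(ltW v0) //.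
    by apply: ler_pM; rewrite ?ler0n ?cards.
  case: hAB => [eA|eB].
    rewrite eA in cA hp' sXs.
    apply: (lifting_safe (Lv := Lv) (p := p') (X := Ys) (Y := X) (Cx := Cy) (Cy := Cx) parf par _ cA) => //.
    - by move=> y y' /(subsetP sYs) yB /(subsetP sYs); apply: cB.
    - by rewrite andbC.
    - by move=> y; rewrite inE => /andP[_]; apply: (badness_safe parf dX).
    - by move=> y x /(subsetP sYs) yB xX; apply: hp'.
    - by rewrite [density R Ys _ * _]mulrC; apply: grow hl.
  rewrite eB in cB hp' sYs.
  apply: (lifting_safe (Lv := Lv) (p := protocol_flip p') (X := Xs) (Y := Y) par parf _ cB dC) => //.
  - by move=> y y' /(subsetP sXs) yB /(subsetP sXs); apply: cA.
  - by move=> y; rewrite inE => /andP[_]; apply: (badness_safe par dY).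
  - by move=> x y /(subsetP sXs) xA yY; rewrite eval_protocol_flip; apply: hp'.
  - by rewrite leaves_protocol_flip; apply: grow hl.
have hexcl := heavy_excluded sl (fun A B Cx Cy Lv hc cl => noclean A B Cx Cy Lv hc cl sl).
have psi'0 : 0 < wsum mu w A' B' by move: psip; rewrite /psi pmulr_lgt0 ?invr_gt0.
have wmean A1 B1 : le_fam A1 A' -> le_fam B1 B' ->
    dense r1 (frees row Lv) (marg R mu A1 B1) ->
    dense r1 (frees row Lv) (marg R (swap mu) B1 A1) ->
    nsum R mu A1 B1 <= 2 * wsum mu w A1 B1.
  by move=> _ _ dA1 dB1; apply: weight_mean'.
have [A1 [B1 [hA1 hB1 psi1 hG1 viol]]] :=
  cleanup mu0l mu0r r10 G0 r1r rlt1 w01' psi'0 wmean.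
have hp1 := correct_sub hA1 hB1 hp; have lv1 := live_sub hA1 hB1 lv'.
have [A10 B10] := wsum_supp mu0l mu0r psi1.
have X10 : (0 < #|supp A1|)%N by rewrite card_gt0.
have Y10 : (0 < #|supp B1|)%N by rewrite card_gt0.
set D1' := #|supp A1|%:R * #|supp B1|%:R / vl Cx Cy : R.
have D1'0 : 0 < D1' by rewrite divr_gt0 // mulr_gt0 // ltr0n.
have sA1 : supp A1 \subset X by apply: supp_sub; apply: le_fam_trans hA1 hA.
have sB1 : supp B1 \subset Y by apply: supp_sub; apply: le_fam_trans hB1 hB.
have D1'D : D1' <= D.
  rewrite ler_wpM2r ?invr_ge0 ?(ltW v0) //.
  by apply: ler_pM; rewrite ?ler0n ?cards.
set psi1' := wsum mu w A1 B1 / vl Cx Cy.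
have psi1'0 : 0 < psi1' by rewrite divr_gt0.
(* Maximality exchanges one of the two factors [D] for [D1']; [shrink_potential] exchanges the
   other. *)
have hG2 : (rho * l) ^+ K.+2 * (D * D1') <= psi1' ^+ K.+2.
  have hG3 := ler_normalize v0 hG1; rewrite -/psi1' -/D1' in hG3.
  have hD' : #|supp A'|%:R * #|supp B'|%:R / vl Cx Cy <= D.
    rewrite ler_wpM2r ?invr_ge0 ?(ltW v0) //.
    by apply: ler_pM; rewrite ?ler0n ?cards // supp_sub.
  have hG4 : psi ^+ K.+2 * D1' <= psi1' ^+ K.+2 * D.
    by apply: le_trans hG3 _; rewrite ler_wpM2l // exprn_ge0 // ltW.
  rewrite -(ler_pM2r D0); apply: le_trans hG4.
  have -> : (rho * l) ^+ K.+2 * (D * D1') * D = (rho * l) ^+ K.+2 * D ^+ 2 * D1' by rewrite expr2; ring.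
  by rewrite ler_wpM2r // ltW.
have psi1D : psi1' <= l * D1'.
  by rewrite /D1' mulrA ler_wpM2r ?invr_ge0 ?(ltW v0) // wsum_le_supp.
have lb1 : rho * l <= 2 * psi1'.
  apply: (potential_lb rho0 l0 (ltW psi1'0) D1'0 psi1D _ K0 hrho).
  apply: le_trans hG2; apply: ler_wpM2l; first by rewrite exprn_ge0 // ltW.
  by rewrite expr2 ler_wpM2r // ltW.
have N1 : wsum mu w A1 B1 <= nsum R mu A1 B1.
  by apply: wsum_le_nsum => x y; case/andP: (w01' x y).
have heavy : rho * l * vl Cx Cy <= 2 * nsum R mu A1 B1.
  apply: le_trans (_ : 2 * wsum mu w A1 B1 <= _); last by rewrite ler_wpM2l.
  by rewrite -ler_pdivlMr // -mulrA.
have kill : ~ violation A1 B1 Lv.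
  move=> viol'.
  have [A2 [B2 [Cx2 [Cy2 [Lv2 [cL hp2 lv2 hN2]]]]]] := heavy_kill lv1 hp1 sl heavy viol'.
  exact: hexcl hp2 lv2 hN2.
case: viol => [viol|viol|[dA1 dB1 dX1 dY1]].
- by apply: kill; left.
- by apply: kill; right.
apply: (noclean A1 B1 Cx Cy Lv hp1) => //; split => //; first by rewrite X10.
rewrite -/D1'; set psi2 := potential _ _ _ _ _.
have dA2 := dense_weak (ltW r10) r1r2 (marg_ge0 R mu A1 B1) dA1.
have dB2 := dense_weak (ltW r10) r1r2 (marg_ge0 R (swap mu) B1 A1) dB1.
have hc := weight_cont par parf dA2 dB2 dX dY dX1 dY1 sA1 sB1 X10 Y10.
have hm := weight_mean' dA1 dB1 dX dY X0 Y0.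
have Xp : 0 < #|X|%:R :> R by rewrite ltr0n.
have Yp : 0 < #|Y|%:R :> R by rewrite ltr0n.
pose tX : R := #|supp A1|%:R / #|X|%:R; pose tY : R := #|supp B1|%:R / #|Y|%:R.
have tX01 : 0 <= tX <= 1 by rewrite divr_ge0 ?ler0n //= ler_pdivrMr // mul1r cards.
have tY01 : 0 <= tY <= 1 by rewrite divr_ge0 ?ler0n //= ler_pdivrMr // mul1r cards.
apply: (shrink_potential (D := D) (psi := psi1') (tX := tX) (tY := tY) (eps := eps)) => //.
- by rewrite exprn_ge0 // ltW.
- exact: ltW.
- exact: ltW.
- have frac (e f v : R) : 0 < f -> e / v = f / v * (e / f).
    by move=> f0; rewrite [RHS]mulrC mulrA divfK // gt_eqF.
  by rewrite /tX /tY mulf_div; apply: frac; rewrite mulr_gt0.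
rewrite /psi1' mulrAC ler_wpM2r ?invr_ge0 ?(ltW v0) //.
rewrite -/w -/tX -/tY in hc hm; move: hc; rewrite -/psi2.
set th := (1 - tX) + (1 - tY); set N := nsum R mu A1 B1 in hm *.
set Q := wsum mu w A1 B1 in hm *; move=> hc.
have : 4 * eps * th * N <= 4 * eps * th * (2 * Q).
  rewrite ler_wpM2l // !mulr_ge0 // addr_ge0 // subr_ge0; by [case/andP: tX01 | case/andP: tY01].
by move: hc; rewrite /psi2 /potential; lra.
Qed.

Lemma clean_excluded p A B Cx Cy Lv : correct p A B ->
  clean A B Cx Cy Lv (protocol_leaves p)%:R -> (s <= protocol_leaves p)%N -> False.
Proof.
elim: p => [ o|c p0 IH0 p1 IH1|c p0 IH0 p1 IH1] in A B Cx Cy Lv *.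
- by move=> _ _; rewrite /= leqNgt s1.
- move=> hp [lv XY0 dX dY hG] _.
  pose A0 x := [set u in A x | ~~ c (u, x)]; pose A1 x := [set u in A x | c (u, x)].
  have hA0 : le_fam A0 A by move=> x; apply/subsetP => u; rewrite inE => /andP[].
  have hA1 : le_fam A1 A by move=> x; apply/subsetP => u; rewrite inE => /andP[].
  have hB : le_fam B B by move=> x; apply: subxx.
  have hp0 : correct p0 A0 B.
    move=> x y u v; rewrite inE => /andP[uA /negbTE cu] vB.
    by have := hp x y u v uA vB; rewrite /= cu.
  have hp1 : correct p1 A1 B.
    move=> x y u v; rewrite inE => /andP[uA cu] vB.
    by have := hp x y u v uA vB; rewrite /= cu.
  have w0 x y := proj1 (andP (w01 (frees row Lv) (supp A) (supp B) x y)).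
  have hs1 : potential A B Lv (supp A) (supp B) / vl Cx Cy <=
     potential A0 B Lv (supp A) (supp B) / vl Cx Cy +
     potential A1 B Lv (supp A) (supp B) / vl Cx Cy.
    rewrite -mulrDl ler_wpM2r ?invr_ge0 ?(ltW (vl0 _ _)) //.
    rewrite /potential; apply: (wsum_split mu_subl) => [x y|x]; first exact: w0.
    by apply/subsetP => u uA; rewrite !inE uA; case: (c _).
  move: hG; rewrite /= natrD => hG.
  have p00 : 0 <= potential A B Lv (supp A) (supp B) / vl Cx Cy.
    by rewrite divr_ge0 ?(ltW (vl0 _ _)) // wsum_ge0.
  have [h0|h1] := heavier_child (ltW rho0) (leaves0 p0) (leaves0 p1) p00 hs1 hG.
    by apply: (clean_child IH0 lv XY0 dX dY hA0 hB _ hp0 h0); right.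
  by apply: (clean_child IH1 lv XY0 dX dY hA1 hB _ hp1 h1); right.
- move=> hp [lv XY0 dX dY hG] _.
  pose B0 y := [set v in B y | ~~ c (v, y)]; pose B1 y := [set v in B y | c (v, y)].
  have hB0 : le_fam B0 B by move=> x; apply/subsetP => u; rewrite inE => /andP[].
  have hB1 : le_fam B1 B by move=> x; apply/subsetP => u; rewrite inE => /andP[].
  have hA : le_fam A A by move=> x; apply: subxx.
  have hp0 : correct p0 A B0.
    move=> x y u v uA; rewrite inE => /andP[vB /negbTE cv].
    by have := hp x y u v uA vB; rewrite /= cv.
  have hp1 : correct p1 A B1.
    move=> x y u v uA; rewrite inE => /andP[vB cv].
    by have := hp x y u v uA vB; rewrite /= cv.
  have w0 x y := proj1 (andP (w01 (frees row Lv) (supp A) (supp B) x y)).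
  have hs1 : potential A B Lv (supp A) (supp B) / vl Cx Cy <=
     potential A B0 Lv (supp A) (supp B) / vl Cx Cy +
     potential A B1 Lv (supp A) (supp B) / vl Cx Cy.
    rewrite -mulrDl ler_wpM2r ?invr_ge0 ?(ltW (vl0 _ _)) // /potential -!(wsum_swap mu).
    apply: (wsum_split (mu := swap mu)) => [S S0 S1 S'|x y|x]; [exact: mu_subr|exact: w0|].
    by apply/subsetP => u uA; rewrite !inE uA; case: (c _).
  move: hG; rewrite /= natrD => hG.
  have p00 : 0 <= potential A B Lv (supp A) (supp B) / vl Cx Cy.
    by rewrite divr_ge0 ?(ltW (vl0 _ _)) // wsum_ge0.
  have [h0|h1] := heavier_child (ltW rho0) (leaves0 p0) (leaves0 p1) p00 hs1 hG.
    by apply: (clean_child IH0 lv XY0 dX dY hA hB0 _ hp0 h0); left.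
  by apply: (clean_child IH1 lv XY0 dX dY hA hB1 _ hp1 h1); left.
Qed.

Lemma vol0 : vol R L (set0 : {set C}) = #|{: Om}|%:R.
Proof. by rewrite /vol setC0 cardsT card_ffun natrX. Qed.

Lemma dense_setT Fr : dense r Fr (ind R [set: Om]).
Proof.
move=> I a _; rewrite sum_ind sum_ind_card cardsT -vol0.
have -> : #|[set x in [set: Om] | agree I x a]|%:R = vol R L I.
  rewrite -(sum_agree R I a) -sum_ind; apply: eq_bigr => x _.
  by rewrite /ind inE.
have d0 : [disjoint set0 & I] by rewrite disjoint_sym -setI_eq0 setI0.
rewrite (volU R L d0) set0U mulrCA ler_peMr ?vol_ge0 // -exprMn exprn_ege1 //.
by move: hg hg1; lra.
Qed.

Theorem embedding p (u0 : U) (v0 : V) : correct p (fun=> setT) (fun=> setT) ->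
  (mu setT setT)%:R < 2 * rho * (protocol_leaves p)%:R :> R.
Proof.
move=> hp; set A := fun=> setT in hp; set B := fun=> setT in hp.
have sA : supp A = setT by apply/setP => x; rewrite !inE; apply/set0Pn; exists u0; rewrite inE.
have sB : supp B = setT by apply/setP => x; rewrite !inE; apply/set0Pn; exists v0; rewrite inE.
have agT (X : {set Om}) : {in X &, forall x x', agree set0 x x'}.
  by move=> x x' _ _; apply: agree0.
have fT : frees row setT = setT by apply/setP => c; rewrite !inE.
have lv : live row la lb A B set0 set0 setT.
  by split=> // [|i]; rewrite ?inE // fT -setI_eq0 setI0 eqxx.
have Om0 : (0 < #|{: Om}|)%N by rewrite card_ffun expn_gt0 L0.
have [sl|ls] := leqP s (protocol_leaves p).
  rewrite ltNge; apply/negP => hmu.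
  apply: (heavy_excluded sl _ hp lv) => [A' B' Cx Cy Lv hp' cl|].
    exact: clean_excluded hp' cl sl.
  have -> : nsum R mu A B = (mu setT setT)%:R * vl (set0 : {set C}) (set0 : {set C}).
    by rewrite !vol0 -sum_const2.
  by rewrite ler_wpM2r ?(ltW (vl0 _ _)) // mulrA.
(* With fewer than [s] leaves the protocol would solve the search problem on all inputs, so this
   case is contradictory. *)
have X0 : (0 < #|supp A|)%N by rewrite sA cardsT.
have Y0 : (0 < #|supp B|)%N by rewrite sB cardsT.
have [p' [lp hp']] := fix_outer lv hp X0 Y0; rewrite sA sB in hp'.
exfalso.
have adv_end' F z k o : adv F z k.+1 -> exists2 w : {ffun C -> bool}, {in F, w =1 z} &
    forall w' : {ffun C -> bool}, {in (setT : {set C}), w' =1 w} -> ~ good o w'.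
  move=> /(adv_end o)[w wz bad]; exists w => // w2 e; apply: bad => c _.
  by apply: e; rewrite inE.
have st : state adv q gd [set: Om] [set: Om] set0 set0 setT set0 z0.
  split; rewrite ?cards0 ?subn0 // -?setI_eq0 ?setI0 ?eqxx //.
  by move=> x y j _ _; rewrite inE.
have T0 : (0 < #|[set: Om]|)%N by rewrite cardsT.
apply: (lifting adv_step adv_end' par parf htau hg1 hg heps hTheta (p := p') st T0 T0).
- by rewrite setU0.
- have r2r : r <= 2 * r2 by have := par_rr2 par; move: r0; lra.
  have i0 x : 0 <= ind R [set: Om] x by rewrite /ind ler0n.
  exact: (dense_weak (ltW r0) r2r i0 (@dense_setT _)).
- exact: dense_setT.
- by move=> x y xT yT; case: (hp' x y xT yT).
rewrite cards0 expr0 mul1r lp /density vol0 cardsT divff ?mulr1; last first.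
  by rewrite pnatr_eq0 -lt0n.
apply: (@le_trans _ _ (s%:R ^+ 10)).
  by apply: lerXn2r; rewrite ?nnegrE ?ler0n // ler_nat ltnW.
have s0 : 0 <= s%:R ^+ 10 :> R by rewrite exprn_ge0 ?ler0n.
have [Th0 _] := andP hTheta; have [_ rho1] := andP rho01.
have : Theta * rho <= Theta by rewrite ler_piMr.
by move: hs s0; lra.
Qed.

End Embedding.

(** * Rectangles of a total relation; the adversary *)

Lemma nat_leastP (A : nat -> Prop) : (exists k, A k) -> A (nat_least A).
Proof.
move=> [k Ak]; rewrite /nat_least; case: pselect => [exA|[]].
  by case: ex_minnP => i /asboolP.
by exists k; apply/asboolP.
Qed.

Lemma nat_least_le (A : nat -> Prop) k : A k -> (nat_least A <= k)%N.
Proof.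
move=> Ak; rewrite /nat_least; case: pselect => // exA.
by case: ex_minnP => i _; apply; apply/asboolP.
Qed.

(** Alice's input is identified by equality tests, then Bob's. This makes the sets of leaf counts
    nonempty, so that their least elements are attained. *)
Lemma protocol_exists (X Y : finType) (O : Type) (P : X -> Y -> O -> Prop) (o0 : O) :
  (forall x y, exists o, P x y o) ->
  exists p : protocol X Y O, forall x y, P x y (protocol_eval p x y).
Proof.
move=> tot.
have bob x0 (s : seq Y) : exists p : protocol X Y O,
    forall x y, y \in s -> P x0 y (protocol_eval p x y).
  elim: s => [|y0 s [p hp]]; first by exists (PLeaf _ _ o0) => x y; rewrite in_nil.
  have [ o ho] := tot x0 y0.
  exists (PBob (fun y => y == y0) p (PLeaf _ _ o)) => x y /=.
  by rewrite in_cons; case: eqP => [->|_ /hp //] _.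
have alice (s : seq X) : exists p : protocol X Y O,
    forall x y, x \in s -> P x y (protocol_eval p x y).
  elim: s => [|x0 s [p hp]]; first by exists (PLeaf _ _ o0) => x y; rewrite in_nil.
  have [p0 hp0] := bob x0 (enum Y).
  exists (PAlice (fun x => x == x0) p p0) => x y /=.
  rewrite in_cons; case: eqP => [-> _|_ /hp //].
  by apply: hp0; rewrite mem_enum.
have [p hp] := alice (enum X).
by exists p => x y; apply: hp; rewrite mem_enum.
Qed.

Section RectangleLeaves.

Variables (U V Rw : finType) (la : Rw -> pred U) (lb : Rw -> pred V) (i0 : Rw).
Hypothesis total : forall u v, exists i, ~~ la i u && ~~ lb i v.
Implicit Types (p : protocol U V Rw).

Definition solves_on p (S : {set U}) (S' : {set V}) := forall u v, u \in S -> v \in S' ->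
  ~~ la (protocol_eval p u v) u && ~~ lb (protocol_eval p u v) v.

(** Empty rectangles get 0, although a protocol always has a leaf: pairs outside the supports must
    not contribute to the sums. *)
Definition rect_leaves (S : {set U}) (S' : {set V}) := if (S == set0) || (S' == set0) then 0%N else
  nat_least (fun k => exists p, solves_on p S S' /\ protocol_leaves p = k).

Lemma rect_leaves0l S' : rect_leaves set0 S' = 0%N.
Proof. by rewrite /rect_leaves eqxx. Qed.

Lemma rect_leaves0r S : rect_leaves S set0 = 0%N.
Proof. by rewrite /rect_leaves eqxx orbT. Qed.

Lemma rect_leavesP S S' : S != set0 -> S' != set0 ->
  exists p, solves_on p S S' /\ protocol_leaves p = rect_leaves S S'.
Proof.
move=> /negbTE S0 /negbTE S0'; rewrite /rect_leaves S0 S0' /=.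
apply: (nat_leastP (A := fun k => exists p, solves_on p S S' /\ protocol_leaves p = k)).
have [p hp] := protocol_exists i0 total.
by exists (protocol_leaves p), p; split => // u v _ _.
Qed.

Lemma rect_leaves_le p S S' : solves_on p S S' -> (rect_leaves S S' <= protocol_leaves p)%N.
Proof. by move=> hp; rewrite /rect_leaves; case: ifP => // _; apply: nat_least_le; exists p. Qed.

Lemma rect_leaves_mono (S S1 : {set U}) (S' S1' : {set V}) : S \subset S1 -> S' \subset S1' ->
  (rect_leaves S S' <= rect_leaves S1 S1')%N.
Proof.
move=> /subsetP s /subsetP s'.
have [->|/set0Pn[u uS]] := eqVneq S set0; first by rewrite rect_leaves0l.
have [->|/set0Pn[v vS]] := eqVneq S' set0; first by rewrite rect_leaves0r.
have S10 : S1 != set0 by apply/set0Pn; exists u; apply: s.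
have S10' : S1' != set0 by apply/set0Pn; exists v; apply: s'.
have [p [hp <-]] := rect_leavesP S10 S10'.
by apply: rect_leaves_le => u' v' /s hu /s' hv; apply: hp.
Qed.

Lemma rect_leaves_subl (S S0 S1 : {set U}) (S' : {set V}) : S \subset S0 :|: S1 ->
  (rect_leaves S S' <= rect_leaves S0 S' + rect_leaves S1 S')%N.
Proof.
move=> s; have [->|S'0] := eqVneq S' set0; first by rewrite !rect_leaves0r.
have [e|S00] := eqVneq S0 set0.
  by rewrite e rect_leaves0l; apply: rect_leaves_mono; rewrite e set0U in s.
have [e|S10] := eqVneq S1 set0.
  by rewrite e rect_leaves0l addn0; apply: rect_leaves_mono; rewrite e setU0 in s.
have [p0 [hp0 <-]] := rect_leavesP S00 S'0; have [p1 [hp1 <-]] := rect_leavesP S10 S'0.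
apply: (@rect_leaves_le (PAlice (fun u => u \in S1) p0 p1)) => u v uS vS /=.
case: ifPn => uS1; first exact: hp1.
apply: hp0 => //; have := subsetP s _ uS; rewrite inE (negbTE uS1) orbF; exact.
Qed.

Lemma rect_leaves_subr (S' S0 S1 : {set V}) (S : {set U}) : S' \subset S0 :|: S1 ->
  (rect_leaves S S' <= rect_leaves S S0 + rect_leaves S S1)%N.
Proof.
move=> s; have [->|S'0] := eqVneq S set0; first by rewrite !rect_leaves0l.
have [e|S00] := eqVneq S0 set0.
  by rewrite e rect_leaves0r; apply: rect_leaves_mono; rewrite e set0U in s.
have [e|S10] := eqVneq S1 set0.
  by rewrite e rect_leaves0r addn0; apply: rect_leaves_mono; rewrite e setU0 in s.
have [p0 [hp0 <-]] := rect_leavesP S'0 S00; have [p1 [hp1 <-]] := rect_leavesP S'0 S10.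
apply: (@rect_leaves_le (PBob (fun u => u \in S1) p0 p1)) => u v uS vS /=.
case: ifPn => vS1; first exact: hp1.
apply: hp0 => //; have := subsetP s _ vS; rewrite inE (negbTE vS1) orbF; exact.
Qed.

(** Where neither player's input rules out row [i], the single leaf [i] is a correct protocol. *)
Lemma rect_leaves_kill i (S : {set U}) (S' : {set V}) :
  (rect_leaves S S' <= rect_leaves [set u in S | la i u] S' +
     rect_leaves S [set v in S' | lb i v] + 1)%N.
Proof.
set S0 := [set u in S | _]; set S1 := [set v in S' | _].
have h1 : (rect_leaves S S' <= rect_leaves S0 S' + rect_leaves (S :\: S0) S')%N.
  apply: rect_leaves_subl; apply/subsetP => u uS; rewrite !inE uS /=.
  by case: (la i u).
have h2 : (rect_leaves (S :\: S0) S' <=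
    rect_leaves (S :\: S0) S1 + rect_leaves (S :\: S0) (S' :\: S1))%N.
  apply: rect_leaves_subr; apply/subsetP => u uS; rewrite !inE uS /=.
  by case: (lb i u).
have h3 : (rect_leaves (S :\: S0) S1 <= rect_leaves S S1)%N.
  by apply: rect_leaves_mono; rewrite ?subxx // subsetDl.
have h4 : (rect_leaves (S :\: S0) (S' :\: S1) <= 1)%N.
  apply: (@rect_leaves_le (PLeaf _ _ i)) => u v /=; rewrite !inE.
  by case: (u \in S); case: (v \in S'); rewrite ?andbF //= !andbT => -> ->.
by apply: leq_trans h1 _; rewrite -addnA leq_add2l (leq_trans h2) // leq_add.
Qed.

End RectangleLeaves.

(** * The adversary against shallow decision trees *)

Section Adversary.

Variables (Rw : finType) (l : nat) (O : finType) (S : search_problem (cube 'I_l) O).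
Local Notation C := (Rw * 'I_l)%type.
Implicit Types (F : {set C}) (z : cube C).

(* No decision tree of depth less than [k] solves, in any row, the search problem
   restricted to the inputs that agree with [z] on [F]. *)
Definition adversary F z k := forall i (T : dtree l O), (dtree_depth T < k)%N ->
  exists2 zi : cube 'I_l, forall j, (i, j) \in F -> zi j = z (i, j) &
    dtree_eval T zi \notin S zi.

(** If neither answer is possible, a shallow tree succeeds after each of them. Both trees belong to
    the row [i0] of the query, as other rows do not see the answer, and a query of [j0] followed by
    these trees contradicts [hz]. *)
Lemma adversary_step F z k c : c \notin F -> adversary F z k ->
  exists2 w : cube C, {in F, w =1 z} & adversary (c |: F) w k.-1.
Proof.
case: c => i0 j0 cF hz; pose upd (b : bool) : cube C := [ffun c => if c == (i0, j0) then b else z c].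
have updF b : {in F, upd b =1 z}.
  by move=> c cF'; rewrite ffunE; case: eqP => // e; rewrite -e cF' in cF.
have upd0 b i j : i != i0 -> upd b (i, j) = z (i, j).
  by move=> ii0; rewrite ffunE xpair_eqE (negbTE ii0).
have [h1|/existsNP[i1 /existsNP[T1 /not_implyP[d1 h1]]]] :=
  pselect (adversary ((i0, j0) |: F) (upd true) k.-1).
  by exists (upd true).
have lek d : (d < k.-1)%N -> (d < k)%N by move=> h; apply: leq_trans h (leq_pred k).
have ext b i zi : i != i0 -> (forall j, (i, j) \in F -> zi j = z (i, j)) ->
    forall j, (i, j) \in (i0, j0) |: F -> zi j = upd b (i, j).
  move=> ii0 h j; rewrite !inE xpair_eqE (negbTE ii0) /= => /h ->.
  by rewrite upd0.
exists (upd false) => // i T dT.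
have [ii0|ii0] := eqVneq i i0; last first.
  by have [zi hzi bad] := hz i T (lek _ dT); exists zi => //; apply: ext.
rewrite {i}ii0; have [i10|i10] := eqVneq i1 i0; last first.
  have [zi hzi bad] := hz i1 T1 (lek _ d1).
  by case: h1; exists zi => //; apply: ext.
rewrite {i1}i10 in h1.
have [|zi hzi] := hz i0 (DQuery j0 T T1).
  by move: dT d1 => /=; move: (dtree_depth T) (dtree_depth T1) => d d'; lia.
rewrite /=; case e: (zi j0) => bad.
  case: h1; exists zi => // j; rewrite !inE => /orP[/eqP[->]|jF].
    by rewrite e ffunE eqxx.
  by rewrite hzi // updF.
exists zi => // j; rewrite !inE => /orP[/eqP[->]|jF]; first by rewrite e ffunE eqxx.
by rewrite hzi // updF.
Qed.

(** The output is a tree of depth 0, so it fails on some input of its row; w copies that input into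
    the row. *)
Lemma adversary_end F z k (o : Rw * O) : adversary F z k.+1 ->
  exists2 w : cube C, {in F, w =1 z} &
    forall w' : cube C, (forall c : C, c.1 = o.1 -> w' c = w c) ->
      ~ o.2 \in S [ffun j => w' (o.1, j)].
Proof.
move=> /(_ o.1 (DLeaf _ o.2) isT)[zi hzi /= bad].
exists [ffun c => if c.1 == o.1 then zi c.2 else z c].
  move=> [i j] cF; rewrite ffunE /=; case: eqP => // e; rewrite e; apply: hzi.
  by rewrite -e.
move=> w' hw'; suff -> : [ffun j => w' (o.1, j)] = zi by apply/negP.
by apply/ffunP => j; rewrite ffunE hw' // ffunE /= eqxx.
Qed.

Lemma adversary_start z : adversary set0 z (query_complexity S).
Proof.
move=> i T dT; have [[zi bad]|none] := pselect (exists zi, dtree_eval T zi \notin S zi).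
  by exists zi => // j; rewrite inE.
have : (query_complexity S <= dtree_depth T)%N.
  apply: nat_least_le; exists T; split => // zi.
  by apply/negPn/negP => bad; apply: none; exists zi.
by rewrite leqNgt dT.
Qed.

End Adversary.

(** * Discrepancy and the choice of parameters *)

Section RectangleGram.

Variables (R : realFieldType) (L : finType) (gd : L -> L -> bool) (D : R).
Local Notation s := (sgn R gd).
Hypothesis rect : forall A B : {set L}, `|\sum_(u in A) \sum_(v in B) s u v| <= D.

(** The two sign functions cut the square into four rectangles. *)
Lemma signed_rectangle (al be : pred L) :
  `|\sum_u \sum_v (-1) ^+ al u * (-1) ^+ be v * s u v| <= 4 * D.
Proof.
pose t (P Q : pred L) := \sum_(u | P u) \sum_(v | Q v) s u v.
have ht P Q : `|t P Q| <= D.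
  have -> : t P Q = \sum_(u in [set u | P u]) \sum_(v in [set v | Q v]) s u v.
    by apply: eq_big => u; rewrite ?inE // => _; apply: eq_bigl => v; rewrite inE.
  exact: rect.
have e0 u : \sum_v (-1) ^+ al u * (-1) ^+ be v * s u v =
    (-1) ^+ al u * (\sum_(v | ~~ be v) s u v - \sum_(v | be v) s u v).
  rewrite (bigID be) /= addrC mulrBr -mulrN !mulr_sumr -sumrN mulr_sumr; congr (_ + _);
    apply: eq_bigr => v bv.
    by rewrite (negbTE bv) expr0 mulr1.
  by rewrite bv expr1 mulrN1 mulNr mulrN.
have -> : \sum_u \sum_v (-1) ^+ al u * (-1) ^+ be v * s u v =
    t (predC al) (predC be) - t (predC al) be - (t al (predC be) - t al be).
  rewrite (eq_bigr _ (fun u _ => e0 u)) (bigID al) /= addrC /t -!sumrB -sumrN.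
  by congr (_ + _); apply: eq_bigr => u au; rewrite ?au ?(negbTE au) ?expr0 ?expr1 ?mul1r ?mulN1r.
have h1 := ht (predC al) (predC be); have h2 := ht (predC al) be.
have h3 := ht al (predC be); have h4 := ht al be.
apply: le_trans (ler_normB _ _) _.
apply: le_trans (lerD (ler_normB _ _) (ler_normB _ _)) _.
lra.
Qed.

(** Expanding the squares gives a sum over four variables. For fixed u' and v', two of the four
    signs depend on u alone and on v alone, so the sum over u and v is a signed rectangle sum. *)
Lemma gram_le_rectangle :
  \sum_v \sum_v' gram R gd v v' ^+ 2 <= 4 * D * #|L|%:R ^+ 2.
Proof.
have -> : \sum_v \sum_v' gram R gd v v' ^+ 2 =
   \sum_u' \sum_v' s u' v' * \sum_u \sum_v (-1) ^+ gd u v' * (-1) ^+ gd u' v * s u v.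
  rewrite exchange_big [RHS]exchange_big /=; apply: eq_bigr => v' _.
  rewrite (eq_bigr (fun v => \sum_u' \sum_u s u v * s u v' * (s u' v * s u' v'))) => [|v _].
    rewrite exchange_big; apply: eq_bigr => u' _; rewrite mulr_sumr exchange_big.
    by apply: eq_bigr => u _; rewrite mulr_sumr; apply: eq_bigr => v _; rewrite /sgn; ring.
  rewrite expr2 {1}/gram mulr_suml exchange_big; apply: eq_bigr => u _.
  by rewrite /gram mulr_sumr.
rewrite expr2 -natrM -[leRHS]mulr1 -mulrA mulr1 natrM -sum_const2.
apply: ler_sum => u' _; apply: ler_sum => v' _.
apply: le_trans (signed_rectangle (fun u => gd u v') (gd u')).
by apply: le_trans (ler_norm _) _; rewrite normrM {1}/sgn normr_sign mul1r.
Qed.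

End RectangleGram.

Lemma rectangle_disc (R : realType) (t : nat) (gd : cube 'I_t -> cube 'I_t -> bool)
    (A B : {set cube 'I_t}) :
  `|\sum_(u in A) \sum_(v in B) sgn R gd u v| <= disc R gd * #|cube 'I_t|%:R ^+ 2.
Proof.
have T0 : (#|cube 'I_t|%:R ^+ 2 : R) != 0.
  by rewrite expf_neq0 // pnatr_eq0 card_ffun card_bool expn_eq0.
have e b : prob_rect R gd b A B * #|cube 'I_t|%:R ^+ 2 =
    \sum_(u in A) \sum_(v in B) (gd u v == b)%:R.
  rewrite /prob_rect card_prod natrM -expr2 divfK // -sum1_card natr_sum.
  rewrite pair_big /= big_mkcond [RHS]big_mkcond; apply: eq_bigr => -[u v] _ /=.
  by rewrite inE /=; case: (u \in A); case: (v \in B); case: (gd u v == b).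
have -> : \sum_(u in A) \sum_(v in B) sgn R gd u v =
    (prob_rect R gd false A B - prob_rect R gd true A B) * #|cube 'I_t|%:R ^+ 2.
  rewrite mulrBl !e -sumrB; apply: eq_bigr => u _; rewrite -sumrB; apply: eq_bigr => v _.
  by rewrite /sgn; case: (gd u v); rewrite /= ?subr0 ?sub0r ?expr0 ?expr1.
rewrite normrM [`|_ ^+ 2|]ger0_norm ?sqr_ge0 // ler_wpM2r ?sqr_ge0 //.
exact: (le_bigmax _ (fun AB => disc_rect R gd AB.1 AB.2) (A, B)).
Qed.

Lemma gram_le_disc (R : realType) (t : nat) (gd : cube 'I_t -> cube 'I_t -> bool) :
  \sum_v \sum_v' gram R gd v v' ^+ 2 <= 4 * disc R gd * #|cube 'I_t|%:R ^+ 4.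
Proof.
apply: le_trans (gram_le_rectangle (@rectangle_disc R t gd)) _.
by rewrite (exprD _ 2 2) !mulrA.
Qed.

Lemma gram_flip_le_disc (R : realType) (t : nat) (gd : cube 'I_t -> cube 'I_t -> bool) :
  \sum_v \sum_v' gram R (flip gd) v v' ^+ 2 <= 4 * disc R gd * #|cube 'I_t|%:R ^+ 4.
Proof.
have rect (A B : {set cube 'I_t}) : `|\sum_(u in A) \sum_(v in B) sgn R (flip gd) u v| <=
    disc R gd * #|cube 'I_t|%:R ^+ 2.
  by rewrite exchange_big; apply: rectangle_disc.
apply: le_trans (gram_le_rectangle rect) _.
by rewrite (exprD _ 2 2) !mulrA.
Qed.

Section SumBound.

Variables (R : realFieldType) (C : finType).

Lemma sum_expr_card (a : R) : \sum_(I : {set C}) a ^+ #|I| = (1 + a) ^+ #|C|.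
Proof.
rewrite -cardsT; have := prod1D [set: C] (fun=> a); rewrite prodr_const => ->.
by apply: eq_big => [I|I _]; rewrite ?subsetT ?prodr_const.
Qed.

Lemma expr1D_le (a : R) n : 0 <= a -> 2 * n%:R * a <= 1 -> (1 + a) ^+ n <= 1 + 2 * n%:R * a.
Proof.
move=> a0; elim: n => [|n IHn] h; first by rewrite expr0 mulr0 mul0r addr0.
rewrite -[n.+1%:R]natr1 mulrDr mulrDl mulr1 in h *; rewrite exprS.
have h' : 2 * n%:R * a <= 1 by lra.
apply: (@le_trans _ _ ((1 + a) * (1 + 2 * n%:R * a))).
  by rewrite ler_wpM2l ?IHn // addr_ge0.
have : a * (2 * n%:R * a) <= a by rewrite ler_piMr.
lra.
Qed.

(* [(r ^+ j / (tau ^+ i * r2 ^+ j)) ^+ e] dominates the indicator of the pairs (I, J) with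
   [tau ^+ i * r2 ^+ j < r ^+ j], where i and j are the sizes of I and J. *)
Lemma sum_relevant (tau sigma r r2 T : R) (e : nat)
    (A := sigma / tau ^+ (2 + e)) (B := T ^+ 3 * (r / r2) ^+ e) :
  0 < tau -> 0 < r -> 0 < r2 -> 0 <= sigma -> 0 <= T ->
  2 * #|C|%:R * A <= 1 -> 2 * #|C|%:R * B <= 1 ->
  \sum_(I : {set C} | I != set0)
    \sum_(J : {set C} | tau ^+ #|I| * r2 ^+ #|J| < r ^+ #|J|)
      (sigma / tau ^+ 2) ^+ #|I| * T ^+ (3 * #|J|) <= 4 * #|C|%:R * A.
Proof.
move=> tau0 r0 r20 s0 T0 hA hB.
have A0 : 0 <= A by rewrite divr_ge0 // exprn_ge0 // ltW.
have B0 : 0 <= B by rewrite mulr_ge0 ?exprn_ge0 // divr_ge0 // ltW.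
apply: (@le_trans _ _ (\sum_(I : {set C} | I != set0) A ^+ #|I| * (1 + B) ^+ #|C|)).
  apply: ler_sum => I _; rewrite -sum_expr_card mulr_sumr [leLHS]big_mkcond.
  apply: ler_sum => J _; case: ifP => [hIJ|_]; last by rewrite mulr_ge0 ?exprn_ge0.
  set i := #|I| in hIJ *; set j := #|J| in hIJ *.
  have c0 : 0 < tau ^+ i * r2 ^+ j by rewrite mulr_gt0 ?exprn_gt0.
  have -> : A ^+ i * B ^+ j = (sigma / tau ^+ 2) ^+ i * T ^+ (3 * j) *
      (r ^+ j / (tau ^+ i * r2 ^+ j)) ^+ e.
    have -> : A ^+ i = (sigma / tau ^+ 2) ^+ i / (tau ^+ i) ^+ e.
      by rewrite /A exprD invfM mulrA exprMn exprVn -!exprM [(e * i)%N]mulnC.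
    have -> : B ^+ j = T ^+ (3 * j) * ((r ^+ j) ^+ e / (r2 ^+ j) ^+ e).
      by rewrite /B exprMn -!exprM -expr_div_n [(e * j)%N]mulnC.
    have aux (u v x y z : R) : u * v * (x * (y * z)) = u * x * (y * (v * z)) by ring.
    have -> : (r ^+ j / (tau ^+ i * r2 ^+ j)) ^+ e =
        (r ^+ j) ^+ e * (((tau ^+ i) ^+ e)^-1 * ((r2 ^+ j) ^+ e)^-1).
      by rewrite expr_div_n exprMn invfM.
    exact: aux.
  apply: ler_peMr; first by rewrite mulr_ge0 // exprn_ge0 // divr_ge0 // exprn_ge0 // ltW.
  by rewrite exprn_ege1 // ler_pdivlMr // mul1r ltW.
rewrite -mulr_suml.
have -> : \sum_(I : {set C} | I != set0) A ^+ #|I| = (1 + A) ^+ #|C| - 1.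
  rewrite -sum_expr_card [in RHS](bigD1 set0) //= cards0 expr0 addrC addrK //.
have hA' := expr1D_le A0 hA; have hB' := expr1D_le B0 hB.
have A1 : 0 <= (1 + A) ^+ #|C| - 1 by rewrite subr_ge0 exprn_ege1 // lerDl.
apply: (@le_trans _ _ ((2 * #|C|%:R * A) * 2)); last by lra.
apply: ler_pM => //; last by lra.
  by rewrite exprn_ge0 // addr_ge0.
by move: hA'; lra.
Qed.

End SumBound.

(** * The parameters as powers of the gadget size *)

Definition bits (R : realType) (t : nat) (a : R) : R := 2 `^ (a * t%:R).

Section Bits.

Variables (R : realType) (t : nat).
Local Notation E := (bits t).
Implicit Types a b : R.

Lemma bits_gt0 a : 0 < E a.
Proof. by rewrite powR_gt0. Qed.

Lemma bitsD a b : E (a + b) = E a * E b.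
Proof. by rewrite /bits mulrDl powRD // pnatr_eq0 implybT. Qed.

Lemma bits0 : E (0 : R) = 1.
Proof. by rewrite /bits mul0r powRr0. Qed.

Lemma bitsN a : E (- a) = (E a)^-1.
Proof. by rewrite /bits mulNr powRN. Qed.

Lemma bits_le a b : a <= b -> E a <= E b.
Proof. by move=> ab; rewrite /bits ler_powR ?ler1n // ler_wpM2r. Qed.

Lemma bits_ge1 a : 0 <= a -> 1 <= E a.
Proof. by move=> a0; rewrite -bits0 bits_le. Qed.

Lemma bits1 : E (1 : R) = 2 ^+ t.
Proof. by rewrite /bits mul1r powR_mulrn. Qed.

Lemma bitsX a k : E a ^+ k = E (a * k%:R).
Proof. by rewrite -powR_mulrn ?(ltW (bits_gt0 a)) // /bits -powRrM mulrAC. Qed.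

Lemma bits_card : #|cube 'I_t|%:R = E (1 : R).
Proof. by rewrite bits1 card_ffun card_bool card_ord natrX. Qed.

End Bits.

Lemma double_le (a b : nat) : (0 < a)%N -> (a <= b)%N -> ((2 * a).+2 <= 4 * b)%N.
Proof. lia. Qed.

Section Constants.

Variables (R : realType) (C : finType) (t q e : nat) (delta : R).
Local Notation E := (bits t).
Local Notation n := (#|C|%:R : R).
Hypotheses (t_gt0 : (0 < t)%N) (q_gt0 : (0 < q)%N) (q_le : (q <= #|C|)%N).
Hypotheses (delta_gt0 : 0 < delta) (delta_le : 20 * delta <= 1) (he : 5 <= delta * e%:R).
Hypothesis n_small : (12 * n) ^+ (e + 5) <= E (delta / 2).
Hypothesis t_small : 16 * (16 * t%:R) <= E (delta / 2).

(** [tau_val] keeps $(1+\tau)^n \le 4/3$. The densities [r1_val], [r_val], [r2_val] are a factor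
    $2^{\delta t}$ apart. The square of [h_val] is the Gram bound for discrepancy $2^{-20\delta t}$,
    and then $2 r_2 r h = 4\cdot 2^{-5\delta t}$ stays below $(\sigma\tau)^2 = 4\cdot 2^{-4\delta
    t}$. *)
Definition tau_val : R := (6 * n)^-1.
Definition sigma_val : R := 12 * n * E (- (2 * delta)).
Definition r1_val : R := E (- (1 - delta)).
Definition r_val : R := E (- (1 - 2 * delta)).
Definition r2_val : R := E (- (1 - 3 * delta)).
Definition h_val : R := 2 * E 2 * E (- (10 * delta)).
Definition eps_val : R := 4 * n * (sigma_val / tau_val ^+ (2 + e)).

Let n1 : 1 <= n. Proof. by rewrite ler1n (leq_trans q_gt0). Qed.
Let n0 : 0 < n. Proof. by apply: lt_le_trans n1. Qed.
Let t1 : 1 <= t%:R :> R. Proof. by rewrite ler1n. Qed.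
Let E0 (a : R) : 0 < E a := bits_gt0 t a.

Let n12 : 12 * n <= E (delta / 2).
Proof.
apply: le_trans n_small; rewrite addnS exprS ler_peMr ?mulr_ge0 ?ler0n //.
by rewrite exprn_ege1 //; move: n1; lra.
Qed.

Let big : 16 <= E (delta / 2).
Proof. by apply: le_trans t_small; have := t1; lra. Qed.

Let big_le (a : R) : delta / 2 <= a -> 16 <= E a.
Proof. by move=> h; apply: le_trans big _; apply: bits_le. Qed.

Lemma rounds_le (K := (2 * (q * t))%N) : K.+2%:R <= 4 * (n * t%:R) :> R.
Proof.
rewrite -!natrM ler_nat; apply: double_le; first by rewrite muln_gt0 q_gt0.
by rewrite leq_mul2r q_le orbT.
Qed.

Let sigma_tau : sigma_val * tau_val = 2 * E (- (2 * delta)).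
Proof. by rewrite /sigma_val /tau_val; field; rewrite gt_eqF. Qed.

(** The exponent [e + 5] of [n_small] counts the factors n: two explicit ones, one in [sigma_val],
    and [2 + e] in the power of [tau_val]. *)
Let A_le : 16 * (16 * t%:R) * n * n * (sigma_val / tau_val ^+ (2 + e)) <= 1.
Proof.
have : (e + 5 = 3 + (2 + e))%N by rewrite addnC addnA.
move: (2 + e)%N => k ek.
have -> : sigma_val / tau_val ^+ k = 12 * n * (6 * n) ^+ k * E (- (2 * delta)).
  by rewrite /sigma_val /tau_val exprVn invrK; ring.
apply: (@le_trans _ _ (16 * (16 * t%:R) * (12 * n) ^+ (e + 5) * E (- (2 * delta)))).
  rewrite mulrA ler_wpM2r ?(ltW (E0 _)) // -!(mulrA (16 * (16 * t%:R))).
  rewrite ler_wpM2l ?mulr_ge0 ?ler0n // !mulrA.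
  have nn : 0 <= 6 * n by rewrite mulr_ge0 ?ler0n.
  rewrite ek [leRHS]exprD; apply: ler_pM.
  - by rewrite !mulr_ge0 ?ler0n.
  - by rewrite exprn_ge0.
  - rewrite exprMn !exprS expr0; have : 0 <= n * n * n by rewrite !mulr_ge0 ?ler0n.
    by lra.
  - by apply: lerXn2r; rewrite ?nnegrE ?mulr_ge0 ?ler0n // ler_wpM2r ?ler0n // ler_nat.
apply: (@le_trans _ _ (E (delta / 2) * E (delta / 2) * E (- (2 * delta)))).
  by rewrite ler_wpM2r ?(ltW (E0 _)) //; apply: ler_pM.
rewrite -!bitsD; apply: (@le_trans _ _ (E 0)); last by rewrite bits0.
by apply: bits_le; move: delta_gt0; lra.
Qed.

Let A0 : 0 <= sigma_val / tau_val ^+ (2 + e).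
Proof.
rewrite divr_ge0 ?exprn_ge0 ?invr_ge0 ?mulr_ge0 ?ler0n //.
exact: ltW.
Qed.

Lemma eps_rounds (K := (2 * (q * t))%N) : 16 * K.+2%:R * eps_val <= 1.
Proof.
apply: le_trans A_le; rewrite /eps_val; have := A0; move: (sigma_val / _) => u u0.
have -> : 16 * (16 * t%:R) * n * n * u = 16 * (4 * (n * t%:R)) * (4 * n * u) by ring.
apply: ler_wpM2r; first by rewrite mulr_ge0 // mulr_ge0 ?ler0n.
by rewrite ler_wpM2l // rounds_le.
Qed.

Lemma parameters_hold (gd : cube 'I_t -> cube 'I_t -> bool) :
  \sum_v \sum_v' gram R gd v v' ^+ 2 <= 4 * E (- (20 * delta)) * #|cube 'I_t|%:R ^+ 4 ->
  params C gd h_val tau_val r_val r2_val sigma_val eps_val.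
Proof.
move=> hgram; have d0 := delta_gt0; have d1 := delta_le.
have tau0 : 0 < tau_val by rewrite invr_gt0 mulr_gt0.
have sigma0 : 0 < sigma_val by rewrite mulr_gt0 // mulr_gt0.
have hh : h_val = 2 * E (2 - 10 * delta) by rewrite /h_val -mulrA -bitsD.
split => //.
- by rewrite card_ffun card_bool expn_gt0.
- by rewrite /h_val !mulr_ge0 // ltW.
- apply: le_trans hgram _; rewrite hh bits_card bitsX exprMn bitsX -mulrA -bitsD.
  have -> : (2 : R) ^+ 2 = 4 by ring.
  by rewrite ler_wpM2l //; apply: bits_le; lra.
- by rewrite invf_le1 ?mulr_gt0 //; move: n1; lra.
- exact: E0.
- by apply: bits_le; lra.
- rewrite /r2_val bitsN ler_pdivrMr // mul1r; have : 16 <= E (1 - 3 * delta) by apply: big_le; lra.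
  lra.
- by rewrite bits_card /r2_val -bitsD bits_ge1 //; lra.
- rewrite /sigma_val bitsN ler_pdivrMr // mul1r; apply: le_trans n12 _; apply: bits_le; lra.
- rewrite sigma_tau hh exprMn bitsX /r2_val /r_val.
  have -> : 2 * E (- (1 - 3 * delta)) * E (- (1 - 2 * delta)) * (2 * E (2 - 10 * delta)) =
     2 ^+ 2 * (E (- (1 - 3 * delta)) * E (- (1 - 2 * delta)) * E (2 - 10 * delta)) by ring.
  by rewrite -!bitsD ler_wpM2l //; apply: bits_le; lra.
- apply: sum_relevant => //; [exact: E0|exact: E0|exact: ltW| |].
    apply: le_trans A_le; apply: ler_wpM2r => //; apply: ler_wpM2r => //.
    have : n <= t%:R * n by rewrite ler_peMl.
    by have := n1; lra.
  (* As $\delta e \ge 5$, the power [e] of $r/r_2$ is at most $2^{-5t}$. It cancels the cube of the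
     gadget size and leaves $2^{-2t}$ against [2 * n]. *)
  rewrite bits_card bitsX /r_val /r2_val -bitsN -bitsD bitsX -bitsD.
  have : 2 * n <= E 2.
    apply: (@le_trans _ _ (12 * n)); first by move: n1; lra.
    by apply: le_trans n12 _; apply: bits_le; lra.
  have : E (1 * 3%:R + (- (1 - 2 * delta) + - - (1 - 3 * delta)) * e%:R) <= E (- 2).
    by apply: bits_le; move: he; lra.
  rewrite [E (- 2)]bitsN => h1 h2; apply: le_trans (_ : E 2 * (E 2)^-1 <= 1).
    by apply: ler_pM; rewrite ?mulr_ge0 ?ler0n // ltW.
  by rewrite divff // gt_eqF.
Qed.

Lemma tau_small : (1 + tau_val) ^+ #|C| <= 4 / 3.
Proof.
have e2 : 2 * n * tau_val = 1 / 3 by rewrite /tau_val; field; rewrite gt_eqF.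
apply: le_trans (expr1D_le _ _) _; rewrite ?e2 //.
- by rewrite invr_ge0 mulr_ge0 ?ler0n.
- lra.
- lra.
Qed.

Lemma gap_le : 4 * E delta <= r_val * #|cube 'I_t|%:R.
Proof.
rewrite bits_card /r_val -bitsD.
have -> : - (1 - 2 * delta) + 1 = delta + delta by ring.
rewrite bitsD ler_wpM2r ?(ltW (E0 _)) //.
have : 16 <= E delta by apply: big_le; move: delta_gt0; lra.
lra.
Qed.

Lemma block_le : 16 <= r1_val * #|cube 'I_t|%:R.
Proof.
rewrite bits_card /r1_val -bitsD.
have : 16 <= E (- (1 - delta) + 1) by apply: big_le; move: delta_gt0; lra.
lra.
Qed.

Lemma r1_r (K := (2 * (q * t))%N) : 2 * K.+2%:R * r1_val <= r_val.
Proof.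
have -> : r_val = E delta * r1_val by rewrite /r_val /r1_val -bitsD; congr (bits _ _); ring.
rewrite ler_wpM2r ?(ltW (E0 _)) //.
have -> : E delta = E (delta / 2) * E (delta / 2) by rewrite -bitsD; congr (bits _ _); field.
apply: (@le_trans _ _ (12 * n * (16 * (16 * t%:R)))).
  apply: (@le_trans _ _ (2 * (4 * (n * t%:R)))); first by rewrite ler_wpM2l // rounds_le.
  have : 0 <= n * t%:R by rewrite mulr_ge0 ?ler0n.
  lra.
by apply: ler_pM => //; rewrite mulr_ge0 ?ler0n.
Qed.

Lemma r_lt1 : r_val < 1.
Proof.
have : 16 <= E (1 - 2 * delta) by apply: big_le; move: delta_le; lra.
by rewrite /r_val bitsN => h; rewrite invf_lt1 //; lra.
Qed.

End Constants.

(** * The composed problem *)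

Lemma dtree_full (l : nat) (O : finType) (S : search_problem (cube 'I_l) O) :
  total_search S -> (query_complexity S <= l)%N.
Proof.
move=> tot.
have full (s : seq 'I_l) (z0 : cube 'I_l) : exists2 T : dtree l O, (dtree_depth T <= size s)%N &
    forall z : cube 'I_l, (forall j, j \notin s -> z j = z0 j) -> dtree_eval T z \in S z.
  elim: s z0 => [|j s IHs] z0.
    have /set0Pn[ o oS] := tot z0; exists (DLeaf _ o) => // z hz /=.
    by suff -> : z = z0 by []; apply/ffunP => j; apply: hz.
  pose upd (b : bool) : cube 'I_l := [ffun i => if i == j then b else z0 i].
  have [T0 d0 h0] := IHs (upd false); have [T1 d1 h1] := IHs (upd true).
  exists (DQuery j T0 T1) => [|z hz]; first by rewrite /= ltnS geq_max d0.
  have hu i : i \notin s -> z i = upd (z j) i.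
    move=> si; rewrite ffunE; case: eqP => [-> //|/eqP ij].
    by apply: hz; rewrite in_cons negb_or ij.
  rewrite /=; case e: (z j) hu => hu; [exact: h1|exact: h0].
have [T dT hT] := full (enum 'I_l) [ffun=> false].
apply: leq_trans (_ : dtree_depth T <= l)%N; last by rewrite -[X in (_ <= X)%N]size_enum_ord.
by apply: nat_least_le; exists T; split => // z; apply: hT => j; rewrite mem_enum.
Qed.

Lemma mKW_total (I : finType) (h : cube I -> bool) : cube_monotone h ->
  forall (x : {x | h x}) (y : {y | ~~ h y}), exists i, i \in mKW h x y.
Proof.
move=> hm [x hx] [y hy]; have [/existsP[i xy]|/existsPn none] := boolP [exists i, (y i < x i)%N].
  by exists i; rewrite inE.
have : (h x <= h y)%N by apply: hm => i; have := none i; rewrite -leqNgt.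
by rewrite hx (negbTE hy).
Qed.

Lemma compose_monotone (m n : nat) (f : cube 'I_m -> bool) (g : cube 'I_n -> bool) :
  cube_monotone f -> cube_monotone g -> cube_monotone (compose f g).
Proof.
move=> hf hg x y xy; apply: hf => i; rewrite !ffunE.
by apply: hg => j; rewrite !ffunE; apply: xy.
Qed.

Lemma cube_nonconstant_witness (I : finType) (h : cube I -> bool) : cube_nonconstant h ->
  (exists x, h x) /\ (exists y, ~~ h y).
Proof.
move=> [x [y]]; case hx: (h x); case hy: (h y) => // _.
  by split; [exists x|exists y; rewrite hy].
by split; [exists y|exists x; rewrite hx].
Qed.

Section Composition.

Variables (m n l t : nat) (O : finType) (f : cube 'I_m -> bool) (g : cube 'I_n -> bool).
Variables (S : search_problem (cube 'I_l) O) (gd : cube 'I_t -> cube 'I_t -> bool).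
Hypotheses (fmono : cube_monotone f) (fnc : cube_nonconstant f).
Hypotheses (gmono : cube_monotone g) (gnc : cube_nonconstant g).
Hypothesis red : reduces (lift_search S gd) (mKW g).

Local Notation C := ('I_m * 'I_l)%type.
Local Notation U := {x : cube 'I_m | f x}.
Local Notation V := {y : cube 'I_m | ~~ f y}.
Local Notation Om := {ffun C -> cube 'I_t}.
Local Notation rowv := (fun (x : Om) i => [ffun j => x (i, j)]).

Let la i (u : U) := ~~ val u i.
Let lb i (v : V) := val v i.

Lemma outer_total (u : U) (v : V) : exists i, ~~ la i u && ~~ lb i v.
Proof.
have [i] := mKW_total fmono u v; rewrite inE => h; exists i; rewrite /la /lb.
by move: h; case: (val u i); case: (val v i).
Qed.

Lemma const_false : ~~ g [ffun=> false].
Proof.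
have [_ [y hy]] := cube_nonconstant_witness gnc.
have : (g [ffun=> false] <= g y)%N by apply: gmono => i; rewrite ffunE.
by rewrite (negbTE hy); case: (g _).
Qed.

Lemma const_true : g [ffun=> true].
Proof.
have [[x hx] _] := cube_nonconstant_witness gnc.
have : (g x <= g [ffun=> true])%N by apply: gmono => i; rewrite ffunE leq_b1.
by rewrite hx; case: (g _).
Qed.

(** Alice fills row i with her image under the reduction if $u_i = 1$ and with zeros otherwise; Bob
    with his image if $v_i = 0$ and with ones otherwise. Since g is 0 on all zeros and 1 on all
    ones, these are inputs of the composed problem. A coordinate where Alice has 1 and Bob 0 lies in
    a row with $u_i = 1$ and $v_i = 0$, where it solves the reduced instance of [mKW g]. *)
Lemma inner_protocol : exists p : protocol (U * Om) (V * Om) ('I_m * O),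
  protocol_leaves p = leaf_complexity (mKW (compose f g)) /\
  forall u v x y, let o := protocol_eval p (u, x) (v, y) in
    [/\ ~~ la o.1 u, ~~ lb o.1 v & o.2 \in S [ffun j => output gd x y (o.1, j)]].
Proof.
have [RA [RB [Rout hR]]] := red.
have ha (u : U) (x : Om) : compose f g
    [ffun c => if val u c.1 then val (RA (rowv x c.1)) c.2 else false].
  rewrite /compose (_ : [ffun i => _] = val u) ?(valP u) //.
  apply/ffunP => i; rewrite ffunE; case e: (val u i).
    rewrite (_ : [ffun j => _] = val (RA (rowv x i))) ?(valP (RA _)) //.
    by apply/ffunP => j; rewrite !ffunE /= e.
  apply/negbTE; rewrite (_ : [ffun j => _] = [ffun=> false]) ?const_false //.
  by apply/ffunP => j; rewrite !ffunE /= e.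
have hb (v : V) (y : Om) : ~~ compose f g
    [ffun c => if val v c.1 then true else val (RB (rowv y c.1)) c.2].
  rewrite /compose (_ : [ffun i => _] = val v) ?(valP v) //.
  apply/ffunP => i; rewrite ffunE; case e: (val v i).
    rewrite (_ : [ffun j => _] = [ffun=> true]) ?const_true //.
    by apply/ffunP => j; rewrite !ffunE /= e.
  apply/negbTE; rewrite (_ : [ffun j => _] = val (RB (rowv y i))) ?(valP (RB _)) //.
  by apply/ffunP => j; rewrite !ffunE /= e.
have cmono := compose_monotone fmono gmono.
have [[u0 hu0] [v0 hv0]] := cube_nonconstant_witness fnc.
have x0 : Om := [ffun=> [ffun=> false]].
pose alice (ux : U * Om) := exist (fun z => is_true (compose f g z)) _ (ha ux.1 ux.2).
pose bob (vy : V * Om) := exist (fun z => is_true (~~ compose f g z)) _ (hb vy.1 vy.2).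
have [c0 _] := mKW_total cmono (alice (exist _ u0 hu0, x0)) (bob (exist _ v0 hv0, x0)).
have [p1 hp1] := protocol_exists (P := fun x y o => o \in mKW (compose f g) x y) c0 (mKW_total cmono).
have [p [hp lp]] : exists p, protocol_solves p (mKW (compose f g)) /\
    protocol_leaves p = leaf_complexity (mKW (compose f g)).
  by apply: (nat_leastP (A := fun k => exists p, protocol_solves p _ /\ protocol_leaves p = k));
    exists (protocol_leaves p1), p1.
exists (protocol_map alice bob (fun c => (c.1, Rout c.2)) p).
split=> [|u v x y]; first by rewrite leaves_protocol_map.
rewrite /= eval_protocol_map /=.
have := hp (alice (u, x)) (bob (v, y)); case: (protocol_eval _ _ _) => i j.
have bl (b c : bool) : (b < c)%N -> c /\ ~~ b by case: b; case: c.
rewrite inE /= !ffunE /= /la /lb => /bl[].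
case: (val u i); case: (val v i) => //= ha' hb'; split => //.
have := hR (rowv x i) (rowv y i) j; rewrite /lift_search inE ha' (negbTE hb') => /(_ isT).
by congr (_ \in S _); apply/ffunP => k; rewrite !ffunE.
Qed.


(** The choice is $\rho = 1/X$, $K = 2qt$, $s \approx 4X$ and $\Theta = 8s^{10}X$. The bound $\Theta
    < 2^{\delta t q} = X^{12}$ explains the 12 and the 27: ten powers of X go into $s^{10}$, one
    into $1/\rho$, and the last one exceeds $8\cdot 5^{10} < 2^{27}$. *)
Lemma composed_bound (R : realType) (delta : R) (e : nat) (q := query_complexity S)
    (X := 2 `^ (delta / 12 * (q * t)%:R)) :
  total_search S -> (0 < t)%N -> (0 < q)%N -> 0 < delta -> 20 * delta <= 1 ->
  5 <= delta * e%:R -> (12 * (m * l)%:R) ^+ (e + 5) <= bits t (delta / 2) ->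
  16 * (16 * t%:R) <= bits t (delta / 2) -> disc R gd <= bits t (- (20 * delta)) ->
  2 ^+ 27 <= X ->
  (leaf_complexity (mKW f))%:R * X < 2 * (leaf_complexity (mKW (compose f g)))%:R.
Proof.
move=> tot t0 q0 d0 d1 he hn ht hdisc.
have d12 : delta / 12 <= 1 by lra.
have le5 (k : R) : k <= 4 * X -> 1 <= X -> k + 1 <= 5 * X by lra.
move=> hX.
have cardC : #|{: C}| = (m * l)%N by rewrite card_prod !card_ord.
rewrite -cardC in hn.
have [[u0' hu0] [v0' hv0]] := cube_nonconstant_witness fnc.
pose u0 : U := exist _ u0' hu0; pose v0 : V := exist _ v0' hv0.
have [i0 _] := outer_total u0 v0.
have qC : (q <= #|{: C}|)%N.
  rewrite cardC; apply: leq_trans (dtree_full tot) _; rewrite leq_pmull //.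
  by case: (i0) => i; case: (m).
have gram_bound (gd' : cube 'I_t -> cube 'I_t -> bool) :
    \sum_v \sum_v' gram R gd' v v' ^+ 2 <= 4 * disc R gd * #|cube 'I_t|%:R ^+ 4 ->
    \sum_v \sum_v' gram R gd' v v' ^+ 2 <= 4 * bits t (- (20 * delta)) * #|cube 'I_t|%:R ^+ 4.
  move=> h; apply: le_trans h _; apply: ler_wpM2r; first by rewrite exprn_ge0 ?ler0n.
  by rewrite ler_wpM2l.
have par := parameters_hold t0 q0 qC d0 d1 he hn ht (gram_bound _ (gram_le_disc R gd)).
have parf := parameters_hold t0 q0 qC d0 d1 he hn ht (gram_bound _ (gram_flip_le_disc R gd)).
have X0 : 0 < X by rewrite powR_gt0.
have X1 : 1 <= X by apply: le_trans hX; rewrite exprn_ege1 ?ler1n.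
pose s := (Num.truncn (4 * X)).+1.
have s4 : 4 * X <= s%:R by rewrite ltW // truncnS_gt.
have s5 : s%:R <= 5 * X.
  by rewrite /s -natr1 le5 // truncn_le mulr_ge0 // ltW.
pose Theta := 8 * s%:R ^+ 10 * X.
have Theta_lt : 0 <= Theta < bits t delta ^+ q.
  rewrite /Theta !mulr_ge0 ?exprn_ge0 ?ler0n ?(ltW X0) //=.
  have -> : bits t delta ^+ q = X ^+ 12.
    rewrite bitsX -powR_mulrn ?(ltW X0) // /X -powRrM /bits; congr (2 `^ _).
    by rewrite natrM; field.
  have h5 : 5 ^+ 10 < 2 ^+ 24 :> R by rewrite !exprS !expr0; lra.
  have h11 : 0 < X ^+ 11 by rewrite exprn_gt0.
  apply: (@le_lt_trans _ _ (8 * 5 ^+ 10 * X ^+ 11)).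
    rewrite [X ^+ 11]exprSr mulrA ler_wpM2r ?(ltW X0) // -mulrA -exprMn ler_wpM2l //.
    by apply: lerXn2r; rewrite ?nnegrE ?ler0n ?mulr_ge0 ?(ltW X0).
  rewrite [X ^+ 12]exprS ltr_pM2r //; apply: lt_le_trans hX.
  have -> : 2 ^+ 27 = 8 * 2 ^+ 24 :> R by rewrite -[27%N]/((3 + 24)%N) exprD; congr (_ * _); ring.
  by rewrite ltr_pM2l.
have hrho : 1 <= X^-1 ^+ 2 * 2 ^+ (2 * (q * t)).
  rewrite exprVn mulrC ler_pdivlMr ?exprn_gt0 // mul1r mulnC exprM.
  apply: lerXn2r; rewrite ?nnegrE ?(ltW X0) ?exprn_ge0 //.
  rewrite /X -powR_mulrn // ler_powR ?ler1n //; apply: ler_piMl; by rewrite ?ler0n.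
have [p [lp hp]] := inner_protocol.
have total := outer_total.
have rhoX : 0 < X^-1 <= 1 by rewrite invr_gt0 X0 invf_le1.
have K0 : (0 < 2 * (q * t))%N by rewrite !muln_gt0 q0.
have s1 : (1 < s)%N.
  rewrite -(ltr_nat R); apply: lt_le_trans s4; apply: (@lt_le_trans _ _ 4).
    by rewrite ltr_nat.
  by rewrite ler_peMr.
have rhos : 4 <= X^-1 * s%:R by rewrite ler_pdivlMl // mulrC.
have hs : 8 * s%:R ^+ 10 <= Theta * X^-1 by rewrite /Theta mulfK // gt_eqF.
have hg1 : 1 <= bits t delta by rewrite bits_ge1 // ltW.
have adv_step F (z : cube C) k c := @adversary_step _ l O S F z k c.
have adv_end F (z : cube C) k o := @adversary_end _ l O S F z k o.
have hcorrect : correct fst la lb (fun o (w : cube C) => o.2 \in S [ffun j => w (o.1, j)]) gd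
    p (fun=> setT) (fun=> setT).
  by move=> x y u v _ _; apply: hp.
have := embedding (mu := rect_leaves la lb) (row := fst) (rect_leaves0l la lb)
  (rect_leaves0r la lb) (rect_leaves_subl i0 total) (rect_leaves_subr i0 total)
  (rect_leaves_kill i0 total) (@rect_leaves_le _ _ _ la lb) adv_step adv_end
  (@adversary_start _ l O S [ffun=> false]) par parf (tau_small R q0 qC) hg1
  (gap_le t0 d0 ht) Theta_lt rhoX hrho K0 s1 rhos hs (bits_gt0 t (- (1 - delta)))
  (block_le t0 d0 ht) (r1_r t0 q0 qC hn ht) (r_lt1 t0 d1 ht)
  (eps_rounds t0 q0 qC d0 hn ht) u0 v0 hcorrect.
rewrite lp => hmu.
have U0 : [set: U] != set0 by apply/set0Pn; exists u0; rewrite inE.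
have V0 : [set: V] != set0 by apply/set0Pn; exists v0; rewrite inE.
have [pf [hpf lpf]] := rect_leavesP i0 total U0 V0.
have hf : (leaf_complexity (mKW f) <= rect_leaves la lb [set: U] [set: V])%N.
  apply: nat_least_le; exists pf; split => // u v.
  have := hpf u v; rewrite !inE => /(_ isT isT); rewrite /la /lb.
  by case: (val u _); case: (val v _).
rewrite -(ler_nat R) in hf.
by rewrite -ltr_pdivlMr // mulrAC; apply: le_lt_trans hf hmu.
Qed.

End Composition.

Lemma leaf_complexity_mKW_gt0 (I : finType) (h : cube I -> bool) :
  cube_monotone h -> cube_nonconstant h -> (0 < leaf_complexity (mKW h))%N.
Proof.
move=> hm /cube_nonconstant_witness[[x hx] [y hy]].
have [i _] := mKW_total hm (exist _ x hx) (exist _ y hy).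
have [p hp] := protocol_exists (P := fun x y i => i \in mKW h x y) i (mKW_total hm).
have [p' [_ <-]] : exists p, protocol_solves p (mKW h) /\
    protocol_leaves p = leaf_complexity (mKW h).
  by apply: (nat_leastP (A := fun k => exists p, protocol_solves p _ /\ protocol_leaves p = k));
    exists (protocol_leaves p), p.
exact: protocol_leaves_gt0.
Qed.

(** * From factors to logarithms *)

Section Logarithms.

Variable R : realType.
Implicit Types x y : R.

Lemma ln2_gt0 : 0 < ln 2 :> R.
Proof. by rewrite ln_gt0 // ltr1n. Qed.

Lemma powR_log2 x : 0 < x -> 2 `^ (log2 x) = x.
Proof.
move=> x0; apply: ln_inj; rewrite ?posrE ?powR_gt0 //.
by rewrite ln_powR /log2 divfK // gt_eqF // ln2_gt0.
Qed.

Lemma log2_ge0 x : 1 <= x -> 0 <= log2 x.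
Proof. by move=> x1; rewrite divr_ge0 ?ln_ge0 ?ler1n. Qed.

Lemma powR2_ge x : x * ln 2 <= 2 `^ x.
Proof.
rewrite /powR pnatr_eq0 /=; apply: le_trans (expR_ge1Dx _).
by rewrite lerDr.
Qed.

Lemma log2_bound x y (a : R) : 0 < x -> 0 < y -> x * 2 `^ a < 2 * y ->
  log2 x + a - 1 <= log2 y.
Proof.
move=> x0 y0 h; have l0 := ln2_gt0.
have : ln (x * 2 `^ a) <= ln (2 * y).
  by rewrite ler_ln ?posrE ?mulr_gt0 ?powR_gt0 // ltW.
rewrite !lnM ?posrE ?powR_gt0 // ln_powR => hl.
rewrite /log2 ler_pdivlMr // mulrBl mulrDl divfK ?gt_eqF // mul1r.
by move: hl; lra.
Qed.

End Logarithms.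

Lemma truncnS_ge (R : realType) (x : R) : x <= (Num.truncn x).+1%:R.
Proof. by rewrite ltW // truncnS_gt. Qed.

Unset Implicit Arguments.
Set Strict Implicit.
Set Printing Implicit Defensive.

Theorem theorem3p1 (R : realType) (eta : R) (heta : 0 < eta) :
  exists (c : nat) (kappa : R) (N0 : nat), 0 < kappa /\
    forall (m n : nat) (f : cube 'I_m -> bool) (g : cube 'I_n -> bool),
      cube_monotone f -> cube_nonconstant f ->
      cube_monotone g -> cube_nonconstant g ->
    forall (l : nat) (O : finType) (S : search_problem (cube 'I_l) O)
           (t : nat) (gd : cube 'I_t -> cube 'I_t -> bool),
      total_search S ->
      c%:R * log2 ((m * l)%N%:R : R) <= t%:R ->
      disc R gd <= 2 `^ (- (eta * t%:R)) ->
      reduces (lift_search S gd) (mKW g) ->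
      (N0 <= query_complexity S * t)%N ->
      log2 ((leaf_complexity (mKW f))%:R : R)
        + kappa * (query_complexity S * t)%N%:R
      <= log2 ((leaf_complexity (mKW (compose f g)))%:R : R).
Proof.
pose delta := Num.min eta 1 / 20; have eta1 : 20 * delta = Num.min eta 1 by rewrite /delta; field.
have d0 : 0 < delta by rewrite divr_gt0 // lt_min heta ltr01.
have d1 : 20 * delta <= 1 by rewrite eta1 ge_min lexx orbT.
have deta : 20 * delta <= eta by rewrite eta1 ge_min lexx.
have l20 : 0 < ln 2 :> R := ln2_gt0 R.
move: delta d0 d1 deta {eta1} => delta d0 d1 deta.
(* With this [b], $bt \le 2^{\delta t/4}$ holds for every $t$. *)
pose b := delta / 4 * ln 2; have b0 : 0 < b by rewrite mulr_gt0 // divr_gt0.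
pose e := (Num.truncn (5 / delta)).+1.
have he : 5 <= delta * e%:R by rewrite -ler_pdivrMl // mulrC truncnS_ge.
(* [k] is the power of $ml$ that the parameters need, and [c] makes $(ml)^k \le 2^{\delta t/4}$. *)
pose k := (e + 5)%N; pose c := (Num.truncn (k%:R * (4 / delta))).+1.
have hc : k%:R <= delta / 4 * c%:R.
  have -> : k%:R = delta / 4 * (k%:R * (4 / delta)) by field; rewrite gt_eqF.
  by rewrite ler_pM2l ?divr_gt0 // truncnS_ge.
pose M := 12 ^+ k + 16 * 16 / b; pose t0 := (Num.truncn (M / b)).+1.
have ht0 (t : nat) : (t0 <= t)%N -> M <= b * t%:R.
  move=> tt; rewrite -ler_pdivrMl // mulrC; apply: le_trans (truncnS_ge _) _.
  by rewrite ler_nat.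
pose N1 := (Num.truncn (27 * (12 / delta))).+1.
(* The summand [2 ^ t0 * t0] excludes short gadgets, and [N1] makes the gain $\delta qt/12$ at least
   27. Half of this gain is given up to absorb the lost bit in [log2_bound], whence [delta / 24]. *)
exists c, (delta / 24), (2 ^ t0 * t0 + N1)%N; split; first by rewrite divr_gt0.
move=> m n f g fm fnc gm gnc l O S t gd tot hct hdisc red.
set q := query_complexity S => hN.
have qt1 : (N1 <= q * t)%N by apply: leq_trans hN; rewrite leq_addl.
have qt0 : (0 < q * t)%N by apply: leq_trans qt1.
have [q0 t_gt0] : (0 < q)%N /\ (0 < t)%N by apply/andP; rewrite -muln_gt0.
have ql : (q <= l)%N by apply: dtree_full.
have m0 : (0 < m)%N.
  case: (fnc) => x [y xy]; rewrite lt0n; apply/eqP => m0; apply: xy; congr (f _).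
  by apply/ffunP => i; move: (ltn_ord i); rewrite [X in (_ < X)%N]m0.
have ml0 : (0 < m * l)%N by rewrite muln_gt0 m0 (leq_trans q0).
pose N := (m * l)%N%:R : R; pose lg := log2 N.
have N1' : 1 <= N by rewrite ler1n.
have lg0 : 0 <= lg by apply: log2_ge0.
have NE : N = 2 `^ lg by rewrite powR_log2 // (lt_le_trans ltr01).
have Nk : N ^+ k <= bits t (delta / 4).
  rewrite NE -powR_mulrn ?powR_ge0 // -powRrM ler_powR ?ler1n //.
  apply: (@le_trans _ _ (delta / 4 * (c%:R * lg))).
    by rewrite mulrA mulrC ler_wpM2r.
  by rewrite ler_wpM2l // ltW // divr_gt0.
(* A short gadget bounds everything: $q \le l \le ml \le 2^t$ because [c] is at least 1, so $qt$
   would be below the threshold. *)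
have tt0 : (t0 <= t)%N.
  rewrite leqNgt; apply/negP => tt.
  have Nt : (m * l <= 2 ^ t)%N.
    rewrite -(ler_nat R) natrX -/N NE -powR_mulrn // ler_powR ?ler1n //.
    by apply: le_trans hct; rewrite ler_peMl // ler1n.
  suff : (q * t < 2 ^ t0 * t0 + N1)%N by rewrite ltnNge hN.
  rewrite addnS ltnS; apply: leq_trans (leq_addr _ _); apply: leq_mul; last exact: ltnW.
  apply: leq_trans ql _; apply: leq_trans (_ : m * l <= _)%N; first by rewrite leq_pmull.
  by apply: leq_trans Nt _; rewrite leq_exp2l // ltnW.
have E4 : M <= bits t (delta / 4).
  apply: le_trans (ht0 t tt0) _; apply: le_trans (powR2_ge _).
  by rewrite /b mulrAC.
have E4t : b * t%:R <= bits t (delta / 4).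
  by apply: le_trans (powR2_ge _); rewrite /b mulrAC.
have E2 : bits t (delta / 2) = bits t (delta / 4) * bits t (delta / 4).
  by rewrite -bitsD; congr (bits _ _); field.
have hn : (12 * N) ^+ (e + 5) <= bits t (delta / 2).
  rewrite -/k exprMn E2; apply: ler_pM => //; rewrite ?exprn_ge0 ?ler0n //.
  by apply: le_trans E4; rewrite lerDl divr_ge0 // ltW.
have ht : 16 * (16 * t%:R) <= bits t (delta / 2).
  have -> : 16 * (16 * t%:R) = 16 * 16 / b * (b * t%:R) by field; rewrite gt_eqF.
  rewrite E2; apply: ler_pM => //.
  - by rewrite divr_ge0 // ltW.
  - by rewrite mulr_ge0 // ltW.
  - by apply: le_trans E4; rewrite lerDr exprn_ge0.
have hdisc' : disc R gd <= bits t (- (20 * delta)).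
  apply: le_trans hdisc _; rewrite -mulNr ler_powR ?ler1n // ler_wpM2r ?ler0n //.
  by rewrite lerN2.
have qt27 : 27 <= delta / 12 * (q * t)%:R.
  have -> : 27 = delta / 12 * (27 * (12 / delta)) by field; rewrite gt_eqF.
  rewrite ler_pM2l ?divr_gt0 //; apply: le_trans (truncnS_ge _) _.
  by rewrite ler_nat.
have hX : 2 ^+ 27 <= 2 `^ (delta / 12 * (q * t)%:R).
  by rewrite -powR_mulrn // ler_powR ?ler1n.
have := composed_bound fm fnc gm gnc red tot t_gt0 q0 d0 d1 he hn ht hdisc' hX.
rewrite -/q; set Lf := (leaf_complexity _)%:R; set Lc := (leaf_complexity _)%:R.
set a := delta / 12 * _ in qt27 hX *; move=> h.
have Lf0 : 0 < Lf by rewrite ltr0n leaf_complexity_mKW_gt0.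
have Lc0 : 0 < Lc.
  rewrite -(pmulr_rgt0 _ (ltr0Sn R 1)); apply: lt_trans h.
  by rewrite mulr_gt0 // powR_gt0.
have := log2_bound Lf0 Lc0 h.
have -> : delta / 24 * (q * t)%:R = a / 2 by rewrite /a; field.
by move: qt27 {hX h}; lra.
Qed.
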